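(* Let $n\ge1$, $m\ge 0$ be integers, and let $\sigma:(\tilde X,E)\to(X,x)$ and $\pi:(\mathbb C^2,0)\to(X,x)$ be the minimal resolution and the smoothing of the $A_n$ singularity germ $(X,x)$. Then: (a) The maximal divisor $D$ such that $$H^0(\tilde X\setminus E,S^m\Omega^1_{\tilde X})=H^0\left(\tilde X,S^m\Omega^1_{\tilde X}(\log E)\otimes\mathcal O_{\tilde X}(-D)\right)$$ is given by $$D=\sum_{r=1}^n\left(\sum_{j=0}^{\min(r-1,\,n-r)}\left\lceil\frac{m-2j}{n+1}\right\rceil\right)E_r,$$ where $E=\bigcup_{r=1}^nE_r$ is the exceptional locus, with components ordered such that $E_r\cap E_{r+1}\neq\emptyset$. (b) Let $w\in H^0(X\setminus\{x\},S^m\Omega^1_X)$ and let $\bar w\in H^0(\mathbb C^2,S^m\Omega^1_{\mathbb C^2})$ be such that $\bar w|_{\mathbb C^2\setminus 0}=\pi^*w$. Set $\operatorname{ord}(w):=\max\{i : \bar w\in\mathfrak m^iS^m\Omega^1_{\mathbb C^2}\}$, where $\mathfrak m$ is the maximal ideal at $0$. Then $\sigma^*w$ extends holomorphically to $\tilde X$ if $\operatorname{ord}(w)\ge nm$.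
   Context: Everything is over $\mathbb C$. The $A_n$ singularity is the germ at the origin of $X=\{xz-y^{n+1}=0\}\subset\mathbb C^3$. The ''smoothing'' $\pi:\mathbb C^2\to X$ is the quotient map $\pi(z_1,z_2)=(z_1^{n+1},z_1z_2,z_2^{n+1})$ by the group $\mathbb Z_{n+1}$, a generator of which acts by $(z_1,z_2)\mapsto(\epsilon z_1,\epsilon^nz_2)$, $\epsilon$ a primitive $(n+1)$-th root of unity. $\sigma$ is the minimal resolution, with exceptional locus $E=E_1\cup\dots\cup E_n$ a chain of $n$ smooth rational $(-2)$-curves. $S^m\Omega^1_{\tilde X}(\log E)$ is the $m$-th symmetric power of the bundle of 1-forms with logarithmic poles along $E$. The equality in (a) is via restriction of sections to $\tilde X\setminus E$ (every section over $\tilde X\setminus E$ is the restriction of one over $\tilde X$ of the indicated bundle, and conversely), and maximality is with respect to the usual partial order on divisors ($D'\le D$ iff $D-D'$ is effective). The paper works with the affine model $X$ above and its minimal resolution. *)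

(* Defs.v *)
From HB Require Import structures.
From mathcomp Require Import all_boot all_order all_algebra.
From mathcomp Require Import complex.
From mathcomp Require Import all_classical all_reals all_analysis.
From mathcomp Require Import zify.

Set Implicit Arguments.
Unset Strict Implicit.
Unset Printing Implicit Defensive.

Import Order.TTheory GRing.Theory Num.Theory.
Import numFieldNormedType.Exports.

Local Open Scope classical_set_scope.
Local Open Scope ring_scope.

(* R[i] packed as a numClosedFieldType, so that it inherits the topology and   *)
(* the normed-space structure that the library puts on every such field.       *)
Definition Cplx (R : realType) : numClosedFieldType := R[i]%C.

Definition row2 (K : nzRingType) (a b : K) : 'rV[K]_2 :=
  \row_j [:: a; b]`_j.
Definition row3 (K : nzRingType) (a b c : K) : 'rV[K]_3 :=
  \row_j [:: a; b; c]`_j.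

Section SymmetricDifferentials.
Variables (R : realType) (m : nat).
Local Notation C := (Cplx R).

(* Differentiability is over the field C, i.e. complex Frechet                 *)
(* differentiability at every point of A (A is always open below).             *)
Definition holomorphic_on d (A : set 'rV[C]_d.+1) (f : 'rV[C]_d.+1 -> C) :=
  forall p, A p -> differentiable f p.

(* exponents of the monomials of degree m in d variables *)
Definition mexp d := {ffun 'I_d -> 'I_m.+1}.

Definition symform d (a : mexp d -> C) (e : 'I_d -> C) : C :=
  \sum_(k : mexp d | \sum_j (k j : nat) == m) a k * \prod_j e j ^+ k j.

(* A symmetric differential of degree m is represented by its values           *)
(* w p xi = w_p(xi, ..., xi), a homogeneous polynomial of degree m in the      *)
(* tangent vector xi.  Values at points outside the domain under consideration *)
(* are irrelevant.                                                             *)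
Definition symdiff d := 'rV[C]_d.+1 -> 'rV[C]_d.+1 -> C.

Definition holo_symdiff d (A : set 'rV[C]_d.+1) (w : symdiff d) :=
  exists2 f : mexp d.+1 -> 'rV[C]_d.+1 -> C,
    forall k, holomorphic_on A (f k) &
    forall p xi, A p -> w p xi = symform (f^~ p) (xi 0).

Definition pullback d e (phi : 'rV[C]_d.+1 -> 'rV[C]_e.+1) (w : symdiff e) :
    symdiff d :=
  fun p xi => w (phi p) ('d phi p xi).

(* germs at 0 of holomorphic functions on C^2, and powers of the maximal ideal *)
Definition holo_germ (f : 'rV[C]_2 -> C) := \forall p \near (0 : 'rV[C]_2), differentiable f p.

Definition max_ideal : set ('rV[C]_2 -> C) := [set f | holo_germ f /\ f 0 = 0].

Definition max_ideal_pow (i : nat) : set ('rV[C]_2 -> C) :=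
  [set f | exists N (h : 'I_N -> 'rV[C]_2 -> C)
             (g : 'I_N -> 'I_i -> 'rV[C]_2 -> C),
     [/\ forall a, holo_germ (h a),
         forall a b, max_ideal (g a b) &
         \forall p \near (0 : 'rV[C]_2), f p = \sum_a h a p * \prod_b g a b p]].

Definition in_max_ideal_pow (i : nat) (w : symdiff 1) :=
  exists2 f : mexp 2 -> 'rV[C]_2 -> C,
    forall k, max_ideal_pow i (f k) &
    \forall p \near (0 : 'rV[C]_2), forall xi, w p xi = symform (f^~ p) (xi 0).

(* +oo for the zero germ *)
Definition ord0_symdiff (w : symdiff 1) : \bar R :=
  ereal_sup [set (i%:R)%:E | i in [set i : nat | in_max_ideal_pow i w]].

End SymmetricDifferentials.

Section AnSingularity.
Variables (R : realType) (n : nat).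
Local Notation C := (Cplx R).

Definition An_eq (p : 'rV[C]_3) : C := p 0 0 * p 0 2%:R - p 0 1 ^+ n.+1.

Definition An_surface : set 'rV[C]_3 := [set p | An_eq p = 0].

Definition An_smoothing (z : 'rV[C]_2) : 'rV[C]_3 :=
  row3 (z 0 0 ^+ n.+1) (z 0 0 * z 0 1) (z 0 1 ^+ n.+1).

(* Holomorphic symmetric differentials on an open subset A of the smooth       *)
(* surface An_surface `\ 0: functions on its tangent bundle that are locally   *)
(* restrictions of ambient holomorphic symmetric differentials.                *)
Definition holo_symdiff_surface m (A : set 'rV[C]_3) (w : symdiff R 2) :=
  forall p, A p -> exists (B : set 'rV[C]_3) (eta : symdiff R 2),
    [/\ open B, B p, holo_symdiff m B eta &
        forall q xi, B q -> A q -> 'd An_eq q xi = 0 -> w q xi = eta q xi].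

(* The minimal resolution is the toric surface glued from n + 1 copies of C^2. *)
(* In terms of the functions x, y, z on the surface, the coordinates of the    *)
(* i-th chart are u = x / y^i and v = y^(i+1) / x.  Consecutive charts are     *)
(* glued by (u, v) |-> (v^-1, u v^2), whence E_r^2 = -2 for the curves E_r     *)
(* below; in particular there is no (-1)-curve in the exceptional locus.  The  *)
(* lemmas below show that the charts glue, that sigma is compatible with the   *)
(* gluing and maps onto the surface, bijectively away from the fibre over 0,   *)
(* and that this fibre is the union of the curves E_r.                         *)
Definition sigma (i : 'I_n.+1) (p : 'rV[C]_2) : 'rV[C]_3 :=
  row3 (p 0 0 ^+ i.+1 * p 0 1 ^+ i)
       (p 0 0 * p 0 1)
       (p 0 0 ^+ (n - i) * p 0 1 ^+ (n.+1 - i)).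

Lemma sigma_An_surface i p : An_surface (sigma i p).
Proof.
rewrite /An_surface /= /An_eq !mxE /=.
have le_in : (i <= n)%N by rewrite -ltnS.
rewrite mulrACA -!exprD exprMn.
by rewrite addSn subnKC // subnKC ?subrr // ltnW.
Qed.

(* coordinates of the j-th chart in terms of those of the i-th chart *)
Definition transition (i j : 'I_n.+1) (p : 'rV[C]_2) : 'rV[C]_2 :=
  row2 (p 0 0 ^ (i.+1%:Z - j%:Z) * p 0 1 ^ (i%:Z - j%:Z))
       (p 0 0 ^ (j%:Z - i%:Z) * p 0 1 ^ (j.+1%:Z - i%:Z)).

(* the part of the i-th chart lying in the j-th one: the coordinates having a  *)
(* negative exponent in transition i j do not vanish                           *)
Definition overlap (i j : 'I_n.+1) : set 'rV[C]_2 :=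
  [set p | ((j < i)%N || (i.+1 < j)%N -> p 0 0 != 0) /\
           ((i < j)%N || (j.+1 < i)%N -> p 0 1 != 0)].

(* local equation, in the i-th chart, of the r-th exceptional curve, r counted *)
(* from 0: it is {u = 0} in chart r, {v = 0} in chart r + 1 and does not meet  *)
(* the other charts                                                            *)
Definition exc_eq (r : 'I_n) (i : 'I_n.+1) (p : 'rV[C]_2) : C :=
  if (i == r :> nat) then p 0 0 else if (i == r.+1 :> nat) then p 0 1 else 1.

Definition exc_curve (r : 'I_n) (i : 'I_n.+1) : set 'rV[C]_2 :=
  [set p | exc_eq r i p = 0].

Definition exc_locus (i : 'I_n.+1) : set 'rV[C]_2 :=
  \bigcup_(r : 'I_n) exc_curve r i.

Lemma exc_locusE (n_ge1 : (0 < n)%N) i : exc_locus i = sigma i @^-1` [set 0].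
Proof.
apply/seteqP; split=> [p [r _]|p /= sp0].
  rewrite /exc_curve /= /exc_eq.
  have lt_rn := ltn_ord r.
  case: eqP => [ir p0|_]; last case: eqP => [ir p1|_ /eqP]; last first.
  - by rewrite oner_eq0.
  - apply/rowP=> j; rewrite !mxE ir p1.
    case: j => [[|[|[|//]]]] //= _; rewrite ?mulr0 ?expr0n ?mulr0 //=.
    by rewrite subSS subn_eq0 leqNgt lt_rn mulr0.
  - apply/rowP=> j; rewrite !mxE ir p0.
    case: j => [[|[|[|//]]]] //= _; rewrite ?mul0r ?expr0n ?mul0r //=.
    by rewrite subn_eq0 leqNgt lt_rn mul0r.
have /eqP := congr1 (fun q : 'rV[C]_3 => q 0 0) sp0.
have /eqP := congr1 (fun q : 'rV[C]_3 => q 0 2%:R) sp0.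
rewrite !mxE /= !mulf_eq0 !expf_eq0 /= => zE xE.
have le_in : (i <= n)%N by rewrite -ltnS.
have [p0|p0] := eqVneq (p 0 0) 0; have [p1|p1] := eqVneq (p 0 1) 0.
- have [lt_in|ge_in] := ltnP i n.
    by exists (Ordinal lt_in) => //; rewrite /exc_curve /= /exc_eq eqxx.
  have lt_in : (i.-1 < n)%N by rewrite prednK ?(leq_trans n_ge1).
  exists (Ordinal lt_in) => //; rewrite /exc_curve /= /exc_eq /=.
  by rewrite prednK ?(leq_trans n_ge1) // eqxx; case: ifP.
- move: zE; rewrite p0 (negPf p1) eqxx andbF andbT orbF subn_gt0 => lt_in.
  by exists (Ordinal lt_in) => //; rewrite /exc_curve /= /exc_eq eqxx.
- move: xE; rewrite (negPf p0) p1 eqxx andbT /= => i_gt0.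
  have lt_in : (i.-1 < n)%N by rewrite prednK.
  exists (Ordinal lt_in) => //; rewrite /exc_curve /= /exc_eq /=.
  by rewrite prednK // eqxx; case: eqP => // /eqP; rewrite -[X in X == _](prednK i_gt0) -[X in _ == X]addn0 -addn1 eqn_add2l.
- by move: xE; rewrite (negPf p0) (negPf p1) andbF.
Qed.

Lemma overlapP i j p : overlap i j p ->
  ((p 0 0 != 0) \/ (j = i :> nat \/ j = i.+1 :> nat)) /\
  ((p 0 1 != 0) \/ (j = i :> nat \/ i = j.+1 :> nat)).
Proof.
move=> [/= u_neq0 v_neq0]; split.
  by have [|] := boolP ((j < i) || (i.+1 < j))%N => [/u_neq0|]; [left|right; lia].
by have [|] := boolP ((i < j) || (j.+1 < i))%N => [/v_neq0|]; [left|right; lia].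
Qed.

Lemma exprzD_nneg (x : C) (a b : int) :
  x != 0 \/ (0 <= a /\ 0 <= b) -> x ^ a * x ^ b = x ^ (a + b).
Proof.
case=> [x0|[]]; first by rewrite expfzDr.
by case: a => // a _; case: b => // b _; rewrite -PoszD -!exprnP exprD.
Qed.

Lemma monomialM (x y : C) (a b c d e f : int) :
  x != 0 \/ (0 <= a /\ 0 <= c) -> y != 0 \/ (0 <= b /\ 0 <= d) ->
  e = a + c -> f = b + d ->
  (x ^ a * y ^ b) * (x ^ c * y ^ d) = x ^ e * y ^ f.
Proof. by move=> hx hy -> ->; rewrite mulrACA !exprzD_nneg. Qed.

Lemma monomialX (x y : C) (a b k : int) :
  (x ^ a * y ^ b) ^ k = x ^ (a * k) * y ^ (b * k).
Proof. by rewrite expfzMl -!exprz_exp. Qed.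

Lemma sigma_transition i j p :
  overlap i j p -> sigma j (transition i j p) = sigma i p.
Proof.
move=> /overlapP [hu hv].
have le_i : (i <= n)%N by rewrite -ltnS.
have le_j : (j <= n)%N by rewrite -ltnS.
apply/rowP=> k; rewrite !mxE /= !exprnP !monomialX.
move: (p 0 0) (p 0 1) hu hv => u v hu hv.
case: k => [[|[|[|//]]]] //= _.
- by apply: monomialM; [move: hu => [|hu]; [left|right; nia]
    |move: hv => [|hv]; [left|right; nia]|nia|nia].
- rewrite -[u in RHS]expr1z -[v in RHS]expr1z.
  by apply: monomialM; [move: hu => [|hu]; [left|right; nia]
    |move: hv => [|hv]; [left|right; nia]|nia|nia].
- rewrite -!subzn ?(leqW le_i) ?(leqW le_j) //.
  by apply: monomialM; [move: hu => [|hu]; [left|right; nia]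
    |move: hv => [|hv]; [left|right; nia]|nia|nia].
Qed.

Lemma transition_comp i j k p : overlap i j p -> overlap i k p ->
  transition j k (transition i j p) = transition i k p.
Proof.
move=> /overlapP [hu hv] /overlapP [hu' hv'].
apply/rowP=> l; rewrite !mxE /= !monomialX.
move: (p 0 0) (p 0 1) hu hv hu' hv' => u v hu hv hu' hv'.
case: l => [[|[|//]]] //= _.
all: by apply: monomialM;
  [case: hu hu' => [hu _|hu [hu'|hu']]; [left|left|right; nia]
  |case: hv hv' => [hv _|hv [hv'|hv']]; [left|left|right; nia]|nia|nia].
Qed.

Lemma transition_overlap i j p :
  overlap i j p -> overlap j i (transition i j p).
Proof.
move=> /overlapP [hu hv]; split=> /= hij; rewrite !mxE /=.
- apply: mulf_neq0; first by case: hu => [/expfz_neq0//|hu];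
    have -> : i.+1%:Z - j%:Z = 0 by [lia]; rewrite expr0z oner_eq0.
  by case: hv => [/expfz_neq0//|hv]; exfalso; lia.
- apply: mulf_neq0; first by case: hu => [/expfz_neq0//|hu]; exfalso; lia.
  by case: hv => [/expfz_neq0//|hv];
    have -> : j.+1%:Z - i%:Z = 0 by [lia]; rewrite expr0z oner_eq0.
Qed.

Lemma transition_id i p : transition i i p = p.
Proof.
apply/rowP=> k; rewrite !mxE !subrr !expr0z ?mulr1 ?mul1r.
have -> : i.+1%:Z - i%:Z = 1 by lia.
rewrite !expr1z.
by case: k => [[|[|//]]] lt_k /=; congr (p 0 _); apply/val_inj.
Qed.

Lemma overlap_id i p : overlap i i p.
Proof. by split=> /= /orP[]; rewrite ?ltnn // ltnNge leqnSn. Qed.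

Lemma transitionK i j p : overlap i j p ->
  transition j i (transition i j p) = p.
Proof.
by move=> ov_ij; rewrite (transition_comp ov_ij (overlap_id i p)) transition_id.
Qed.

Lemma sigma_inj i j p q : sigma i p = sigma j q -> sigma i p != 0 ->
  overlap i j p /\ q = transition i j p.
Proof.
move=> eq_s s_neq0.
have le_i : (i <= n)%N by rewrite -ltnS.
have le_j : (j <= n)%N by rewrite -ltnS.
have := congr1 (fun q : 'rV[C]_3 => q 0 0) eq_s.
have := congr1 (fun q : 'rV[C]_3 => q 0 1) eq_s.
have := congr1 (fun q : 'rV[C]_3 => q 0 2%:R) eq_s.
have : [|| p 0 0 ^+ i.+1 * p 0 1 ^+ i != 0, p 0 0 * p 0 1 != 0 |
          p 0 0 ^+ (n - i) * p 0 1 ^+ (n.+1 - i) != 0].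
  apply: contraNT s_neq0; rewrite !negb_or !negbK => /and3P[/eqP a /eqP b /eqP c].
  apply/eqP/rowP=> k; rewrite !mxE a b c.
  by case: k => [[|[|[|//]]]].
have qE : q = row2 (q 0 0) (q 0 1).
  apply/rowP=> k; rewrite !mxE; case: k => [[|[|//]]] lt_k /=;
  by congr (q 0 _); apply/val_inj.
rewrite /transition /overlap /= !mxE /= {}qE !mxE /=.
move: (p 0 0) (p 0 1) (q 0 0) (q 0 1) => u v u' v' nz ez ey ex.
have [y0|y0] := eqVneq (u * v) 0; last first.
  have := y0; rewrite mulf_eq0 negb_or => /andP[u0 v0].
  have := y0; rewrite ey mulf_eq0 negb_or => /andP[u'0 v'0].
  split=> //.
  have u'E : u' = u ^ (i.+1%:Z - j%:Z) * v ^ (i%:Z - j%:Z).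
    apply: (mulIf (expf_neq0 j y0)).
    rewrite {1}ey exprMn mulrA -exprS -ex !exprnP expfzMl.
    by symmetry; apply: monomialM; [left|left|lia|lia].
  rewrite -u'E; congr row2; apply: (mulfI u'0); rewrite -ey u'E.
  rewrite -[u in LHS]expr1z -[v in LHS]expr1z.
  by symmetry; apply: monomialM; [left|left|lia|lia].
have y'0 : u' * v' = 0 by rewrite -ey.
have aux k : (k <= n)%N -> (n.+1 - k = (n - k).+1)%N by lia.
move: nz; rewrite y0 eqxx /= => /orP[x0|z0].
  have [u0 vi0] : u != 0 /\ v ^+ i != 0.
    by move: x0; rewrite mulf_eq0 expf_eq0 negb_or => /andP[].
  have [u'0 v'j0] : u' != 0 /\ v' ^+ j != 0.
    by move: x0; rewrite ex mulf_eq0 expf_eq0 negb_or => /andP[].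
  move/eqP: y0; rewrite mulf_eq0 (negPf u0) /= => /eqP v0.
  move/eqP: y'0; rewrite mulf_eq0 (negPf u'0) /= => /eqP v'0.
  move: vi0 v'j0; rewrite v0 v'0 !expr0n !pnatr_eq0 !eqb0 !negbK.
  move=> /eqP i0 /eqP j0; move: ex.
  rewrite i0 j0 !expr0 !expr1 !mulr1 => ->; split=> //.
  by rewrite ?subrr ?expr0z ?mulr1 ?mul1r ?subr0 ?expr1z.
have [ui0 v0] : u ^+ (n - i) != 0 /\ v != 0.
  by move: z0; rewrite mulf_eq0 aux // [v ^+ _ == 0]expf_eq0 negb_or => /andP[].
have [u'j0 v'0] : u' ^+ (n - j) != 0 /\ v' != 0.
  by move: z0; rewrite ez mulf_eq0 (aux j) // [v' ^+ _ == 0]expf_eq0 negb_or => /andP[].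
move/eqP: y0; rewrite mulf_eq0 (negPf v0) orbF => /eqP u0.
move/eqP: y'0; rewrite mulf_eq0 (negPf v'0) orbF => /eqP u'0.
move: ui0 u'j0; rewrite u0 u'0 !expr0n !pnatr_eq0 !eqb0 !negbK.
move=> /eqP ni /eqP nj; move: ez.
rewrite !aux // ni nj !expr0 !mul1r !expr1 => ->.
have -> : (i = j :> nat) by lia.
split; first by split=> //; move=> /orP[]; rewrite ?ltnn // ltnNge leqnSn.
rewrite ?subrr ?expr0z ?mulr1 ?mul1r.
by have -> : j.+1%:Z - j%:Z = 1 by [lia]; rewrite ?expr1z.
Qed.

Lemma sigma_surj q : An_surface q -> q != 0 -> exists i p, sigma i p = q.
Proof.
rewrite /An_surface /= /An_eq => /eqP; rewrite subr_eq0 => /eqP eq_q q_neq0.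
have [x0|x0] := eqVneq (q 0 0) 0.
  move/eqP: eq_q; rewrite x0 mul0r eq_sym expf_eq0 => /= /eqP y0.
  exists ord_max, (row2 0 (q 0 2%:R)); apply/rowP=> k; rewrite !mxE /=.
  have kE (l : 'I_3) : k = l :> nat -> q 0 k = q 0 l.
    by move=> kl; congr (q 0 _); apply/val_inj.
  rewrite subnn subSnn exprS !mul0r expr0 mul1r expr1.
  case: k kE => [[|[|[|//]]]] lt_k kE /=.
  - by rewrite (kE 0) // x0.
  - by rewrite (kE 1) // y0.
  - by rewrite (kE 2%:R).
exists ord0, (row2 (q 0 0) (q 0 1 / q 0 0)); apply/rowP=> k; rewrite !mxE /=.
have kE (l : 'I_3) : k = l :> nat -> q 0 k = q 0 l.
  by move=> kl; congr (q 0 _); apply/val_inj.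
rewrite !subn0 expr1 expr0 mulr1 mulrCA mulfV // mulr1.
case: k kE => [[|[|[|//]]]] lt_k kE /=.
- by rewrite (kE 0).
- by rewrite (kE 1).
- rewrite (kE 2%:R) // exprMn exprVn mulrCA -eq_q exprS invfM.
  rewrite [q 0 0 ^+ n * _]mulrCA mulfV ?expf_neq0 // mulr1.
  by rewrite mulrC mulrA mulVf // mul1r.
Qed.

(* A family of subsets of the charts stands for an open subset of the          *)
(* resolution; these are the symmetric differentials holomorphic there.        *)
Definition compatible (A : 'I_n.+1 -> set 'rV[C]_2)
    (w : 'I_n.+1 -> symdiff R 1) :=
  forall i j p xi, A i p -> overlap i j p ->
    w i p xi = pullback (transition i j) (w j) p xi.

Definition sections m (A : 'I_n.+1 -> set 'rV[C]_2) :
    set ('I_n.+1 -> symdiff R 1) :=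
  [set w | (forall i, holo_symdiff m (A i) (w i)) /\ compatible A w].

Definition resolution_over (U : set 'rV[C]_3) (i : 'I_n.+1) : set 'rV[C]_2 :=
  sigma i @^-1` U.

Definition resolution_off_exc (U : set 'rV[C]_3) (i : 'I_n.+1) : set 'rV[C]_2 :=
  resolution_over U i `\` exc_locus i.

(* Divisors supported on the exceptional locus, by their multiplicities. *)
Definition exc_divisor := 'I_n -> int.

Definition divisor_eq (D : exc_divisor) (i : 'I_n.+1) (p : 'rV[C]_2) : C :=
  \prod_(r : 'I_n) exc_eq r i p ^ D r.

(* The j-th element of the logarithmic coframe of the i-th chart: d log of the *)
(* coordinate if its zero set is exceptional, i.e. unless it is the coordinate *)
(* v of the first chart or the coordinate u of the last one.                   *)
Definition log_coframe (i : 'I_n.+1) (p xi : 'rV[C]_2) (j : 'I_2) : C :=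
  if (if j == 0 then (i < n)%N else (0 < i)%N) then xi 0 j / p 0 j else xi 0 j.

(* Sections over sigma^-1(U) of S^m Omega^1(log E) tensored with O(- D), each  *)
(* given by its restriction to the complement of E (which determines it, as do *)
(* its coefficients in the local frames, the complement of E being dense).     *)
Definition log_sections m (D : exc_divisor) (U : set 'rV[C]_3) :
    set ('I_n.+1 -> symdiff R 1) :=
  [set w | (forall i, exists2 f : mexp m 2 -> 'rV[C]_2 -> C,
              forall k, holomorphic_on (resolution_over U i) (f k) &
              forall p xi, resolution_off_exc U i p ->
                w i p xi = divisor_eq D i p *
                           symform (f^~ p) (log_coframe i p xi)) /\
           compatible (resolution_off_exc U) w].

Definition max_divisor (m : nat) : exc_divisor :=
  fun r => \sum_(0 <= j < (minn r (n - r.+1)).+1)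
    Num.ceil ((m%:R - (2 * j)%:R) / n.+1%:R : rat).

End AnSingularity.

Arguments An_surface {R} n.
Arguments An_smoothing {R} n z.
Arguments overlap {R n} i j.
Arguments exc_locus {R n} i.
Arguments resolution_off_exc {R} n U i.
Arguments resolution_over {R} n U i.
Arguments log_sections {R n} m D U.
Arguments sections {R n} m A.
Arguments max_divisor n m r : clear implicits.

(* Main.v *)
(* Let z be a point of the smoothing with z1 z2 <> 0, lifted to the i-th chart *)
(* (u, v) of the resolution by a Laurent monomial map.  A section w over the   *)
(* complement of E pulls back to {z1 z2 <> 0}; by Hartogs it gives an invariant *)
(* form on C^2, so that in the coframe dz1/z1, dz2/z2 its coefficients are     *)
(* series in the monomials z1^A z2^B with A + B >= m and A = B mod n + 1.      *)
(* Such a monomial vanishes to the order (A (r + 1) + B (n - r)) / (n + 1) on  *)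
(* the r-th curve (r counted from 0), and the logarithmic coframes of the      *)
(* charts are constant linear combinations of dz1/z1 and dz2/z2; hence the     *)
(* coefficients of w in a logarithmic coframe are bounded by the monomials     *)
(* given by the least such orders, and Riemann's extension theorem applies.    *)
(* The minimum is attained by A, B for which z1^A z2^B (dz1/z1)^k              *)
(* (dz2/z2)^(m-k) with suitable k is a section, which gives maximality.  In    *)
(* (b), ord(w) >= n m forces A + B >= n m + m, so that the coefficients vanish *)
(* to order at least m along E, which absorbs the logarithmic poles.           *)
(* Cauchy's formula, Riemann's and Hartogs' theorems and Taylor's formula on   *)
(* C^2 all come from integrals over the boundaries of squares.                 *)
From HB Require Import structures.
Require Import Defs.
From mathcomp Require Import all_boot all_order all_algebra.
From mathcomp Require Import all_solvable all_field.
From mathcomp Require Import complex.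
From mathcomp Require Import all_classical all_reals all_analysis.
From mathcomp Require Import ring lra zify.
Import Order.TTheory GRing.Theory Num.Theory.
Import numFieldNormedType.Exports.
Local Open Scope classical_set_scope.
Local Open Scope ring_scope.

Set Implicit Arguments.
Unset Strict Implicit.
Unset Printing Implicit Defensive.

(** * Cauchy's formula *)

(** Let z1, z2 be the coordinates of the smoothing and u, v those of the i-th chart. The lift
    [tau i] of the smoothing is a Laurent monomial map with z1^(n+1) = u^(i+1) v^i and z2^(n+1) =
    u^(n-i) v^(n+1-i), so every comparison between C^2 and the resolution becomes a comparison of
    exponents.

    Holomorphic forms off E are logarithmic sections. The first chart is reached by [tau] wherever
    z1 <> 0 and the last one wherever z2 <> 0, so a section pulls back to C^2 minus the origin, and
    Hartogs' theorem extends its coefficients G_l over the origin ([hartogs_coefficients]). The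
    pullback is invariant under the cyclic group. Averaging a Taylor expansion over the group
    ([invariant_bound]) bounds G_l z1^l z2^(m-l) by the monomials |z1|^A |z2|^B with A + B >= m and
    A = B mod n + 1, up to a remainder of arbitrarily high order. By [max_mult_lower] each such
    monomial vanishes on the r-th curve at least to the order prescribed by [max_divisor]. This is
    the growth estimate [section_log_growth], and Riemann's extension theorem in the logarithmic
    coframe ([log_extension]) turns it into holomorphic coefficients. The converse inclusion is
    [log_sections_sections].

    Maximality. The minimal order on a given curve is attained by a monomial ([max_mult_attained])
    that is the coefficient of an explicit section, [toric_section]. Evaluating this section near a
    general point of the curve shows that no larger multiplicity is possible
    ([toric_section_div_le]).

    Vanishing order. If the order is at least n m, the logarithmic coefficients on C^2 are bounded
    by monomials of degree (n + 1) m. On every curve these vanish to order at least m, which cancels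
    the poles of (du/u)^l (dv/v)^(m-l) ([extension_of_log_growth]); the chartwise extensions are
    compatible by density ([compatible_by_density]).

    The analytic tool is [removable_cross], which serves as Riemann's theorem and as Hartogs'
    theorem. It rests on [goursat], [cauchy_formula] and [cauchy_integral_differentiable]. *)

Section Cousin.
Variable R : realType.
Implicit Types (x y h : R) (P : R -> R -> R -> Prop).

Lemma nested_intervals_point (x : nat -> R) h : 0 < h ->
  (forall k, `|x k.+1 - x k| <= h / 2 ^+ k.+1) ->
  exists p, forall k, `|p - x k| <= h / 2 ^+ k.
Proof.
move=> h0 hx; have hk k : h / 2 ^+ k = h / 2 ^+ k.+1 + h / 2 ^+ k.+1.
  by rewrite exprS; field; rewrite expf_neq0.
have hk0 k : 0 < h / 2 ^+ k by rewrite divr_gt0// exprn_gt0.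
have stp k : x k - h / 2 ^+ k <= x k.+1 - h / 2 ^+ k.+1 /\
             x k.+1 + h / 2 ^+ k.+1 <= x k + h / 2 ^+ k.
  by have := hx k; have := hk k; rewrite ler_norml => ? /andP[] ? ?; split; lra.
have lo : {homo (fun k => x k - h / 2 ^+ k) : i j / (i <= j)%N >-> i <= j}.
  by apply: homo_leq => [//|? ? ?|k]; [exact: le_trans|case: (stp k)].
have hi : {homo (fun k => x k + h / 2 ^+ k) : i j / (i <= j)%N >-> i >= j}.
  by apply: homo_leq => [//|b a c|k]; [move=> ? /le_trans; apply|case: (stp k)].
have lohi i j : x i - h / 2 ^+ i <= x j + h / 2 ^+ j.
  have := lo i _ (leq_maxl i j); have := hi j _ (leq_maxr i j).
  by have := hk0 (maxn i j); lra.
pose A := range (fun k => x k - h / 2 ^+ k).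
have ubA k : ubound A (x k + h / 2 ^+ k) by move=> _ [i _ <-].
have supA : has_sup A.
  by split; [exists (x 0%N - h / 2 ^+ 0), 0%N|exists (x 0%N + h / 2 ^+ 0)].
exists (sup A) => k; rewrite ler_norml; apply/andP; split=> /=.
  have : x k - h / 2 ^+ k <= sup A by apply: sup_upper_bound => //; exists k.
  lra.
have : sup A <= x k + h / 2 ^+ k by apply: ge_sup => //; case: supA.
lra.
Qed.

(** Cousin's lemma for squares: if [P] failed, repeated quartering would give nested squares on
    which it fails, and these shrink to a point where the local hypothesis applies. *)
Lemma square_bisection P x0 y0 h0 : 0 < h0 ->
  (forall x y h, 0 < h ->
     P (x - h / 2) (y - h / 2) (h / 2) -> P (x - h / 2) (y + h / 2) (h / 2) ->
     P (x + h / 2) (y - h / 2) (h / 2) -> P (x + h / 2) (y + h / 2) (h / 2) ->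
     P x y h) ->
  (forall a b, `|a - x0| <= h0 -> `|b - y0| <= h0 ->
     exists2 d, 0 < d & forall x y h, 0 < h < d ->
       `|a - x| <= h -> `|b - y| <= h ->
       `|x - x0| <= h0 - h -> `|y - y0| <= h0 - h -> P x y h) ->
  P x0 y0 h0.
Proof.
move=> h0_gt0 Pquarters Plocal; apply: contrapT => notP.
have hk0 k : 0 < h0 / 2 ^+ k by rewrite divr_gt0// exprn_gt0.
have hkS k : h0 / 2 ^+ k / 2 = h0 / 2 ^+ k.+1.
  by rewrite exprS; field; rewrite expf_neq0.
(* [f] selects a quarter on which [P] fails whenever it fails on the given square: three quarters
   are tested, and the fourth is then forced by [Pquarters]. *)
have /choice[f fP] (s : nat * (R * R)) : exists t : R * R,
    [/\ `|t.1 - s.2.1| <= h0 / 2 ^+ s.1.+1, `|t.2 - s.2.2| <= h0 / 2 ^+ s.1.+1 &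
     ~ P s.2.1 s.2.2 (h0 / 2 ^+ s.1) -> ~ P t.1 t.2 (h0 / 2 ^+ s.1.+1)].
  case: s => k [x y] /=.
  have e1 z : `|z - h0 / 2 ^+ k.+1 - z| <= h0 / 2 ^+ k.+1.
    by rewrite addrAC subrr add0r normrN (gtr0_norm (hk0 _)).
  have e2 z : `|z + h0 / 2 ^+ k.+1 - z| <= h0 / 2 ^+ k.+1.
    by rewrite addrAC subrr add0r (gtr0_norm (hk0 _)).
  have [Q1|Q1] := pselect (P (x - h0 / 2 ^+ k.+1) (y - h0 / 2 ^+ k.+1) (h0 / 2 ^+ k.+1)); last first.
    by exists (x - h0 / 2 ^+ k.+1, y - h0 / 2 ^+ k.+1); split=> /=.
  have [Q2|Q2] := pselect (P (x - h0 / 2 ^+ k.+1) (y + h0 / 2 ^+ k.+1) (h0 / 2 ^+ k.+1)); last first.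
    by exists (x - h0 / 2 ^+ k.+1, y + h0 / 2 ^+ k.+1); split=> /=.
  have [Q3|Q3] := pselect (P (x + h0 / 2 ^+ k.+1) (y - h0 / 2 ^+ k.+1) (h0 / 2 ^+ k.+1)); last first.
    by exists (x + h0 / 2 ^+ k.+1, y - h0 / 2 ^+ k.+1); split=> /=.
  exists (x + h0 / 2 ^+ k.+1, y + h0 / 2 ^+ k.+1); split=> //= nP Q4; apply: nP.
  by apply: Pquarters; rewrite ?hkS.
pose s := fix s k := if k is k'.+1 then f (k', s k') else (x0, y0).
have s1 k : `|(s k.+1).1 - (s k).1| <= h0 / 2 ^+ k.+1 by case: (fP (k, s k)).
have s2 k : `|(s k.+1).2 - (s k).2| <= h0 / 2 ^+ k.+1 by case: (fP (k, s k)).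
have sP k : ~ P (s k).1 (s k).2 (h0 / 2 ^+ k).
  elim: k => [|k IH]; first by rewrite expr0 divr1.
  by case: (fP (k, s k)) => _ _; apply.
have inside (u : nat -> R) : (forall k, `|u k.+1 - u k| <= h0 / 2 ^+ k.+1) ->
    forall k, `|u k - u 0%N| <= h0 - h0 / 2 ^+ k.
  move=> hu; elim=> [|k IH]; first by rewrite subrr normr0 expr0 divr1 subrr.
  have -> : u k.+1 - u 0%N = (u k.+1 - u k) + (u k - u 0%N) by ring.
  apply: le_trans (ler_normD _ _) _.
  have := hu k; have := hkS k; move: IH; set w := h0 / 2 ^+ k; lra.
have [a aP] := nested_intervals_point h0_gt0 s1.
have [b bP] := nested_intervals_point h0_gt0 s2.
have [||d d0 dP] := Plocal a b.
- by have := aP 0%N; rewrite expr0 divr1.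
- by have := bP 0%N; rewrite expr0 divr1.
have [k kd] : exists k, h0 / 2 ^+ k < d.
  have [k hk] : exists k : nat, h0 / d < k%:R.
    by exists (Num.truncn (h0 / d)).+1; rewrite truncnS_gt.
  exists k; rewrite ltr_pdivrMr ?exprn_gt0// mulrC -ltr_pdivrMr//.
  apply: (lt_le_trans hk); rewrite -natrX ler_nat.
  exact: ltnW (ltn_expl _ _).
apply: (sP k); apply: dP; rewrite ?hk0//; first exact: (inside (fun k => (s k).1)).
exact: (inside (fun k => (s k).2)).
Qed.

End Cousin.

(** * The complex modulus as a real number *)

Section ComplexModulus.
Variable R : realType.
Local Notation C := (Cplx R).
Implicit Types (x y h : R) (z w : C).

Definition cabs (z : C) : R := complex.Re `|z|.

Definition cpx (x y : R) : C := Complex x y.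

Lemma cabsE z : `|z| = (cabs z)%:C%C :> C.
Proof. by rewrite /cabs; case: (z) => a b. Qed.

Lemma cpxE z : z = cpx (complex.Re z) (complex.Im z).
Proof. by case: z. Qed.

Lemma cpxD a b c d : cpx a b + cpx c d = cpx (a + c) (b + d).
Proof. by []. Qed.

Lemma cpxN a b : - cpx a b = cpx (- a) (- b).
Proof. by []. Qed.

Lemma ReD z w : complex.Re (z + w) = complex.Re z + complex.Re w.
Proof. by case: z; case: w. Qed.

Lemma ImD z w : complex.Im (z + w) = complex.Im z + complex.Im w.
Proof. by case: z; case: w. Qed.

Lemma ReN z : complex.Re (- z) = - complex.Re z.
Proof. by case: z. Qed.

Lemma ImN z : complex.Im (- z) = - complex.Im z.
Proof. by case: z. Qed.

Lemma cpx_half a b : cpx a b / 2 = cpx (a / 2) (b / 2).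
Proof.
apply: (@mulIf _ (2 : C)); rewrite ?pnatr_eq0// mulfVK ?pnatr_eq0//.
by rewrite mulr_natr mulr2n cpxD; congr cpx; field.
Qed.

Lemma cabsM z w : cabs (z * w) = cabs z * cabs w.
Proof. by rewrite /cabs normrM !cabsE /= mulr0 subr0. Qed.

Lemma cabs_def z : cabs z = Num.sqrt (complex.Re z ^+ 2 + complex.Im z ^+ 2).
Proof. by rewrite /cabs; case: z. Qed.

Lemma cabs_ge0 z : 0 <= cabs z. Proof. by rewrite cabs_def sqrtr_ge0. Qed.

Lemma cabs_leE z x : (cabs z <= x) = (`|z| <= x%:C%C).
Proof. by rewrite cabsE lecR. Qed.

Lemma cabs_ltE z x : (cabs z < x) = (`|z| < x%:C%C).
Proof. by rewrite cabsE ltcR. Qed.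

Lemma cabsD z w : cabs (z + w) <= cabs z + cabs w.
Proof. by rewrite cabs_leE rmorphD /= -!cabsE ler_normD. Qed.

Lemma cabsN z : cabs (- z) = cabs z. Proof. by rewrite /cabs normrN. Qed.

Lemma cabsB z w : cabs (z - w) = cabs (w - z).
Proof. by rewrite -cabsN opprB. Qed.

Lemma cabs0 : cabs 0 = 0. Proof. by rewrite /cabs normr0. Qed.

Lemma cabs1 : cabs 1 = 1. Proof. by rewrite /cabs normr1. Qed.

Lemma cabs_eq0 z : (cabs z == 0) = (z == 0).
Proof. by rewrite -[in RHS]normr_eq0 cabsE -(inj_eq (@complexI R)). Qed.

Lemma cabs_gt0 z : (0 < cabs z) = (z != 0).
Proof. by rewrite lt_def cabs_ge0 andbT cabs_eq0. Qed.

Lemma cabsX z k : cabs (z ^+ k) = cabs z ^+ k.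
Proof. by elim: k => [|k IH]; rewrite ?expr0 ?cabs1// !exprS cabsM IH. Qed.

Lemma cabsV z : cabs z^-1 = (cabs z)^-1.
Proof.
have [->|z0] := eqVneq z 0; first by rewrite invr0 cabs0 invr0.
apply: (mulfI (_ : cabs z != 0)); first by rewrite cabs_eq0.
by rewrite -cabsM !mulfV ?cabs1 ?cabs_eq0.
Qed.

Lemma cabs_real x : cabs x%:C%C = `|x|.
Proof. by rewrite cabs_def /= expr0n addr0 sqrtr_sqr. Qed.

Lemma cabs_nat k : cabs (k%:R : C) = k%:R.
Proof. by rewrite /cabs normr_nat -(rmorph_nat (real_complex R)). Qed.

Lemma cabs_sum (I : Type) (r : seq I) (P : pred I) (F : I -> C) :
  cabs (\sum_(i <- r | P i) F i) <= \sum_(i <- r | P i) cabs (F i).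
Proof.
elim/big_ind2: _ => [|a b c d h1 h2|//]; first by rewrite cabs0.
exact: le_trans (cabsD _ _) (lerD h1 h2).
Qed.

Lemma Re_le_cabs z : `|complex.Re z| <= cabs z.
Proof. by rewrite cabs_def -sqrtr_sqr ler_wsqrtr// lerDl sqr_ge0. Qed.

Lemma Im_le_cabs z : `|complex.Im z| <= cabs z.
Proof. by rewrite cabs_def -sqrtr_sqr ler_wsqrtr// lerDr sqr_ge0. Qed.

Lemma cabs_le_ReIm z : cabs z <= `|complex.Re z| + `|complex.Im z|.
Proof.
rewrite cabs_def -[leRHS]ger0_norm ?addr_ge0// -[leRHS]sqrtr_sqr ler_wsqrtr//.
rewrite sqrrD !real_normK ?num_real// -addrA [_ *+ 2 + _]addrC addrA lerDl.
by rewrite mulrn_wge0// mulr_ge0.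
Qed.

Lemma cabs_cpx_real x : cabs (cpx x 0) = `|x|.
Proof. exact: cabs_real. Qed.

Lemma cabs_cpx_im x : cabs (cpx 0 x) = `|x|.
Proof. by rewrite cabs_def /= expr0n add0r sqrtr_sqr. Qed.

End ComplexModulus.

(** * Midpoint sums along segments and square boundaries *)

Section MidpointSums.
Variable R : realType.
Local Notation C := (Cplx R).
Implicit Types (x y h : R) (z w a b : C) (f g : C -> C).

(** Midpoint Riemann sum for the integral of f(z) dz along the segment from [a] to [b], cut into 2^k
    equal pieces. The dyadic recursion makes it exactly additive under halving. *)
Fixpoint midsum k f a b : C :=
  if k is k'.+1 then midsum k' f a ((a + b) / 2) + midsum k' f ((a + b) / 2) b
  else (b - a) * f ((a + b) / 2).

Lemma midsumD k f g a b :
  midsum k (fun z => f z + g z) a b = midsum k f a b + midsum k g a b.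
Proof.
elim: k a b => [|k IH] a b /=; first by rewrite mulrDr.
by rewrite !IH addrACA.
Qed.

Lemma midsumZ k f c a b :
  midsum k (fun z => c * f z) a b = c * midsum k f a b.
Proof.
elim: k a b => [|k IH] a b /=; first by rewrite mulrCA.
by rewrite !IH mulrDr.
Qed.

Lemma midsum_sym k f a b : midsum k f b a = - midsum k f a b.
Proof.
elim: k a b => [|k IH] a b /=; first by rewrite [b + a]addrC -mulNr opprB.
by rewrite [b + a]addrC IH [midsum k f _ a]IH; ring.
Qed.

Lemma midsum_affine k a b c d :
  midsum k (fun z => c * z + d) a b = (b - a) * (c * ((a + b) / 2) + d).
Proof. by elim: k a b => [//|k IH] a b /=; rewrite !IH; field. Qed.

Lemma midsum_le k f (D : set C) M a b :
  (forall u v, D u -> D v -> D ((u + v) / 2)) ->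
  (forall z, D z -> cabs (f z) <= M) -> D a -> D b ->
  cabs (midsum k f a b) <= cabs (b - a) * M.
Proof.
move=> Dmid fM; have half z : cabs (z / 2) = cabs z / 2.
  by rewrite cabsM cabsV cabs_nat.
elim: k a b => [|k IH] a b Da Db /=.
  by rewrite cabsM ler_wpM2l ?cabs_ge0 ?fM//; exact: Dmid.
apply: le_trans (cabsD _ _) _.
apply: le_trans (lerD (IH _ _ Da (Dmid _ _ Da Db)) (IH _ _ (Dmid _ _ Da Db) Db)) _.
have -> : (a + b) / 2 - a = (b - a) / 2 by field.
have -> : b - (a + b) / 2 = (b - a) / 2 by field.
by rewrite half; set u := cabs _; lra.
Qed.

Definition sqsum k f x y h : C :=
  midsum k f (cpx (x - h) (y - h)) (cpx (x + h) (y - h)) +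
  midsum k f (cpx (x + h) (y - h)) (cpx (x + h) (y + h)) +
  midsum k f (cpx (x + h) (y + h)) (cpx (x - h) (y + h)) +
  midsum k f (cpx (x - h) (y + h)) (cpx (x - h) (y - h)).

Definition in_square x y h : set C :=
  [set z | `|complex.Re z - x| <= h /\ `|complex.Im z - y| <= h].

Definition on_square x y h : set C :=
  [set z | in_square x y h z /\
           (`|complex.Re z - x| = h \/ `|complex.Im z - y| = h)].

Lemma sqsumD k f g x y h :
  sqsum k (fun z => f z + g z) x y h = sqsum k f x y h + sqsum k g x y h.
Proof. by rewrite /sqsum !midsumD; ring. Qed.

Lemma sqsumZ k f c x y h :
  sqsum k (fun z => c * f z) x y h = c * sqsum k f x y h.
Proof. by rewrite /sqsum !midsumZ !mulrDr. Qed.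

Lemma sqsum_affine k x y h c d : sqsum k (fun z => c * z + d) x y h = 0.
Proof. by rewrite /sqsum !midsum_affine; field. Qed.

(** An exact identity: the outer edges of the quarters, at one level less, carry the same pieces as
    the large boundary, and each inner edge is run through twice in opposite directions. *)
Lemma sqsumS k f x y h : sqsum k.+1 f x y h =
  sqsum k f (x - h / 2) (y - h / 2) (h / 2) +
  sqsum k f (x - h / 2) (y + h / 2) (h / 2) +
  sqsum k f (x + h / 2) (y - h / 2) (h / 2) +
  sqsum k f (x + h / 2) (y + h / 2) (h / 2).
Proof.
have e1 (t : R) : t - h + (t + h) = t * 2 by ring.
have e2 (t : R) : t + h + (t - h) = t * 2 by ring.
have e3 (t : R) : t + t = t * 2 by ring.
have e4 (t : R) : t - h / 2 - h / 2 = t - h by field.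
have e5 (t : R) : t - h / 2 + h / 2 = t by field.
have e6 (t : R) : t + h / 2 - h / 2 = t by field.
have e7 (t : R) : t + h / 2 + h / 2 = t + h by field.
rewrite /sqsum /= !cpxD !cpx_half !(e1, e2, e3) !mulfK ?pnatr_eq0//.
rewrite !(e4, e5, e6, e7).
rewrite (midsum_sym _ _ (cpx (x - h) y) (cpx x y)) (midsum_sym _ _ (cpx x (y + h)) (cpx x y)).
rewrite (midsum_sym _ _ (cpx x (y - h)) (cpx x y)) (midsum_sym _ _ (cpx (x + h) y) (cpx x y)).
ring.
Qed.

Lemma sqsum_le k f x y h M : 0 <= h ->
  (forall z, on_square x y h z -> cabs (f z) <= M) ->
  cabs (sqsum k f x y h) <= 8 * h * M.
Proof.
move=> h0 fM.
have mid (u v c : R) : `|u - c| <= h -> `|v - c| <= h -> `|(u + v) / 2 - c| <= h.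
  by rewrite !ler_norml => /andP[? ?] /andP[? ?]; apply/andP; split; lra.
have half (u v : C) : (u + v) / 2 = cpx ((complex.Re u + complex.Re v) / 2) ((complex.Im u + complex.Im v) / 2).
  by rewrite [u]cpxE [v]cpxE cpxD cpx_half.
have hor (t a b : R) : `|t - y| = h -> `|a - x| <= h -> `|b - x| <= h ->
    cabs (midsum k f (cpx a t) (cpx b t)) <= `|b - a| * M.
  move=> ty ax bx; rewrite -[`|b - a|]cabs_cpx_real.
  rewrite (_ : cpx (b - a) 0 = cpx b t - cpx a t); last by rewrite cpxN cpxD subrr.
  apply: (midsum_le k (D := [set z | complex.Im z = t /\ `|complex.Re z - x| <= h])) => //.
    move=> u v [ut ux] [vt vx]; rewrite half; split=> /=; first by rewrite ut vt; field.
    exact: mid.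
  by move=> z [zt zx]; apply: fM; rewrite /on_square/in_square/= zt ty; split; [|right].
have ver (t a b : R) : `|t - x| = h -> `|a - y| <= h -> `|b - y| <= h ->
    cabs (midsum k f (cpx t a) (cpx t b)) <= `|b - a| * M.
  move=> ty ax bx; rewrite -[`|b - a|]cabs_cpx_im.
  rewrite (_ : cpx 0 (b - a) = cpx t b - cpx t a); last by rewrite cpxN cpxD subrr.
  apply: (midsum_le k (D := [set z | complex.Re z = t /\ `|complex.Im z - y| <= h])) => //.
    move=> u v [ut ux] [vt vx]; rewrite half; split=> /=; first by rewrite ut vt; field.
    exact: mid.
  by move=> z [zt zx]; apply: fM; rewrite /on_square/in_square/= zt ty; split; [|left].
have hp (c : R) : `|c + h - c| = h by rewrite addrAC subrr add0r ger0_norm.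
have hm (c : R) : `|c - h - c| = h by rewrite addrAC subrr add0r normrN ger0_norm.
have hp' (c : R) : `|c + h - c| <= h by rewrite hp.
have hm' (c : R) : `|c - h - c| <= h by rewrite hm.
have len1 (c : R) : `|c + h - (c - h)| = 2 * h.
  by rewrite (_ : _ - _ = 2 * h); [rewrite ger0_norm// mulr_ge0|ring].
have len2 (c : R) : `|c - h - (c + h)| = 2 * h by rewrite distrC len1.
have := hor _ _ _ (hm y) (hm' x) (hp' x); have := ver _ _ _ (hp x) (hm' y) (hp' y).
have := hor _ _ _ (hp y) (hp' x) (hm' x); have := ver _ _ _ (hm x) (hp' y) (hm' y).
rewrite !len1 !len2 /sqsum => h1 h2 h3 h4.
apply: le_trans (cabsD _ _) _; apply: le_trans (lerD (cabsD _ _) (lexx _)) _.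
apply: le_trans (lerD (lerD (cabsD _ _) (lexx _)) (lexx _)) _.
lra.
Qed.

End MidpointSums.

(** * Goursat's theorem with finitely many exceptional points *)

Section Goursat.
Variable R : realType.
Local Notation C := (Cplx R).
Implicit Types (x y h e : R) (z w a b : C) (f g : C -> C) (bad : seq C).

Definition cderivable f z := exists c : C, forall e, 0 < e ->
  exists2 d, 0 < d & forall w, cabs (w - z) < d ->
    cabs (f w - f z - c * (w - z)) <= e * cabs (w - z).

Definition bounded_near f z := exists2 d : R, 0 < d & exists M : R,
  forall w, cabs (w - z) < d -> cabs (f w) <= M.

(** The upper limit of the moduli of the sums is at most [e]; such bounds add up under subdivision
    even if the sums are not known to converge. *)
Definition sqsum_limsup_le f x y h e := forall e', 0 < e' ->
  exists k0, forall k, (k0 <= k)%N -> cabs (sqsum k f x y h) <= e + e'.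

(* Weight of a point in a square, additive under subdivision: boundary points  *)
(* are shared between the squares of a subdivision.                            *)
Definition interval_weight (t c h : R) : R :=
  if `|t - c| < h then 1 else if `|t - c| == h then 2^-1 else 0.

Definition square_weight z x y h :=
  interval_weight (complex.Re z) x h * interval_weight (complex.Im z) y h.

Lemma interval_weight_halves t c h : 0 < h -> interval_weight t c h =
  interval_weight t (c - h / 2) (h / 2) + interval_weight t (c + h / 2) (h / 2).
Proof.
move=> h0; rewrite /interval_weight.
have split_cases : [\/ t < c - h, t = c - h, c - h < t < c |
    t = c \/ [\/ c < t < c + h, t = c + h | c + h < t]].
  case: (ltgtP t (c - h)) => [?|?|->]; [exact: Or41| |exact: Or42].
  case: (ltgtP t c) => [?|?|->]; [by apply: Or43; apply/andP| |by apply: Or44; left].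
  apply: Or44; right; case: (ltgtP t (c + h)) => [?|?|->]; [|exact: Or33|exact: Or32].
  by apply: Or31; apply/andP.
have absl (s d : R) : 0 < d -> (`|s| < d) = (- d < s < d) by move=> _; rewrite ltr_norml.
have abse (s d : R) : 0 < d -> (`|s| == d) = ((s == d) || (s == - d)).
  by move=> d0; rewrite eqr_norml ltW// andbT.
rewrite !absl ?divr_gt0// !abse ?divr_gt0//.
have neg (b : bool) : ~ b -> b = false by case: b.
have pos (b : bool) : b -> b = true by [].
have E (u v : R) : (u == v) = (u <= v <= u) by rewrite eq_le andbC andbC.
rewrite !E.
case: split_cases => [H|->|/andP[H1 H2]|[->|[/andP[H1 H2]|->|H]]];
 repeat (match goal with |- context [if ?b then _ else _] =>
  first [rewrite (neg b); [|by apply/negP; lra]|rewrite (pos b); [|lra]] end); lra.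
Qed.

Lemma square_weight_quarters z x y h : 0 < h -> square_weight z x y h =
  square_weight z (x - h / 2) (y - h / 2) (h / 2) +
  square_weight z (x - h / 2) (y + h / 2) (h / 2) +
  square_weight z (x + h / 2) (y - h / 2) (h / 2) +
  square_weight z (x + h / 2) (y + h / 2) (h / 2).
Proof.
move=> h0; rewrite /square_weight (interval_weight_halves _ x)//.
by rewrite (interval_weight_halves _ y)//; ring.
Qed.

Lemma square_weight_in z x y h : in_square x y h z -> 4^-1 <= square_weight z x y h.
Proof.
have half (t c : R) : `|t - c| <= h -> 2^-1 <= interval_weight t c h.
  rewrite /interval_weight le_eqVlt => /orP[/eqP ->|->]; last by lra.
  by rewrite ltxx eqxx.
case=> /half h1 /half h2; rewrite (_ : 4^-1 = 2^-1 * 2^-1 :> R); last by field.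
by rewrite ler_pM.
Qed.

Lemma square_weight_ge0 z x y h : 0 <= square_weight z x y h.
Proof.
by rewrite mulr_ge0// /interval_weight; do 2?case: ifP => // _; rewrite invr_ge0.
Qed.

Lemma sqsum_limsup_quarters f x y h e1 e2 e3 e4 :
  sqsum_limsup_le f (x - h / 2) (y - h / 2) (h / 2) e1 ->
  sqsum_limsup_le f (x - h / 2) (y + h / 2) (h / 2) e2 ->
  sqsum_limsup_le f (x + h / 2) (y - h / 2) (h / 2) e3 ->
  sqsum_limsup_le f (x + h / 2) (y + h / 2) (h / 2) e4 ->
  sqsum_limsup_le f x y h (e1 + e2 + e3 + e4).
Proof.
move=> H1 H2 H3 H4 e' e'0; have e'4 : 0 < e' / 4 by rewrite divr_gt0.
have [k1 K1] := H1 _ e'4; have [k2 K2] := H2 _ e'4.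
have [k3 K3] := H3 _ e'4; have [k4 K4] := H4 _ e'4.
exists (k1 + k2 + k3 + k4).+1 => -[//|k]; rewrite ltnS => hk; rewrite sqsumS.
have {}K1 := K1 k ltac:(lia); have {}K2 := K2 k ltac:(lia).
have {}K3 := K3 k ltac:(lia); have {}K4 := K4 k ltac:(lia).
apply: le_trans (cabsD _ _) _; apply: le_trans (lerD (cabsD _ _) (lexx _)) _.
apply: le_trans (lerD (lerD (cabsD _ _) (lexx _)) (lexx _)) _.
lra.
Qed.

Lemma in_square_dist x y h z w :
  in_square x y h z -> in_square x y h w -> cabs (w - z) <= 4 * h.
Proof.
move=> [z1 z2] [w1 w2]; apply: le_trans (cabs_le_ReIm _) _.
rewrite !ReD !ImD !ReN !ImN.
move: z1 z2 w1 w2; rewrite !ler_norml => /andP[? ?] /andP[? ?] /andP[? ?] /andP[? ?].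
have : `|complex.Re w - complex.Re z| <= 2 * h by rewrite ler_norml; apply/andP; split; lra.
have : `|complex.Im w - complex.Im z| <= 2 * h by rewrite ler_norml; apply/andP; split; lra.
lra.
Qed.

(** The allowed error [eta * W] adds up under quartering, since area and weights do. On a small
    square around a point of derivability the affine part has zero sums and the rest is O(eta h^2),
    within the area term. Around a bad point the sums are O(h M), within the weight term, which is
    at least 1/4 there. *)
Lemma goursat f bad x0 y0 h0 : 0 < h0 ->
  (forall z, in_square x0 y0 h0 z -> z \notin bad -> cderivable f z) ->
  (forall z, z \in bad -> bounded_near f z) ->
  forall e, 0 < e -> exists k0, forall k, (k0 <= k)%N ->
    cabs (sqsum k f x0 y0 h0) <= e.
Proof.
move=> h00 fder fbad.
pose W x y h := h ^+ 2 + \sum_(b <- bad) square_weight b x y h.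
suff main eta : 0 < eta -> sqsum_limsup_le f x0 y0 h0 (eta * W x0 y0 h0).
  move=> e e0; have e2 : 0 < e / 2 by rewrite divr_gt0.
  have W0 : 0 < W x0 y0 h0.
    by rewrite ltr_pwDl ?exprn_gt0// sumr_ge0// => ? _; exact: square_weight_ge0.
  have [k0 hk0] := main (e / 2 / W x0 y0 h0) ltac:(by rewrite divr_gt0) _ e2.
  by exists k0 => k /hk0; rewrite divfK ?gt_eqF//; lra.
move=> eta0; apply: (square_bisection (P := fun x y h =>
  sqsum_limsup_le f x y h (eta * W x y h))) => // [x y h h_gt0 H1 H2 H3 H4|p1 p2 hp1 hp2].
  have := sqsum_limsup_quarters H1 H2 H3 H4; congr sqsum_limsup_le.
  rewrite -!mulrDr /W; congr (eta * _).
  under [in RHS]eq_bigr do rewrite square_weight_quarters//.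
  by rewrite !big_split /=; field.
pose p := cpx p1 p2.
have [pbad|pbad] := boolP (p \in bad).
  have [d d0 [M fM]] := fbad _ pbad.
  have M0 : 0 <= M by apply: le_trans (fM p _); rewrite ?cabs_ge0// subrr cabs0.
  (* The first bound keeps the square, of diameter at most 4 h, where |f| <= M; the second makes 8 h
     M at most eta / 4. *)
  exists (Num.min (d / 4) (eta / (32 * (M + 1)))).
    by rewrite lt_min !divr_gt0 ?mulr_gt0// ltr_wpDl.
  move=> x y h /andP[h_gt0]; rewrite lt_min => /andP[hd heta] px py _ _ e' e'0.
  exists 0%N => k _; apply: ler_wpDr; first exact: ltW.
  apply: (le_trans (sqsum_le k (M := M) (ltW h_gt0) _)).
    move=> z [zin _]; apply: fM; apply: (le_lt_trans (in_square_dist (x:=x) (y:=y) (h:=h) _ zin)) => //.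
    by rewrite mulrC -ltr_pdivlMr.
  have : 4^-1 <= W x y h.
    apply: ler_wpDl; first by rewrite exprn_ge0 ?ltW.
    rewrite (perm_big _ (perm_to_rem pbad)) big_cons; apply: ler_wpDr.
      by rewrite sumr_ge0// => ? _; exact: square_weight_ge0.
    exact: square_weight_in.
  rewrite -(ler_pM2l eta0); apply: le_trans.
  move: heta; rewrite ltr_pdivlMr; last by rewrite mulr_gt0// ltr_wpDl.
  have : 0 <= h * M by rewrite mulr_ge0// ltW.
  set u := h * M; rewrite (_ : h * (32 * (M + 1)) = 32 * u + 32 * h); last by rewrite /u; ring.
  rewrite (_ : 8 * h * M = 8 * u); last by rewrite /u; ring.
  lra.
have [c cP] := fder p (conj hp1 hp2) pbad.
(* Perimeter 8 h times eta / 32 times distance 4 h gives eta h^2. *)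
have [d d0 dP] := cP (eta / 32) ltac:(by rewrite divr_gt0).
exists (d / 4); first by rewrite divr_gt0.
move=> x y h /andP[h_gt0 hd] px py _ _ e' e'0.
exists 0%N => k _; apply: ler_wpDr; first exact: ltW.
have -> : f = fun z => (f z - f p - c * (z - p)) + (c * z + (f p - c * p)).
  by apply/funext => z; ring.
rewrite sqsumD sqsum_affine addr0.
apply: (le_trans (sqsum_le k (M := eta / 32 * (4 * h)) (ltW h_gt0) _)).
  move=> z [zin _]; have pz : cabs (z - p) <= 4 * h by exact: in_square_dist zin.
  apply: le_trans (dP _ _) _; last by rewrite ler_wpM2l// divr_ge0// ltW.
  by apply: le_lt_trans pz _; rewrite mulrC -ltr_pdivlMr.
rewrite (_ : 8 * h * _ = eta * h ^+ 2); last by field.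
by rewrite ler_pM2l// lerDl sumr_ge0// => ? _; exact: square_weight_ge0.
Qed.

End Goursat.

(** * Differentiability: explicit estimates and pointwise operations *)

Section Differentiability.

(** Replaces the Landau notation by an inequality on a neighbourhood, which can be transferred
    between functions that agree near the point. *)
Lemma differentiable_epsP (K : numFieldType) (V W : normedModType K)
    (f : V -> W) x :
  differentiable f x <-> exists df : {linear V -> W}, continuous df /\
    forall e, 0 < e -> \forall y \near x,
      `|f y - f x - df (y - x)| <= e * `|y - x|.
Proof.
split=> [/diffP[dc df]|[df [dfc dfE]]].
  exists ('d f x); split=> // e e0.
  have /eqaddoP H : f = (fun y => f (lim (nbhs x)) + 'd f x (y - lim (nbhs x)))
      +o_ (nbhs x) (fun y => y - lim (nbhs x)).
    by apply/eqaddoP; apply/eqaddoP; apply/funext.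
  have := H e e0; apply: filterS => y /=.
  by rewrite lim_id // -[(f - _) y]/(f y - (f x + 'd f x (y - x))) opprD addrA.
apply/diffP => /=.
apply: (@getPex _ (fun (dg : {linear V -> W}) => continuous dg /\
  forall y, f y = f (lim (nbhs x)) + dg (y - lim (nbhs x))
                  +o_(y \near x) (y - lim (nbhs x)))).
exists df; split=> // y; rewrite !lim_id //.
have : f = (fun y => f x + df (y - x)) +o_ (nbhs x) (fun y => y - x).
  apply/eqaddoP => e e0; have := dfE e e0; apply: filterS => z /=.
  by rewrite -[(f - _) z]/(f z - (f x + df (z - x))) opprD addrA.
by move=> /(congr1 (fun g => g y)).
Qed.

Lemma near_eq_differentiable (K : numFieldType) (V W : normedModType K)
    (f g : V -> W) x :
  (\forall y \near x, f y = g y) -> differentiable f x -> differentiable g x.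
Proof.
move=> fg /differentiable_epsP[df [dfc dfE]].
apply/differentiable_epsP; exists df; split=> // e e0.
have fgx := nbhs_singleton fg; have := dfE e e0.
by apply: filterS2 fg => y <-; rewrite fgx.
Qed.

End Differentiability.

Section PointwiseOperations.
Variables (K : numFieldType) (V : normedModType K).
Implicit Types (f g : V -> K) (x : V).

Lemma dfun_cst (c : K) x : differentiable (fun _ : V => c) x.
Proof. exact: (@differentiable_cst K V K c x). Qed.

Lemma dfunD f g x : differentiable f x -> differentiable g x ->
  differentiable (fun y => f y + g y) x.
Proof. exact: (@differentiableD K V K f g x). Qed.

Lemma dfunB f g x : differentiable f x -> differentiable g x ->
  differentiable (fun y => f y - g y) x.
Proof. exact: (@differentiableB K V K f g x). Qed.

Lemma dfunM f g x : differentiable f x -> differentiable g x ->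
  differentiable (fun y => f y * g y) x.
Proof. exact: (@differentiableM K V f g x). Qed.

Lemma dfunV f x : f x != 0 -> differentiable f x ->
  differentiable (fun y => (f y)^-1) x.
Proof. by move=> f0 df; exact: (@differentiableV K V f x df f0). Qed.

Lemma dfunX f k x : differentiable f x -> differentiable (fun y => f y ^+ k) x.
Proof.
move=> df; elim: k => [|k IH].
  by rewrite (_ : (fun _ => _) = fun=> 1); [exact: dfun_cst|apply/funext => y; rewrite expr0].
rewrite (_ : (fun _ => _) = fun y => f y * f y ^+ k); first exact: dfunM.
by apply/funext => y; rewrite exprS.
Qed.

Lemma dfun_sum (I : Type) (r : seq I) (P : pred I) (F : I -> V -> K) x :
  (forall i, P i -> differentiable (F i) x) ->
  differentiable (fun y => \sum_(i <- r | P i) F i y) x.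
Proof.
move=> dF; elim: r => [|i r IH].
  by rewrite (_ : (fun _ => _) = fun=> 0); [exact: dfun_cst|apply/funext => y; exact: big_nil].
have [Pi|nPi] := boolP (P i); last first.
  rewrite (_ : (fun _ => _) = fun y => \sum_(j <- r | P j) F j y)//.
  by apply/funext => y; rewrite big_cons (negPf nPi).
rewrite (_ : (fun _ => _) = fun y => F i y + \sum_(j <- r | P j) F j y).
  by apply: dfunD => //; exact: dF.
by apply/funext => y; rewrite big_cons Pi.
Qed.

Lemma dfun_prod (I : Type) (r : seq I) (P : pred I) (F : I -> V -> K) x :
  (forall i, P i -> differentiable (F i) x) ->
  differentiable (fun y => \prod_(i <- r | P i) F i y) x.
Proof.
move=> dF; elim: r => [|i r IH].
  by rewrite (_ : (fun _ => _) = fun=> 1); [exact: dfun_cst|apply/funext => y; exact: big_nil].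
have [Pi|nPi] := boolP (P i); last first.
  rewrite (_ : (fun _ => _) = fun y => \prod_(j <- r | P j) F j y)//.
  by apply/funext => y; rewrite big_cons (negPf nPi).
rewrite (_ : (fun _ => _) = fun y => F i y * \prod_(j <- r | P j) F j y).
  by apply: dfunM => //; exact: dF.
by apply/funext => y; rewrite big_cons Pi.
Qed.

End PointwiseOperations.

Lemma dfun_id (K : numFieldType) (x : K) : differentiable (fun y : K => y) x.
Proof. exact: (@ex_diff _ _ _ _ _ _ id (is_diff_id x)). Qed.

Section RowMaps.
Variable K : numFieldType.
Implicit Types (f : 'rV[K]_2 -> K).

Lemma row2E (p : 'rV[K]_2) : p = row2 (p 0 0) (p 0 1).
Proof.
by apply/rowP=> k; rewrite !mxE; case: k => [[|[|//]]] lt_k /=;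
  congr (p 0 _); apply/val_inj.
Qed.

Lemma row20 (a b : K) : row2 a b 0 0 = a. Proof. by rewrite mxE. Qed.
Lemma row21 (a b : K) : row2 a b 0 1 = b. Proof. by rewrite mxE. Qed.

Lemma row2D (a b c d : K) : row2 a b + row2 c d = row2 (a + c) (b + d).
Proof. by apply/rowP=> k; rewrite !mxE; case: k => [[|[|//]]]. Qed.

Lemma row2Z (a b c : K) : c *: row2 a b = row2 (c * a) (c * b).
Proof. by apply/rowP=> k; rewrite !mxE; case: k => [[|[|//]]]. Qed.

Lemma mx_norm_leP m n (M : 'M[K]_(m, n)) e : 0 <= e ->
  `|M| <= e <-> forall i j, `|M i j| <= e.
Proof.
move=> e0; rewrite [in `|M|]/Num.Def.normr /= mx_normE; case/nonnegP: e0 => {}e.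
rewrite num_le; split=> [/bigmax_leP[_ H] i j|H].
  by have := H (i, j) isT; rewrite -num_le.
by apply/bigmax_leP; split=> [|[i j] _]; rewrite -num_le//=.
Qed.

Lemma row2_norm_le (a b e : K) : `|a| <= e -> `|b| <= e -> `|row2 a b| <= e.
Proof.
move=> ae be; apply/mx_norm_leP => [|i j]; first exact: le_trans ae.
by rewrite mxE; case: j => [[|[|//]]].
Qed.

Lemma coord_norm_le m n (M : 'M[K]_(m, n)) i j : `|M i j| <= `|M|.
Proof. by have /mx_norm_leP := lexx `|M|; apply. Qed.

Lemma differentiable_row d (V : normedModType K) (phi : V -> 'rV[K]_d) x :
  (forall j, differentiable (fun y => phi y 0 j) x) -> differentiable phi x.
Proof.
move=> dphi; have -> : phi = \sum_j (fun y => phi y 0 j *: delta_mx 0 j : 'rV[K]_d).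
  apply/funext => y; rewrite fct_sumE; apply/rowP => k; rewrite summxE (bigD1 k)//=.
  rewrite !mxE !eqxx mulr1 big1 ?addr0// => j jk.
  by rewrite !mxE eqxx eq_sym (negPf jk) mulr0.
by apply: differentiable_sum => j; exact: differentiableZl.
Qed.

Lemma diff_coord d (V : normedModType K) (phi : V -> 'rV[K]_d) x v j :
  differentiable phi x -> ('d phi x v) 0 j = 'd (fun y => phi y 0 j) x v.
Proof.
move=> dphi.
have dco : differentiable (fun M : 'rV[K]_d => M 0 j : K) (phi x) := differentiable_coord _ _ _.
have -> : (fun y => phi y 0 j) = (fun M : 'rV[K]_d => M 0 j) \o phi by [].
rewrite (diff_comp dphi dco) /=.
suff -> : 'd (fun M : 'rV[K]_d => M 0 j : K) (phi x) = (fun M => M 0 j) :> ('rV[K]_d -> K) by [].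
pose f := fun N : 'rV[K]_d => N 0 j : K^o.
have lf : linear f by move=> k u w; rewrite /f !mxE.
pose F : {linear 'rV[K]_d -> K^o} := HB.pack f (GRing.isLinear.Build _ _ _ _ f lf).
exact/(@diff_lin _ _ _ F)/coord_continuous.
Qed.

Lemma differentiable_row2 (V : normedModType K) (f g : V -> K) x :
  differentiable f x -> differentiable g x ->
  differentiable (fun y => row2 (f y) (g y)) x.
Proof.
move=> df dg; apply: differentiable_row => -[[|[|//]]] lt_j /=.
  by rewrite (_ : (fun y => _) = f)//; apply/funext => y; rewrite mxE.
by rewrite (_ : (fun y => _) = g)//; apply/funext => y; rewrite mxE.
Qed.

End RowMaps.

Section ComplexDifferentiability.
Variable R : realType.
Local Notation C := (Cplx R).

Lemma posC_gt (e : C) : 0 < e -> exists2 r : R, 0 < r & e = r%:C%C.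
Proof.
by case: e => a b; rewrite ltcE /= => /andP[/eqP -> a0]; exists a.
Qed.

Lemma nbhs_cabsP (z : C) (A : set C) :
  nbhs z A <-> exists2 d : R, 0 < d & forall w, cabs (w - z) < d -> A w.
Proof.
split=> [/nbhs_ballP[e /= e0 eA]|[d d0 dA]].
  have [r r0 er] := posC_gt e0; exists r => // w wz; apply: eA.
  by rewrite -ball_normE /ball_/= distrC er -cabs_ltE.
apply/nbhs_ballP; exists d%:C%C; first by rewrite /= ltcR.
by move=> w; rewrite -ball_normE /ball_/= distrC -cabs_ltE; exact: dA.
Qed.

Lemma nbhs_row2P (p : 'rV[C]_2) (A : set 'rV[C]_2) :
  nbhs p A <-> exists2 d : R, 0 < d & forall u v,
    cabs (u - p 0 0) < d -> cabs (v - p 0 1) < d -> A (row2 u v).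
Proof.
split=> [/nbhs_ballP[e /= e0 eA]|[d d0 dA]].
  have [r r0 er] := posC_gt e0; exists r => // u v ur vr; apply: eA; split=> //.
  move=> i j; rewrite -ball_normE /ball_/= distrC er -cabs_ltE (row2E p) !mxE.
  by case: j => [[|[|//]]] lt_j /=.
apply/nbhs_ballP; exists d%:C%C; first by rewrite /= ltcR.
move=> q [_ qd]; rewrite (row2E q); apply: dA.
  by have := qd 0 0; rewrite -ball_normE /ball_/= distrC -cabs_ltE.
by have := qd 0 1; rewrite -ball_normE /ball_/= distrC -cabs_ltE.
Qed.

Lemma differentiable_cderivable (f : C -> C) z :
  differentiable f z -> cderivable f z.
Proof.
move=> /differentiable_epsP[df [_ dfE]].
exists (df 1) => e e0; have [|d d0 dP] := (nbhs_cabsP _ _).1 (dfE e%:C%C _).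
  by rewrite ltcR.
have dfZ u : df u = df 1 * u.
  by rewrite mulrC -[X in df X = _]mulr1 (linearZ_LR df u 1).
by exists d => // w /dP /=; rewrite cabs_leE rmorphM/= -cabsE -dfZ.
Qed.

Lemma continuous_bounded_near (f : C -> C) z :
  {for z, continuous f} -> bounded_near f z.
Proof.
move=> /cvgrPdist_le /(_ 1 ltr01) /nbhs_cabsP[d d0 dP].
exists d => //; exists (cabs (f z) + 1) => w /dP /=.
rewrite -[1]/(1%:C%C : C) -cabs_leE cabsB => H.
by rewrite -[f w](subrK (f z)) addrC (le_trans (cabsD _ _))// lerD2l.
Qed.

Lemma differentiable2_eps (f : 'rV[C]_2 -> C) (p : 'rV[C]_2) (a b : C) :
  (forall e : R, 0 < e -> exists2 d : R, 0 < d & forall u v,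
     cabs (u - p 0 0) < d -> cabs (v - p 0 1) < d ->
     cabs (f (row2 u v) - f p - (a * (u - p 0 0) + b * (v - p 0 1))) <=
     e * (cabs (u - p 0 0) + cabs (v - p 0 1))) ->
  differentiable f p.
Proof.
move=> fP; pose l := fun q : 'rV[C]_2 => a * q 0 0 + b * q 0 1 : C.
have ll : linear (l : _ -> C^o) by move=> k u v; rewrite /l !mxE /GRing.scale /=; ring.
pose L : {linear 'rV[C]_2 -> C} := HB.pack l (GRing.isLinear.Build _ _ _ _ (l : _ -> C^o) ll).
apply/differentiable_epsP; exists L; split.
  move=> q; apply: differentiable_continuous.
  have -> : L = ((cst a * fun N : 'rV[C]_2 => N 0 0 : C) + (cst b * fun N : 'rV[C]_2 => N 0 1 : C)) :> ('rV[C]_2 -> C) by [].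
  by apply: differentiableD; apply: differentiableM => //; exact: differentiable_coord.
move=> e /posC_gt[r r0 ->].
have [|d d0 dP] := fP (r / 2); first by rewrite divr_gt0.
apply/nbhs_row2P; exists d => // u v ur vr.
have := dP u v ur vr; rewrite /L/= /l !mxE/= => H.
have Hu := coord_norm_le (row2 u v - p) 0 0; have Hv := coord_norm_le (row2 u v - p) 0 1.
rewrite !mxE /= in Hu Hv.
rewrite cabsE; apply: (@le_trans _ _ (r / 2 * (cabs (u - p 0 0) + cabs (v - p 0 1)))%:C%C).
  by rewrite lecR.
rewrite rmorphM rmorphD/= -!cabsE.
apply: (@le_trans _ _ ((r / 2)%:C%C * (`|row2 u v - p| + `|row2 u v - p|))).
  by rewrite ler_wpM2l ?lerD// lecR divr_ge0// ltW.
set N := `|_|; rewrite (_ : N + N = 2 * N); last by rewrite mulr_natl mulr2n.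
by rewrite mulrA rmorphM/= fmorphV rmorph_nat mulfVK ?pnatr_eq0.
Qed.

End ComplexDifferentiability.

(** * Contour integrals over square boundaries *)

Section ContourIntegral.
Variable R : realType.
Local Notation C := (Cplx R).
Implicit Types (h : R) (z w : C) (f g : C -> C).

Lemma cabs_triangle_sub u z w : cabs (u - w) <= cabs (u - z) + cabs (z - w).
Proof. by rewrite -(subrKA z) cabsD. Qed.

(** Compactness of the boundary as an induction principle over sets, obtained by bisection: a small
    square near a boundary point is handled by [Ploc], and one near any other point misses the
    boundary. *)
Lemma on_square_compact h (P : set C -> Prop) : 0 < h ->
  P set0 -> (forall A B, P A -> P B -> P (A `|` B)) ->
  (forall A B, A `<=` B -> P B -> P A) ->
  (forall z, on_square 0 0 h z ->
     exists2 d : R, 0 < d & P [set w | cabs (w - z) < d]) ->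
  P (on_square 0 0 h).
Proof.
move=> h0 P0 PU PS Ploc.
suff : P (in_square 0 0 h `&` on_square 0 0 h) by apply: PS => z [].
apply: (square_bisection (P := fun x y k => P (in_square x y k `&` on_square 0 0 h))) => //.
  move=> x y k k0 P1 P2 P3 P4; apply: PS (PU _ _ (PU _ _ P1 P2) (PU _ _ P3 P4)).
  move=> z [[zx zy] zh].
  have half (t c : R) : `|t - c| <= k -> `|t - (c - k / 2)| <= k / 2 \/ `|t - (c + k / 2)| <= k / 2.
    rewrite ler_norml => /andP[? ?]; have [?|?] := lerP t c; [left|right];
    by rewrite ler_norml; apply/andP; split; lra.
  by case: (half _ _ zx) => ?; case: (half _ _ zy) => ?; [left; left|left; right|right; left|right; right].
move=> a b ha hb; pose p := cpx a b.
have [pon|poff] := pselect (on_square 0 0 h p).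
  have [d d0 Pd] := Ploc _ pon; exists (d / 4); first by rewrite divr_gt0.
  move=> x y k /andP[k0 kd] ax bx _ _; apply: PS Pd => z [zin _] /=.
  apply: le_lt_trans (in_square_dist (z := p) _ zin) _; first by [].
  by rewrite mulrC -ltr_pdivlMr.
have [na nb] : `|a - 0| < h /\ `|b - 0| < h.
  by split; rewrite lt_neqAle ?ha ?hb andbT; apply/eqP => E; apply: poff; split=> //; [left|right].
exists (Num.min (h - `|a - 0|) (h - `|b - 0|) / 2).
  by rewrite divr_gt0// lt_min !subr_gt0 na nb.
move=> x y k /andP[k0]; rewrite ltr_pdivlMr// lt_min => /andP[ka kb] ax bx _ _.
apply: PS P0 => z [[zx zy] [_]] /=.
have near (t c s : R) : `|s - c| <= k -> `|t - c| <= k -> k * 2 < h - `|t - 0| -> `|s - 0| <> h :> R.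
  move=> sc tc; rewrite !subr0 => H.
  have := ler_normD (s - c) (c - t); have := ler_normD (s - t) t.
  rewrite subrKA subrK [`|c - t|]distrC; lra.
by case; [exact: (near a x _ zx ax ka)|exact: (near b y _ zy bx kb)].
Qed.

Definition bounded_on_square h f :=
  exists M, forall z, on_square 0 0 h z -> cabs (f z) <= M.

Lemma continuous_bounded_on_square h f : 0 < h ->
  (forall z, on_square 0 0 h z -> {for z, continuous f}) -> bounded_on_square h f.
Proof.
move=> h0 fc; rewrite /bounded_on_square.
apply: (on_square_compact (P := fun A => exists M, forall z, A z -> cabs (f z) <= M)) => //.
- by exists 0 => z [].
- move=> A B [M AM] [N BN]; exists (Num.max M N) => z [/AM|/BN] H;
  by rewrite le_max H ?orbT.
- by move=> A B AB [M BM]; exists M => z /AB/BM.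
by move=> z /fc/continuous_bounded_near[d d0 [M fM]]; exists d => //; exists M.
Qed.

(* Limits along an ultrafilter: contour integrals are thereby defined for all  *)
(* bounded functions, without proving that the Riemann sums converge.          *)
Lemma exists_generalized_limit : exists L : (nat -> C) -> C,
  [/\ forall x y, (exists M, forall k, cabs (x k) <= M) ->
        (exists M, forall k, cabs (y k) <= M) -> L (fun k => x k + y k) = L x + L y,
      forall c x, (exists M, forall k, cabs (x k) <= M) -> L (fun k => c * x k) = c * L x,
      forall x M, (exists M, forall k, cabs (x k) <= M) ->
        (exists k0, forall k, (k0 <= k)%N -> cabs (x k) <= M) -> cabs (L x) <= 2 * M &
      forall x M, (exists M, forall k, cabs (x k) <= M) ->
        (forall k, M <= complex.Im (x k)) -> M <= complex.Im (L x)].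
Proof.
have [G [GU sG]] := @ultraFilterLemma _ (\oo) _.
have GP : ProperFilter G := @ultra_proper _ _ GU.
have GF : Filter G := @filter_filter _ _ GP.
(* A segment is compact, so a bounded sequence has a cluster point along [G]; an ultrafilter
   converges to its cluster points. *)
have rcvg (x : nat -> R) : (exists M : R, forall k, `|x k| <= M) -> cvg (x @ G).
  move=> [M xM]; have xG : G (x @^-1` [set` `[- M, M]]).
    by apply: filterE => k /=; rewrite in_itv /= -ler_norml; exact: xM.
  have [l [_ lG]] := @segment_compact R (- M) M (x @ G) _ xG.
  apply/cvg_ex; exists l => B lB.
  have [//|/= GnB] := in_ultra_setVsetC (x @^-1` B) GU.
  by have [t [nBt Bt]] := lG (~` B) B GnB lB.
have Rebd (x : nat -> C) : (exists M, forall k, cabs (x k) <= M) -> exists M : R, forall k, `|complex.Re (x k)| <= M.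
  by move=> [M xM]; exists M => k; apply: le_trans (Re_le_cabs _) (xM k).
have Imbd (x : nat -> C) : (exists M, forall k, cabs (x k) <= M) -> exists M : R, forall k, `|complex.Im (x k)| <= M.
  by move=> [M xM]; exists M => k; apply: le_trans (Im_le_cabs _) (xM k).
pose LR (x : nat -> R) : R := lim (x @ G).
have LRD (x y : nat -> R) : cvg (x @ G) -> cvg (y @ G) -> LR (fun k => x k + y k) = LR x + LR y.
  by move=> cx cy; exact: (limD cx cy).
have LRZ (c : R) (x : nat -> R) : cvg (x @ G) -> LR (fun k => c * x k) = c * LR x.
  by move=> cx; apply/cvg_lim => //; apply: cvgM => //; exact: cvg_cst.
pose L (x : nat -> C) := cpx (LR (fun k => complex.Re (x k))) (LR (fun k => complex.Im (x k))).
have LRabs (x : nat -> R) (M : R) : cvg (x @ G) -> (exists k0, forall k, (k0 <= k)%N -> `|x k| <= M) -> `|LR x| <= M.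
  move=> cx [k0 xM]; have xG : \near G, `|x G| <= M by apply: sG; exists k0.
  rewrite ler_norml; apply/andP; split.
    by apply: limr_ge => //; apply: filterS xG => k; rewrite ler_norml => /andP[].
  by apply: limr_le => //; apply: filterS xG => k; rewrite ler_norml => /andP[].
exists L; split.
- move=> x y xb yb; rewrite /L cpxD -!LRD; try by apply: rcvg; auto.
  by congr cpx; congr LR; apply/funext => k; rewrite ?ReD ?ImD.
- move=> c x xb; have cR := rcvg _ (Rebd _ xb); have cI := rcvg _ (Imbd _ xb).
  have cZ (a : R) (y : nat -> R) : cvg (y @ G) -> cvg ((fun k => a * y k) @ G).
    by move=> cy; apply: is_cvgM => //; exact: is_cvg_cst.
  rewrite /L; case: c => a b.
  rewrite (_ : _ * cpx _ _ = cpx (a * LR (fun k => complex.Re (x k)) + (- b) * LR (fun k => complex.Im (x k)))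
      (a * LR (fun k => complex.Im (x k)) + b * LR (fun k => complex.Re (x k)))); last first.
    by rewrite mulNr.
  rewrite -!LRZ// -!LRD; try by apply: cZ.
  congr cpx; congr LR; apply/funext => k; case: (x k) => u v /=; ring.
(* Real and imaginary parts are bounded separately, hence the factor 2. *)
- move=> x M xb [k0 xM]; apply: le_trans (cabs_le_ReIm _) _; rewrite /L /=.
  rewrite mulr_natl mulr2n lerD//; apply: LRabs; try by apply: rcvg; auto.
    by exists k0 => k /xM; apply: le_trans (Re_le_cabs _).
  by exists k0 => k /xM; apply: le_trans (Im_le_cabs _).
- move=> x M xb xM; apply: limr_ge; first exact/rcvg/Imbd.
  exact: filterE.
Qed.

Definition generalized_limit : (nat -> C) -> C := sval (cid exists_generalized_limit).

Definition contour_int h f : C := generalized_limit (fun k => sqsum k f 0 0 h).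

Lemma sqsum_bounded h f : 0 < h -> bounded_on_square h f ->
  exists M, forall k, cabs (sqsum k f 0 0 h) <= M.
Proof. by move=> h0 [M fM]; exists (8 * h * M) => k; apply: sqsum_le => //; exact: ltW. Qed.

Lemma contour_intD h f g : 0 < h -> bounded_on_square h f -> bounded_on_square h g ->
  contour_int h (fun z => f z + g z) = contour_int h f + contour_int h g.
Proof.
move=> h0 fb gb; rewrite /contour_int /generalized_limit; case: cid => L [LD _ _ _] /=.
rewrite -LD; try exact: sqsum_bounded.
by congr L; apply/funext => k; rewrite sqsumD.
Qed.

Lemma contour_intZ h c f : 0 < h -> bounded_on_square h f ->
  contour_int h (fun z => c * f z) = c * contour_int h f.
Proof.
move=> h0 fb; rewrite /contour_int /generalized_limit; case: cid => L [_ LZ _ _] /=.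
rewrite -LZ; try exact: sqsum_bounded.
by congr L; apply/funext => k; rewrite sqsumZ.
Qed.

Lemma contour_int_le h f M : 0 < h -> (forall z, on_square 0 0 h z -> cabs (f z) <= M) ->
  cabs (contour_int h f) <= 16 * h * M.
Proof.
move=> h0 fM; rewrite /contour_int /generalized_limit; case: cid => L [_ _ Lle _] /=.
rewrite (_ : 16 * h * M = 2 * (8 * h * M)); last by ring.
apply: Lle; first by apply: sqsum_bounded => //; exists M.
by exists 0%N => k _; apply: sqsum_le => //; exact: ltW.
Qed.

Lemma contour_int_eq0 h f : 0 < h -> bounded_on_square h f ->
  (forall e : R, 0 < e -> exists k0, forall k, (k0 <= k)%N -> cabs (sqsum k f 0 0 h) <= e) ->
  contour_int h f = 0.
Proof.
move=> h0 fb f0; apply/eqP; rewrite -cabs_eq0 eq_le cabs_ge0 andbT.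
apply/ler_addgt0Pl => e e0; rewrite addr0.
have e2 : 0 < e / 2 by rewrite divr_gt0.
rewrite /contour_int /generalized_limit; case: cid => L [_ _ Lle _] /=.
rewrite (_ : e = 2 * (e / 2)); last by field.
by apply: Lle; [exact: sqsum_bounded|exact: f0].
Qed.

Lemma contour_int_im_ge h f M : 0 < h -> bounded_on_square h f ->
  (forall k, M <= complex.Im (sqsum k f 0 0 h)) -> M <= complex.Im (contour_int h f).
Proof.
move=> h0 fb fM; rewrite /contour_int /generalized_limit; case: cid => L [_ _ _ Lge] /=.
by apply: Lge => //; exact: sqsum_bounded.
Qed.

Lemma eq_bounded_on_square h f g : (forall z, on_square 0 0 h z -> f z = g z) ->
  bounded_on_square h f -> bounded_on_square h g.
Proof. by move=> fg [M fM]; exists M => z zh; rewrite -fg ?fM. Qed.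

Lemma bounded_on_squareM h f g : bounded_on_square h f -> bounded_on_square h g ->
  bounded_on_square h (fun z => f z * g z).
Proof.
by move=> [M fM] [N gN]; exists (M * N) => z zh; rewrite cabsM ler_pM ?cabs_ge0 ?fM ?gN.
Qed.

Lemma bounded_on_squareD h f g : bounded_on_square h f -> bounded_on_square h g ->
  bounded_on_square h (fun z => f z + g z).
Proof.
move=> [M fM] [N gN]; exists (M + N) => z zh.
by rewrite (le_trans (cabsD _ _))// lerD ?fM ?gN.
Qed.

Lemma bounded_on_square_cst h c : bounded_on_square h (fun=> c).
Proof. by exists (cabs c). Qed.

Lemma eq_contour_int h f g : 0 < h -> bounded_on_square h f ->
  (forall z, on_square 0 0 h z -> f z = g z) -> contour_int h f = contour_int h g.
Proof.
move=> h0 fb fg; have gb := eq_bounded_on_square fg fb.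
have fgb : bounded_on_square h (fun z => (- 1) * f z + g z).
  by exists 0 => z zh; rewrite fg// mulN1r addNr cabs0.
have : contour_int h (fun z => (- 1) * f z + g z) = 0.
  apply: contour_int_eq0 => // e e0; exists 0%N => k _.
  apply: le_trans (sqsum_le k (M := 0) (ltW h0) _) _; last by rewrite mulr0 ltW.
  by move=> z zh; rewrite fg// mulN1r addNr cabs0.
rewrite contour_intD//; last exact/bounded_on_squareM/fb/bounded_on_square_cst.
by rewrite (contour_intZ (-1)) // mulN1r addrC => /eqP; rewrite subr_eq0 => /eqP.
Qed.

End ContourIntegral.

(** * Cauchy's formula on a square *)

Section CauchyFormula.
Variable R : realType.
Local Notation C := (Cplx R).
Implicit Types (h : R) (z w u v : C) (f g : C -> C) (F G : 'rV[C]_2 -> C).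

Definition open_square h w := `|complex.Re w| < h /\ `|complex.Im w| < h.

Lemma cpxV (a b : R) :
  (cpx a b)^-1 = cpx (a / (a ^+ 2 + b ^+ 2)) (- (b / (a ^+ 2 + b ^+ 2))).
Proof. by []. Qed.

(** Along a segment of direction [u] each piece of the sum is a nonnegative real multiple of a value
    of [u * f]. With [D] the side of a square this bounds its contribution to [winding] from
    below. *)
Lemma midsum_im_ge k f (D : set C) (t r : R) u a b :
  (forall z w, D z -> D w -> D ((z + w) / 2)) -> 0 <= t ->
  (forall z, D z -> r <= complex.Im (u * f z)) -> D a -> D b ->
  b - a = t%:C%C * u -> t * r <= complex.Im (midsum k f a b).
Proof.
move=> Dmid t0 fr; elim: k t t0 a b => [|k IH] t t0 a b Da Db ab /=.
  have H := fr _ (Dmid _ _ Da Db).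
  rewrite ab -mulrA; set z := u * _ in H *; rewrite [z]cpxE /= mul0r addr0.
  exact: ler_wpM2l.
have ab2 : b - a = (t / 2)%:C%C * u + (t / 2)%:C%C * u.
  by rewrite ab -mulrDl -rmorphD /=; congr (_%:C%C * _); field.
have Dm := Dmid _ _ Da Db.
have H1 : t / 2 * r <= complex.Im (midsum k f a ((a + b) / 2)).
  apply: IH => //; first by rewrite divr_ge0.
  rewrite (_ : _ - a = (b - a) / 2); last by field.
  by rewrite ab2; field.
have H2 : t / 2 * r <= complex.Im (midsum k f ((a + b) / 2) b).
  apply: IH => //; first by rewrite divr_ge0.
  rewrite (_ : b - _ = (b - a) / 2); last by field.
  by rewrite ab2; field.
by rewrite ImD (_ : t * r = t / 2 * r + t / 2 * r); [exact: lerD|field].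
Qed.

Lemma open_square_gap h w : open_square h w -> exists2 m : R, 0 < m &
  [/\ m <= h - complex.Re w, m <= h + complex.Re w,
      m <= h - complex.Im w & m <= h + complex.Im w].
Proof.
rewrite /open_square !ltr_norml => -[/andP[? ?] /andP[? ?]].
exists (Num.min (Num.min (h - complex.Re w) (h + complex.Re w))
               (Num.min (h - complex.Im w) (h + complex.Im w))).
  by rewrite !lt_min; apply/andP; split; apply/andP; split; lra.
by split; rewrite !ge_min lexx ?orbT.
Qed.

Lemma on_square_sides h z : on_square 0 0 h z ->
  [/\ - h <= complex.Re z <= h, - h <= complex.Im z <= h &
   [\/ complex.Re z = h, complex.Re z = - h, complex.Im z = h | complex.Im z = - h]].
Proof.
rewrite /on_square /in_square /= !subr0 => -[[H1 H2] H3]; rewrite -!ler_norml; split=> //.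
case: H3 => [Hz|Hz].
  have := lerP 0 (complex.Re z) => -[z0|z0].
    by constructor 1; rewrite -Hz ger0_norm.
  by constructor 2; rewrite -Hz ltr0_norm// opprK.
have := lerP 0 (complex.Im z) => -[z0|z0].
  by constructor 3; rewrite -Hz ger0_norm.
by constructor 4; rewrite -Hz ltr0_norm// opprK.
Qed.

Lemma on_square_away h w : open_square h w -> exists2 m : R, 0 < m &
  forall z, on_square 0 0 h z -> m <= cabs (z - w).
Proof.
move=> /open_square_gap[m m0 [m1 m2 m3 m4]]; exists m => // z /on_square_sides[_ _].
have re : `|complex.Re z - complex.Re w| <= cabs (z - w).
  by rewrite -ReN -ReD; exact: Re_le_cabs.
have im : `|complex.Im z - complex.Im w| <= cabs (z - w).
  by rewrite -ImN -ImD; exact: Im_le_cabs.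
have absge (a : R) : m <= a \/ m <= - a -> m <= `|a| by rewrite ler_normr => -[->|->]; rewrite ?orbT.
by case=> H; [apply: le_trans re|apply: le_trans re|apply: le_trans im|apply: le_trans im];
  apply: absge; rewrite H; [left|right|left|right]; lra.
Qed.

Lemma bounded_on_square_inv h w : open_square h w ->
  bounded_on_square h (fun z => (z - w)^-1).
Proof.
move=> /on_square_away[m m0 mP]; exists m^-1 => z /mP mz.
by rewrite cabsV lef_pV2// posrE (lt_le_trans m0).
Qed.

Definition winding h w : C := contour_int h (fun z => (z - w)^-1).

(* The contributions of the four sides have positive imaginary parts; the      *)
(* exact value is not needed.                                                  *)
Lemma winding_neq0 h w : 0 < h -> open_square h w -> winding h w != 0.
Proof.
move=> h0 hw; have [m m0 [m1 m2 m3 m4]] := open_square_gap hw.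
(* On each side, with direction u, the imaginary part of u / (z - w) is the distance from w to the
   line of that side, at least m, divided by |z - w|^2, at most 8 h^2. *)
pose r := m / (8 * h ^+ 2).
have r0 : 0 < r by rewrite divr_gt0// mulr_gt0// exprn_gt0.
suff : 8 * h * r <= complex.Im (winding h w).
  apply: contraL => /eqP ->; rewrite -ltNge (_ : complex.Im _ = 0)//.
  by apply: mulr_gt0 => //; apply: mulr_gt0.
apply: contour_int_im_ge => //; first exact: bounded_on_square_inv.
move=> k.
have quot (x a b : R) : m <= x -> (x = a \/ x = - a \/ x = b \/ x = - b) -> `|a| <= 2 * h -> `|b| <= 2 * h ->
    r <= x / (a ^+ 2 + b ^+ 2).
  move=> mx xab ah bh; rewrite /r ler_pM ?(ltW m0)//.
    by rewrite invr_ge0 mulr_ge0// exprn_ge0// ltW.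
  have ab0 : 0 < a ^+ 2 + b ^+ 2.
    rewrite lt_neqAle addr_ge0 ?sqr_ge0// andbT eq_sym paddr_eq0 ?sqr_ge0//.
    rewrite !sqrf_eq0; apply/negP => /andP[/eqP a0 /eqP b0].
    by move: xab mx; rewrite a0 b0 oppr0; case=> [->|[->|[->|->]]]; rewrite leNgt m0.
  rewrite lef_pV2 ?posrE// ?mulr_gt0 ?exprn_gt0//.
  have sq (c : R) : `|c| <= 2 * h -> c ^+ 2 <= 4 * h ^+ 2.
    move=> ch; rewrite -real_normK ?num_real// (_ : 4 * h ^+ 2 = (2 * h) ^+ 2); last by ring.
    by rewrite lerXn2r// nnegrE ?mulr_ge0 ?ltW.
  have := sq _ ah; have := sq _ bh; lra.
have bnd (s t : R) : - h <= s <= h -> - h < t < h -> `|s - t| <= 2 * h.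
  by move=> /andP[? ?] /andP[? ?]; rewrite ler_norml; apply/andP; split; lra.
have [wre wim] : - h < complex.Re w < h /\ - h < complex.Im w < h.
  by move: hw; rewrite /open_square !ltr_norml.
have edge (D : set C) u a b :
    (forall z w, D z -> D w -> D ((z + w) / 2)) ->
    (forall z, D z -> - h <= complex.Re z <= h /\ - h <= complex.Im z <= h) ->
    (forall z, D z -> exists x, [/\ m <= x, complex.Im (u * (z - w)^-1) =
       x / ((complex.Re z - complex.Re w) ^+ 2 + (complex.Im z - complex.Im w) ^+ 2) &
       x = complex.Re z - complex.Re w \/ x = - (complex.Re z - complex.Re w) \/
       x = complex.Im z - complex.Im w \/ x = - (complex.Im z - complex.Im w)]) ->
    D a -> D b -> b - a = (2 * h)%:C%C * u ->
    2 * h * r <= complex.Im (midsum k (fun z => (z - w)^-1) a b).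
  move=> Dmid Dh Dx Da Db ab.
  apply: (@midsum_im_ge k _ D _ _ u) => //; first by rewrite mulr_ge0// ltW.
  move=> z Dz; have [x [mx -> xab]] := Dx _ Dz; have [z1 z2] := Dh _ Dz.
  by apply: quot => //; exact: bnd.
have inv_w z : (z - w)^-1 = cpx ((complex.Re z - complex.Re w) / ((complex.Re z - complex.Re w) ^+ 2 + (complex.Im z - complex.Im w) ^+ 2))
    (- ((complex.Im z - complex.Im w) / ((complex.Re z - complex.Re w) ^+ 2 + (complex.Im z - complex.Im w) ^+ 2))).
  by rewrite -cpxV; congr _^-1; rewrite [z]cpxE [w]cpxE cpxN cpxD.
have mid (s t : R) : - h <= s <= h -> - h <= t <= h -> - h <= (s + t) / 2 <= h.
  by move=> /andP[? ?] /andP[? ?]; apply/andP; split; lra.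
have half (z z' : C) : (z + z') / 2 = cpx ((complex.Re z + complex.Re z') / 2) ((complex.Im z + complex.Im z') / 2).
  by rewrite [z]cpxE [z']cpxE cpxD cpx_half.
have hh : - h <= h <= h by apply/andP; split; lra.
have hNh : - h <= - h <= h by apply/andP; split; lra.
have rowD (c : R) : forall z z' : C, complex.Im z = c /\ - h <= complex.Re z <= h ->
    complex.Im z' = c /\ - h <= complex.Re z' <= h ->
    complex.Im ((z + z') / 2) = c /\ - h <= complex.Re ((z + z') / 2) <= h.
  move=> z z' [zc zh] [z'c z'h]; rewrite half /= zc z'c; split; last exact: mid.
  by field.
have colD (c : R) : forall z z' : C, complex.Re z = c /\ - h <= complex.Im z <= h ->
    complex.Re z' = c /\ - h <= complex.Im z' <= h ->
    complex.Re ((z + z') / 2) = c /\ - h <= complex.Im ((z + z') / 2) <= h.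
  move=> z z' [zc zh] [z'c z'h]; rewrite half /= zc z'c; split; last exact: mid.
  by field.
rewrite /sqsum !ImD !sub0r !add0r.
have E1 : 2 * h * r <= complex.Im (midsum k (fun z => (z - w)^-1) (cpx (- h) (- h)) (cpx h (- h))).
  apply: (edge [set z | complex.Im z = - h /\ - h <= complex.Re z <= h] (cpx 1 0) _ _ (rowD _)) => //=.
  - by move=> z [-> ?].
  - move=> z [zi zr]; exists (- (complex.Im z - complex.Im w)); split; last by auto.
      by rewrite zi; lra.
    by rewrite inv_w /= mul1r mul0r addr0 mulNr.
  - by rewrite cpxN cpxD; congr Complex; ring.
have E2 : 2 * h * r <= complex.Im (midsum k (fun z => (z - w)^-1) (cpx h (- h)) (cpx h h)).
  apply: (edge [set z | complex.Re z = h /\ - h <= complex.Im z <= h] (cpx 0 1) _ _ (colD _)) => //=.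
  - by move=> z [-> ?].
  - move=> z [zi zr]; exists (complex.Re z - complex.Re w); split; last by auto.
      by rewrite zi; lra.
    by rewrite inv_w /= mul1r mul0r add0r.
  - by rewrite cpxN cpxD; congr Complex; ring.
have E3 : 2 * h * r <= complex.Im (midsum k (fun z => (z - w)^-1) (cpx h h) (cpx (- h) h)).
  apply: (edge [set z | complex.Im z = h /\ - h <= complex.Re z <= h] (cpx (- 1) 0) _ _ (rowD _)) => //=.
  - by move=> z [-> ?].
  - move=> z [zi zr]; exists (complex.Im z - complex.Im w); split; last by auto.
      by rewrite zi; lra.
    by rewrite inv_w /= mul0r addr0 mulN1r opprK.
  - by rewrite cpxN cpxD; congr Complex; ring.
have E4 : 2 * h * r <= complex.Im (midsum k (fun z => (z - w)^-1) (cpx (- h) h) (cpx (- h) (- h))).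
  apply: (edge [set z | complex.Re z = - h /\ - h <= complex.Im z <= h] (cpx 0 (- 1)) _ _ (colD _)) => //=.
  - by move=> z [-> ?].
  - move=> z [zi zr]; exists (- (complex.Re z - complex.Re w)); split; last by auto.
      by rewrite zi; lra.
    by rewrite inv_w /= mul0r add0r mulN1r mulNr.
  - by rewrite cpxN cpxD; congr Complex; ring.
rewrite (_ : 8 * h * r = 2 * h * r + 2 * h * r + 2 * h * r + 2 * h * r); last by ring.
by rewrite !lerD.
Qed.

(** The quotient (f z - f w) / (z - w) is derivable outside 0 and w and bounded near both, so
    [goursat] makes its integral vanish. Allowing [f] to be merely bounded near 0 is what later
    removes singularities. *)
Lemma cauchy_formula h f w : 0 < h -> open_square h w -> w != 0 ->
  (forall z, in_square 0 0 h z -> z != 0 -> differentiable f z) ->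
  bounded_near f 0 ->
  contour_int h (fun z => f z * (z - w)^-1) = f w * winding h w.
Proof.
move=> h0 hw w0 df fb.
have on0 z : on_square 0 0 h z -> z != 0.
  have o0 : open_square h 0 by split; rewrite normr0.
  have [m m0 mP] := on_square_away o0 => /mP; rewrite subr0 -cabs_gt0.
  exact: lt_le_trans.
have onw z : on_square 0 0 h z -> z != w.
  have [m m0 mP] := on_square_away hw => /mP; rewrite -subr_eq0 -cabs_gt0.
  exact: lt_le_trans.
have fbd : bounded_on_square h f.
  apply: continuous_bounded_on_square => // z zh.
  by apply: differentiable_continuous; apply: df; [case: zh|exact: on0].
have ibd := bounded_on_square_inv hw.
have dfw : differentiable f w.
  by apply: df => //; case: hw; rewrite /in_square /= !subr0 => ? ?; split; exact: ltW.
pose g z := (f z - f w) * (z - w)^-1.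
have gE z : g z = f z * (z - w)^-1 + (- f w) * (z - w)^-1.
  by rewrite /g mulrDl mulNr.
have gbd : bounded_on_square h g.
  rewrite (_ : g = fun z => f z * (z - w)^-1 + (- f w) * (z - w)^-1); last exact/funext.
  apply: bounded_on_squareD; first exact: bounded_on_squareM.
  exact/bounded_on_squareM/ibd/bounded_on_square_cst.
have : contour_int h g = 0.
  apply: contour_int_eq0 => //; apply: (@goursat _ g [:: 0; w]) => //.
    move=> z zh; rewrite !inE negb_or => /andP[z0 zw].
    apply: differentiable_cderivable; apply: (@dfunM _ _ (fun z => f z - f w)).
      by apply: dfunB; [exact: df|exact: dfun_cst].
    apply: dfunV; first by rewrite subr_eq0.
    by apply: dfunB; [exact: dfun_id|exact: dfun_cst].
  move=> z; rewrite !inE => /orP[|] /eqP ->.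
    case: fb => d d0 [M fM]; have w2 : 0 < cabs w / 2 by rewrite divr_gt0// cabs_gt0.
    exists (Num.min d (cabs w / 2)); first by rewrite lt_min d0.
    exists ((M + cabs (f w)) * (cabs w / 2)^-1) => t; rewrite lt_min => /andP[td tw].
    rewrite /g cabsM; apply: ler_pM; rewrite ?cabs_ge0//.
      by rewrite (le_trans (cabsD _ _))// cabsN lerD// fM.
    have : cabs w / 2 <= cabs (t - w).
      by have := cabs_triangle_sub 0 t w; rewrite !sub0r !cabsN; move: tw; rewrite subr0; lra.
    by move=> H; rewrite cabsV lef_pV2// posrE (lt_le_trans w2).
  have [c cP] := differentiable_cderivable dfw.
  have [d d0 dP] := cP 1 ltr01; exists d => //; exists (cabs c + 1) => t /dP H.
  have [->|tw] := eqVneq t w.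
    by rewrite /g !subrr mul0r cabs0 addr_ge0// cabs_ge0.
  have tw0 : 0 < cabs (t - w) by rewrite cabs_gt0 subr_eq0.
  rewrite /g cabsM cabsV ler_pdivrMr// mulrDl -cabsM.
  by rewrite -[f t - f w](subrK (c * (t - w))) addrC (le_trans (cabsD _ _))// lerD2l.
rewrite (eq_contour_int h0 gbd (g := fun z => f z * (z - w)^-1 + (- f w) * (z - w)^-1)) //.
rewrite contour_intD//; [|exact: bounded_on_squareM|exact/bounded_on_squareM/ibd/bounded_on_square_cst].
rewrite contour_intZ// => /eqP; rewrite addr_eq0 => /eqP ->.
by rewrite mulNr opprK.
Qed.

End CauchyFormula.

(** * Cauchy integrals and removable singularities in two variables *)

Section Extension.
Variable R : realType.
Local Notation C := (Cplx R).
Implicit Types (h : R) (z w u v : C) (F G : 'rV[C]_2 -> C).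

(** Here the torus is the product of two square boundaries, over which the iterated Cauchy integrals
    are taken. It stays away from both axes. *)
Definition bounded_on_torus h F := exists M,
  forall z w, on_square 0 0 h z -> on_square 0 0 h w -> cabs (F (row2 z w)) <= M.

Definition torus_int h F : C :=
  contour_int h (fun z => contour_int h (fun w => F (row2 z w))).

Lemma bounded_torus_slice h F z : bounded_on_torus h F -> on_square 0 0 h z ->
  bounded_on_square h (fun w => F (row2 z w)).
Proof. by move=> [M FM] zh; exists M => w wh; exact: FM. Qed.

Lemma bounded_torus_int h F : 0 < h -> bounded_on_torus h F ->
  bounded_on_square h (fun z => contour_int h (fun w => F (row2 z w))).
Proof.
by move=> h0 [M FM]; exists (16 * h * M) => z zh; apply: contour_int_le => // w; exact: FM.
Qed.

Lemma torus_intD h F G : 0 < h -> bounded_on_torus h F -> bounded_on_torus h G ->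
  torus_int h (fun p => F p + G p) = torus_int h F + torus_int h G.
Proof.
move=> h0 Fb Gb; rewrite /torus_int -contour_intD//; try exact: bounded_torus_int.
apply/esym/eq_contour_int => //.
  by apply: bounded_on_squareD; exact: bounded_torus_int.
by move=> z zh; rewrite -contour_intD//; exact: bounded_torus_slice.
Qed.

Lemma torus_intZ h c F : 0 < h -> bounded_on_torus h F ->
  torus_int h (fun p => c * F p) = c * torus_int h F.
Proof.
move=> h0 Fb; rewrite /torus_int -contour_intZ//; last exact: bounded_torus_int.
apply/esym/eq_contour_int => //.
  by apply: bounded_on_squareM; [exact: bounded_on_square_cst|exact: bounded_torus_int].
by move=> z zh; rewrite -contour_intZ//; exact: bounded_torus_slice.
Qed.

Lemma torus_int_le h F M : 0 < h ->
  (forall z w, on_square 0 0 h z -> on_square 0 0 h w -> cabs (F (row2 z w)) <= M) ->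
  cabs (torus_int h F) <= 16 * h * (16 * h * M).
Proof.
by move=> h0 FM; apply: contour_int_le => // z zh; apply: contour_int_le => // w; exact: FM.
Qed.

Lemma bounded_torusM h F G : bounded_on_torus h F -> bounded_on_torus h G ->
  bounded_on_torus h (fun p => F p * G p).
Proof.
by move=> [M FM] [N GN]; exists (M * N) => z w zh wh; rewrite cabsM ler_pM ?cabs_ge0 ?FM ?GN.
Qed.

Lemma bounded_torus_cst h c : bounded_on_torus h (fun=> c).
Proof. by exists (cabs c). Qed.

Lemma continuous_bounded_on_torus h F : 0 < h ->
  (forall z w, on_square 0 0 h z -> on_square 0 0 h w ->
     {for row2 z w, continuous F}) -> bounded_on_torus h F.
Proof.
move=> h0 Fc; rewrite /bounded_on_torus.
have loc z w : on_square 0 0 h z -> on_square 0 0 h w -> exists2 d : R, 0 < d & exists M,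
    forall z' w', cabs (z' - z) < d -> cabs (w' - w) < d -> cabs (F (row2 z' w')) <= M.
  move=> zh wh; have /cvgrPdist_le/(_ 1 ltr01) := Fc _ _ zh wh.
  move=> /nbhs_row2P[d d0]; rewrite row20 row21 => dP; exists d => //.
  exists (cabs (F (row2 z w)) + 1) => z' w' zd wd; have /= := dP _ _ zd wd.
  rewrite -[1]/(1%:C%C : C) -cabs_leE cabsB => H.
  by rewrite -[F (row2 z' w')](subrK (F (row2 z w))) addrC (le_trans (cabsD _ _))// lerD2l.
apply: (on_square_compact (P := fun A => exists M, forall z w, A z ->
    on_square 0 0 h w -> cabs (F (row2 z w)) <= M)) => //.
- by exists 0 => z w [].
- move=> A B [M AM] [N BN]; exists (Num.max M N) => z w [/AM|/BN] H wh;
  by rewrite le_max H ?orbT.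
- by move=> A B AB [M BM]; exists M => z w /AB; exact: BM.
move=> z zh.
have [d d0 [M dM]] : exists2 d : R, 0 < d & exists M, forall z' w, cabs (z' - z) < d ->
    on_square 0 0 h w -> cabs (F (row2 z' w)) <= M.
  apply: (on_square_compact (P := fun A => exists2 d : R, 0 < d & exists M,
    forall z' w, cabs (z' - z) < d -> A w -> cabs (F (row2 z' w)) <= M)) => //.
  - by exists 1 => //; exists 0 => ? ? ? [].
  - move=> A B [d d0 [M AM]] [e e0 [N BN]]; exists (Num.min d e); first by rewrite lt_min d0.
    exists (Num.max M N) => z' w; rewrite lt_min => /andP[zd ze].
    by rewrite le_max => -[/(AM _ _ zd)|/(BN _ _ ze)] ->; rewrite ?orbT.
  - by move=> A B AB [d d0 [M BM]]; exists d => //; exists M => z' w zd /AB; exact: BM.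
  move=> w wh; have [d d0 [M dM]] := loc _ _ zh wh.
  by exists d => //; exists d => //; exists M.
by exists d => //; exists M => z' w; exact: dM.
Qed.

Definition cauchy_kernel u v (p : 'rV[C]_2) : C := (p 0 0 - u)^-1 * (p 0 1 - v)^-1.

(* Differentiation under the integral sign, the kernel being a rational        *)
(* function of [(u, v)] whose poles stay away from the torus.                  *)
Lemma cauchy_integral_differentiable h F u v : 0 < h ->
  bounded_on_torus h F -> open_square h u -> open_square h v ->
  differentiable (fun p : 'rV[C]_2 =>
    torus_int h (fun q => F q * cauchy_kernel (p 0 0) (p 0 1) q)) (row2 u v).
Proof.
move=> h0 Fb hu hv; have [mu mu0 muP] := on_square_away hu; have [mv mv0 mvP] := on_square_away hv.
have [M0 FM0] := Fb; pose M := Num.max M0 0.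
have FM z w : on_square 0 0 h z -> on_square 0 0 h w -> cabs (F (row2 z w)) <= M.
  by move=> zh wh; rewrite le_max FM0.
pose m := Num.min mu mv / 2; have m0 : 0 < m by rewrite divr_gt0// lt_min mu0.
have m2 : m <= m * 2 by rewrite mulr_natr mulr2n lerDl ltW.
have mu2 : m * 2 <= mu by rewrite /m mulfVK// ge_min lexx.
have mv2 : m * 2 <= mv by rewrite /m mulfVK// ge_min lexx orbT.
have kle t t' m' z : on_square 0 0 h z -> m' <= cabs (z - t) -> m * 2 <= m' -> cabs (t' - t) < m -> cabs (z - t')^-1 <= m^-1.
  move=> zh zt mm tt; have mz : m <= cabs (z - t') by have := cabs_triangle_sub z t' t; lra.
  have cz : 0 < cabs (z - t') := lt_le_trans m0 mz.
  by rewrite cabsV lef_pV2 ?posrE.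
have kb t t' m' : (forall z, on_square 0 0 h z -> m' <= cabs (z - t)) -> m * 2 <= m' ->
    cabs (t' - t) < m -> forall z, on_square 0 0 h z -> (z - t' != 0) /\ cabs (z - t')^-1 <= m^-1.
  move=> tP mm tt z zh; split; last exact: (kle t t' m' z zh (tP _ zh) mm tt).
  by rewrite -cabs_gt0; have := tP _ zh; have := cabs_triangle_sub z t' t; lra.
have uu : cabs (u - u) < m by rewrite subrr cabs0.
have vv : cabs (v - v) < m by rewrite subrr cabs0.
pose K t : 'rV[C]_2 -> C := fun q => (q 0 0 - t)^-1.
pose L t : 'rV[C]_2 -> C := fun q => (q 0 1 - t)^-1.
have Kb t : cabs (t - u) < m -> bounded_on_torus h (K t).
  by move=> tu; exists m^-1 => z w zh wh; rewrite /K row20; case: (kb _ _ _ muP mu2 tu _ zh).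
have Lb t : cabs (t - v) < m -> bounded_on_torus h (L t).
  by move=> tu; exists m^-1 => z w zh wh; rewrite /L row21; case: (kb _ _ _ mvP mv2 tu _ wh).
pose a := torus_int h (fun q => F q * (K u q ^+ 2 * L v q)).
pose b := torus_int h (fun q => F q * (K u q * L v q ^+ 2)).
apply: (@differentiable2_eps _ _ _ a b) => e e0; rewrite row20 row21.
pose B := 16 * h * (16 * h * (M * m^-1 ^+ 4)).
have B0 : 0 <= B.
  have hp : 0 <= 16 * h by rewrite mulr_ge0// ltW.
  apply: mulr_ge0 => //; apply: mulr_ge0 => //; apply: mulr_ge0.
    by rewrite le_max lexx orbT.
  by rewrite exprn_ge0// invr_ge0 ltW.
exists (Num.min m (e / (2 * (B + 1)))).
  by rewrite lt_min m0 divr_gt0// mulr_gt0// ltr_wpDl.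
move=> u' v'; rewrite !lt_min => /andP[um ue] /andP[vm ve].
(* The exact second-order remainder of the kernel, obtained from 1/(z - u') - 1/(z - u) = (u' - u) /
   ((z - u) (z - u')) in each variable. All factors are at most 1/m on the torus, so it is quadratic
   in the increments. *)
pose Rem q := (u' - u) ^+ 2 * (K u q ^+ 2 * K u' q * L v q) + (v' - v) ^+ 2 * (K u q * L v q ^+ 2 * L v' q)
  + (u' - u) * (v' - v) * (K u q * K u' q * L v q * L v' q).
have -> : torus_int h (fun q => F q * cauchy_kernel (row2 u' v' 0 0) (row2 u' v' 0 1) q) -
    torus_int h (fun q => F q * cauchy_kernel u v q) - (a * (u' - u) + b * (v' - v)) =
    torus_int h (fun q => F q * Rem q).
  rewrite row20 row21 /a /b.
  have b0 := bounded_torusM Fb (bounded_torusM (Kb _ uu) (Lb _ vv)).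
  have b0' := bounded_torusM Fb (bounded_torusM (Kb _ um) (Lb _ vm)).
  have b1 : bounded_on_torus h (fun q => F q * (K u q ^+ 2 * L v q)).
    by apply: bounded_torusM => //; apply: bounded_torusM; [exact: (bounded_torusM (Kb _ uu) (Kb _ uu))|exact: Lb].
  have b2 : bounded_on_torus h (fun q => F q * (K u q * L v q ^+ 2)).
    by apply: bounded_torusM => //; apply: bounded_torusM; [exact: Kb|exact: (bounded_torusM (Lb _ vv) (Lb _ vv))].
  have bZ c G : bounded_on_torus h G -> bounded_on_torus h (fun q => c * G q).
    by move=> Gb; apply: bounded_torusM => //; exact: bounded_torus_cst.
  have bD G G' : bounded_on_torus h G -> bounded_on_torus h G' -> bounded_on_torus h (fun q => G q + G' q).
    by move=> [N1 G1] [N2 G2]; exists (N1 + N2) => z w zh wh; rewrite (le_trans (cabsD _ _))// lerD ?G1 ?G2.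

  have -> : torus_int h (fun q => F q * Rem q) =
    torus_int h (fun q => (F q * cauchy_kernel u' v' q) + ((-1) * (F q * cauchy_kernel u v q) +
     (- (u' - u) * (F q * (K u q ^+ 2 * L v q)) + (- (v' - v) * (F q * (K u q * L v q ^+ 2)))))).
    have E z w : on_square 0 0 h z -> on_square 0 0 h w -> F (row2 z w) * Rem (row2 z w) =
      F (row2 z w) * cauchy_kernel u' v' (row2 z w) + ((-1) * (F (row2 z w) * cauchy_kernel u v (row2 z w)) +
     (- (u' - u) * (F (row2 z w) * (K u (row2 z w) ^+ 2 * L v (row2 z w))) + (- (v' - v) * (F (row2 z w) * (K u (row2 z w) * L v (row2 z w) ^+ 2))))).
      move=> zh wh; rewrite /Rem /K /L /cauchy_kernel !row20 !row21.
      have [z1 _] := kb _ _ _ muP mu2 uu _ zh; have [z2 _] := kb _ _ _ muP mu2 um _ zh.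
      have [w1 _] := kb _ _ _ mvP mv2 vv _ wh; have [w2 _] := kb _ _ _ mvP mv2 vm _ wh.
      by field; rewrite z1 z2 w1 w2.
    have bb : bounded_on_torus h (fun q => (F q * cauchy_kernel u' v' q) + ((-1) * (F q * cauchy_kernel u v q) +
       (- (u' - u) * (F q * (K u q ^+ 2 * L v q)) + (- (v' - v) * (F q * (K u q * L v q ^+ 2)))))).
      by apply: (bD _ _ b0'); apply: (bD _ _); [exact: bZ|apply: (bD _ _); exact: bZ].
    apply/esym/eq_contour_int => //; first exact: (bounded_torus_int h0 bb).
    move=> z zh; apply: eq_contour_int => //; first exact: (bounded_torus_slice bb zh).
    by move=> w wh; rewrite E.
  rewrite torus_intD//; last by apply: (bD _ _); [exact: bZ|apply: (bD _ _); exact: bZ].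
  rewrite torus_intD//; [|exact: bZ|by apply: (bD _ _); exact: bZ].
  rewrite torus_intD//; [|exact: bZ|exact: bZ].
  by rewrite !torus_intZ//; ring.
apply: (@le_trans _ _ (B * (cabs (u' - u) + cabs (v' - v)) ^+ 2)).
  rewrite /B -!mulrA; set s := (_ + _) ^+ 2.
  rewrite (_ : 16 * _ = 16 * h * (16 * h * (M * (m^-1 ^+ 4 * s)))); last by ring.
  apply: torus_int_le => // z w zh wh; rewrite cabsM ler_pM ?cabs_ge0 ?FM//.
  rewrite /Rem /K /L !row20 !row21.
  have [_ z1] := kb _ _ _ muP mu2 uu _ zh; have [_ z2] := kb _ _ _ muP mu2 um _ zh.
  have [_ w1] := kb _ _ _ mvP mv2 vv _ wh; have [_ w2] := kb _ _ _ mvP mv2 vm _ wh.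
  move: z1 z2 w1 w2; move: (z - u)^-1 (z - u')^-1 (w - v)^-1 (w - v')^-1 => k k' l l' Hk Hk' Hl Hl'.
  have P4 (x1 x2 x3 x4 : C) : cabs x1 <= m^-1 -> cabs x2 <= m^-1 -> cabs x3 <= m^-1 -> cabs x4 <= m^-1 ->
      cabs (x1 * x2 * x3 * x4) <= m^-1 ^+ 4.
    move=> H1 H2 H3 H4; rewrite !cabsM !exprSr expr0 mul1r.
    by do 3!(apply: ler_pM; rewrite ?cabs_ge0 ?mulr_ge0 ?cabs_ge0//).
  have p1 : cabs (k ^+ 2 * k' * l) <= m^-1 ^+ 4 by rewrite expr2; exact: P4.
  have p2 : cabs (k * l ^+ 2 * l') <= m^-1 ^+ 4 by rewrite expr2 mulrA; exact: P4.
  have p3 : cabs (k * k' * l * l') <= m^-1 ^+ 4 by exact: P4.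
  apply: le_trans (cabsD _ _) _; apply: le_trans (lerD (cabsD _ _) (lexx _)) _.
  rewrite [cabs ((u' - u) ^+ 2 * _)]cabsM [cabs ((v' - v) ^+ 2 * _)]cabsM.
  rewrite [cabs ((u' - u) * _ * _)]cabsM [cabs ((u' - u) * _)]cabsM !(cabsX (_ - _)) /s.
  set x := cabs (u' - u); set y := cabs (v' - v).
  have x0 : 0 <= x := cabs_ge0 _; have y0 : 0 <= y := cabs_ge0 _.
  have q1 := ler_wpM2l (sqr_ge0 x) p1; have q2 := ler_wpM2l (sqr_ge0 y) p2.
  have q3 := ler_wpM2l (mulr_ge0 x0 y0) p3.
  have q4 : 0 <= x * y * m^-1 ^+ 4 by apply: mulr_ge0; [exact: mulr_ge0|apply: exprn_ge0; rewrite invr_ge0 ltW].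
  apply: le_trans (lerD (lerD q1 q2) q3) _.
  rewrite (_ : _ * (x + y) ^+ 2 = x ^+ 2 * m^-1 ^+ 4 + y ^+ 2 * m^-1 ^+ 4 + x * y * m^-1 ^+ 4 + x * y * m^-1 ^+ 4); last by ring.
  by rewrite lerDl.
set s := cabs (u' - u) + cabs (v' - v).
have s0 : 0 <= s by rewrite addr_ge0// cabs_ge0.
rewrite expr2 mulrA ler_wpM2r//.
have : s * (B + 1) <= e.
  rewrite -ler_pdivlMr ?ltr_wpDl//.
  move: ue ve; rewrite invfM mulrA; set t := (B + 1)^-1; rewrite /s.
  rewrite (_ : e / 2 * t = e * t / 2); last by ring.
  set c := e * t; lra.
have : 0 <= s * 1 by rewrite mulr1.
rewrite mulrDr [B * s]mulrC; lra.
Qed.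

(** The one-variable formula applied twice, in the inner variable and then in the outer one. *)
Lemma torus_int_kernel h F u v : 0 < h -> open_square h u -> open_square h v ->
  bounded_on_torus h F ->
  (forall z, on_square 0 0 h z ->
     contour_int h (fun w => F (row2 z w) * (w - v)^-1) = F (row2 z v) * winding h v) ->
  contour_int h (fun z => F (row2 z v) * (z - u)^-1) = F (row2 u v) * winding h u ->
  torus_int h (fun q => F q * cauchy_kernel u v q) = F (row2 u v) * (winding h u * winding h v).
Proof.
move=> h0 hu hv Fb Ev Eu.
have ub := bounded_on_square_inv hu; have vb := bounded_on_square_inv hv.
have Fvb : bounded_on_square h (fun z => F (row2 z v)).
  apply: (@eq_bounded_on_square _ _ (fun z => (winding h v)^-1 * contour_int h (fun w => F (row2 z w) * (w - v)^-1))).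
    by move=> z zh; rewrite Ev// mulrCA mulVf ?mulr1//; exact: winding_neq0.
  apply: bounded_on_squareM; first exact: bounded_on_square_cst.
  have : bounded_on_torus h (fun p => F p * (p 0 1 - v)^-1).
    apply: bounded_torusM => //; have [M vM] := vb; exists M => z w zh wh.
    by rewrite row21 vM.
  move=> /(bounded_torus_int h0); apply: eq_bounded_on_square => z zh.
  by congr contour_int; apply/funext => w; rewrite row21.
rewrite mulrA -Eu mulrC -contour_intZ//; last exact: bounded_on_squareM.
rewrite /torus_int; apply/esym/eq_contour_int => //.
  by apply: bounded_on_squareM; [exact: bounded_on_square_cst|exact: bounded_on_squareM].
move=> z zh; transitivity ((z - u)^-1 * (F (row2 z v) * winding h v)); first by ring.
rewrite -Ev// -contour_intZ//; last by apply: bounded_on_squareM => //; exact: bounded_torus_slice.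
apply: eq_contour_int => //.
  by apply: bounded_on_squareM; [exact: bounded_on_square_cst|apply: bounded_on_squareM => //; exact: bounded_torus_slice].
by move=> w wh; rewrite /cauchy_kernel row20 row21; ring.
Qed.

End Extension.

(** * Removable singularities along a pair of lines *)

Section RemovableCross.
Variable R : realType.
Local Notation C := (Cplx R).
Implicit Types (h : R) (z w u v : C) (F G : 'rV[C]_2 -> C).

Lemma differentiable_slice1 F u v : differentiable F (row2 u v) ->
  differentiable (fun w => F (row2 w v)) u.
Proof.
move=> dF; apply: (@differentiable_comp _ _ _ _ (fun w => row2 w v) F _ _ dF).
by apply: differentiable_row2; [exact: dfun_id|exact: dfun_cst].
Qed.

Lemma differentiable_slice2 F u v : differentiable F (row2 u v) ->
  differentiable (fun w => F (row2 u w)) v.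
Proof.
move=> dF; apply: (@differentiable_comp _ _ _ _ (fun w => row2 u w) F _ _ dF).
by apply: differentiable_row2; [exact: dfun_cst|exact: dfun_id].
Qed.

Lemma on_square_neq0 h z : 0 < h -> on_square 0 0 h z -> z != 0.
Proof.
move=> h0; have o0 : open_square h (0 : C) by split; rewrite normr0.
have [m m0 mP] := on_square_away o0 => /mP; rewrite subr0 -cabs_gt0.
exact: lt_le_trans.
Qed.

Lemma open_in_square h w : open_square h w -> in_square 0 0 h w.
Proof. by case; rewrite /in_square /= !subr0 => ? ?; split; exact: ltW. Qed.

Lemma removable_axes h F : 0 < h ->
  (forall u v, in_square 0 0 h u -> in_square 0 0 h v -> u != 0 -> v != 0 ->
     differentiable F (row2 u v)) ->
  (forall v, v != 0 -> in_square 0 0 h v -> exists2 d : R, 0 < d & exists M,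
     forall u, u != 0 -> cabs u < d -> cabs (F (row2 u v)) <= M) ->
  (forall u, u != 0 -> in_square 0 0 h u -> exists2 d : R, 0 < d & exists M,
     forall v, v != 0 -> cabs v < d -> cabs (F (row2 u v)) <= M) ->
  exists G, forall u v, open_square h u -> open_square h v ->
    differentiable G (row2 u v) /\ (u != 0 -> v != 0 -> G (row2 u v) = F (row2 u v)).
Proof.
move=> h0 dF Fu Fv.
have bnear (f : C -> C) : (exists2 d : R, 0 < d & exists M, forall u, u != 0 -> cabs u < d -> cabs (f u) <= M) ->
    bounded_near f 0.
  move=> [d d0 [M fM]]; exists d => //; exists (Num.max M (cabs (f 0))) => w.
  rewrite subr0 le_max => wd; have [->|w0] := eqVneq w 0; first by rewrite lexx orbT.
  by rewrite fM.
have Fb : bounded_on_torus h F.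
  apply: continuous_bounded_on_torus => // z w zh wh; apply: differentiable_continuous.
  by apply: dF; [case: zh|case: wh|exact: on_square_neq0 zh|exact: on_square_neq0 wh].
have oneb : bounded_on_torus h (fun=> 1 : C) := bounded_torus_cst h 1.
pose T H (p : 'rV[C]_2) := torus_int h (fun q => H q * cauchy_kernel (p 0 0) (p 0 1) q).
exists (fun p => T F p * (T (fun=> 1) p)^-1) => u v hu hv.
have T1 : T (fun=> 1) (row2 u v) = winding h u * winding h v.
  rewrite /T row20 row21 (@torus_int_kernel _ _ (fun=> 1))//; first by rewrite mul1r.
    by move=> z zh; rewrite mul1r; congr contour_int; apply/funext => w; rewrite mul1r.
  by rewrite mul1r; congr contour_int; apply/funext => w; rewrite mul1r.
have T1_neq0 : T (fun=> 1) (row2 u v) != 0.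
  by rewrite T1 mulf_neq0//; exact: winding_neq0.
split.
  apply: dfunM; first exact: cauchy_integral_differentiable.
  apply: dfunV => //; exact: (cauchy_integral_differentiable h0 oneb hu hv).
move=> u0 v0; rewrite T1 /T row20 row21 torus_int_kernel ?mulfK//.
- by rewrite -T1.
- move=> z zh; apply: (@cauchy_formula _ h (fun w => F (row2 z w))) => //.
    move=> w wh w0; apply: differentiable_slice2; apply: dF => //; first by case: zh.
    exact: on_square_neq0 zh.
  by apply: bnear; apply: Fv; [exact: on_square_neq0 zh|case: zh].
- apply: (@cauchy_formula _ h (fun w => F (row2 w v))) => //.
    move=> w wh w0; apply: differentiable_slice1; apply: dF => //; exact: open_in_square.
  by apply: bnear; apply: Fu => //; exact: open_in_square.
Qed.

Lemma differentiable_translate (f : 'rV[C]_2 -> C) (p0 p : 'rV[C]_2) :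
  differentiable f (p + p0) -> differentiable (fun q => f (q + p0)) p.
Proof.
move=> df; apply: (@differentiable_comp _ _ _ _ (fun q => q + p0) f _ _ df).
apply: (@differentiableD _ _ _ id (cst p0)); last exact: differentiable_cst.
exact: (@ex_diff _ _ _ _ _ _ id (is_diff_id p)).
Qed.

(* This covers Riemann's extension theorem along a curve or a normal crossing  *)
(* (each slice being bounded near it) as well as Hartogs' theorem at a point   *)
(* (each slice extending across it).                                           *)
Lemma removable_cross F u0 v0 d : 0 < d ->
  (forall u v, cabs (u - u0) < d -> cabs (v - v0) < d -> u != u0 -> v != v0 ->
     differentiable F (row2 u v)) ->
  (forall v, v != v0 -> cabs (v - v0) < d -> exists2 e : R, 0 < e & exists M,
     forall u, u != u0 -> cabs (u - u0) < e -> cabs (F (row2 u v)) <= M) ->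
  (forall u, u != u0 -> cabs (u - u0) < d -> exists2 e : R, 0 < e & exists M,
     forall v, v != v0 -> cabs (v - v0) < e -> cabs (F (row2 u v)) <= M) ->
  exists G, exists2 e : R, 0 < e <= d & forall u v, cabs (u - u0) < e -> cabs (v - v0) < e ->
    differentiable G (row2 u v) /\ (u != u0 -> v != v0 -> G (row2 u v) = F (row2 u v)).
Proof.
move=> d0 dF Fu Fv; pose h := d / 4; have h0 : 0 < h by rewrite divr_gt0.
have insq w : in_square 0 0 h w -> cabs w < d.
  case; rewrite !subr0 => H1 H2; have := cabs_le_ReIm w; rewrite /h in H1 H2; lra.
have [|v vn0 /insq vd|u un0 /insq ud|G GP] := @removable_axes h (fun q => F (q + row2 u0 v0)) h0.
- move=> u v /insq ud /insq vd u_neq0 v_neq0; apply: differentiable_translate; rewrite row2D.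
  by apply: dF; rewrite ?addrK// -subr_eq0 addrK.
- have [||e e0 [M FM]] := Fu (v + v0); rewrite ?addrK//; first by rewrite -subr_eq0 addrK.
  exists e => //; exists M => u u_neq0 ue; rewrite row2D.
  by apply: FM; rewrite ?addrK// -subr_eq0 addrK.
- have [||e e0 [M FM]] := Fv (u + u0); rewrite ?addrK//; first by rewrite -subr_eq0 addrK.
  exists e => //; exists M => v v_neq0 ve; rewrite row2D.
  by apply: FM; rewrite ?addrK// -subr_eq0 addrK.
exists (fun p => G (p + row2 (- u0) (- v0))), h.
  by rewrite h0 /= /h; lra.
have opn w : cabs w < h -> open_square h w.
  by move=> wh; split; apply: le_lt_trans wh; [exact: Re_le_cabs|exact: Im_le_cabs].
move=> u v /opn uh /opn vh; have [dG GF] := GP _ _ uh vh; split.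
  by apply: differentiable_translate; rewrite row2D.
by move=> uu0 vv0; rewrite row2D GF ?subr_eq0// row2D !subrK.
Qed.

End RemovableCross.

(** * Symmetric differentials *)

Section BinaryForms.
Variable R : realType.
Local Notation C := (Cplx R).
Implicit Types (m : nat) (a b : C) (c : nat -> C) (P Q : C -> C -> C).

Definition form_val m c (x y : C) : C := \sum_(l < m.+1) c l * (x ^+ l * y ^+ (m - l)).

Definition is_form m P := exists c, forall x y, P x y = form_val m c x y.

Lemma is_form_ext m P Q : (forall x y, P x y = Q x y) -> is_form m P -> is_form m Q.
Proof. by move=> PQ [c Pc]; exists c => x y; rewrite -PQ. Qed.

Lemma is_formD m P Q : is_form m P -> is_form m Q -> is_form m (fun x y => P x y + Q x y).
Proof.
move=> [c Pc] [d Qd]; exists (fun l => c l + d l) => x y; rewrite Pc Qd -big_split /=.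
by apply: eq_bigr => l _; rewrite mulrDl.
Qed.

Lemma is_formZ m a P : is_form m P -> is_form m (fun x y => a * P x y).
Proof.
move=> [c Pc]; exists (fun l => a * c l) => x y; rewrite Pc mulr_sumr.
by apply: eq_bigr => l _; rewrite mulrA.
Qed.

Lemma is_form0 m : is_form m (fun _ _ => 0).
Proof. by exists (fun=> 0) => x y; rewrite /form_val big1// => l _; rewrite mul0r. Qed.

Lemma is_form_sum m (I : Type) (r : seq I) (p : pred I) (F : I -> C -> C -> C) :
  (forall i, p i -> is_form m (F i)) ->
  is_form m (fun x y => \sum_(i <- r | p i) F i x y).
Proof.
move=> FF; elim: r => [|i r IH].
  by apply: is_form_ext (is_form0 m) => x y; rewrite big_nil.
have [pi|npi] := boolP (p i); last first.
  by apply: is_form_ext IH => x y; rewrite big_cons (negPf npi).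
by apply: is_form_ext (is_formD (FF _ pi) IH) => x y; rewrite big_cons pi.
Qed.

Lemma is_form1 : is_form 0 (fun _ _ => 1).
Proof. by exists (fun=> 1) => x y; rewrite /form_val big_ord1 !mul1r. Qed.

Lemma is_form_lin m a b P : is_form m P ->
  is_form m.+1 (fun x y => (a * x + b * y) * P x y).
Proof.
move=> [c Pc].
exists (fun l => a * (if l is l'.+1 then c l' else 0) + b * (if (l <= m)%N then c l else 0)) => x y.
rewrite Pc /form_val; under [in RHS]eq_bigr do rewrite mulrDl.
rewrite big_split /= [X in _ = X + _]big_ord_recl [X in _ = _ + X]big_ord_recr /=.
rewrite ltnn !mulr0 !mul0r addr0 add0r mulrDl; congr (_ + _); rewrite mulr_sumr.
  by apply: eq_bigr => l _; rewrite subSS exprS; ring.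
apply: eq_bigr => l _; have lm : (l <= m)%N by rewrite -ltnS.
by rewrite lm subSn// exprS; ring.
Qed.

Lemma is_form_linX m k a b P : is_form m P ->
  is_form (k + m) (fun x y => (a * x + b * y) ^+ k * P x y).
Proof.
move=> Pm; elim: k => [|k IH]; first by apply: is_form_ext Pm => x y; rewrite mul1r.
by apply: is_form_ext (is_form_lin a b IH) => x y; rewrite exprS mulrA.
Qed.

(** The Vandermonde matrix of 0, ..., m is invertible, so the coefficients of a binary form are
    fixed linear combinations of its values at the points (j, 1). Bounds, differentiability and
    equality thus pass from values to coefficients. *)
Lemma form_interpolation m : exists V : nat -> 'I_m.+1 -> C, forall c l, (l <= m)%N ->
  c l = \sum_j V l j * form_val m c j%:R 1.
Proof.
pose a : 'rV[C]_m.+1 := \row_j (j : nat)%:R.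
pose M : 'M[C]_m.+1 := (Vandermonde m.+1 a)^T.
have Mu : M \in unitmx.
  rewrite unitmxE unitfE det_tr det_Vandermonde prodf_seq_neq0; apply/allP => i _ /=.
  rewrite prodf_seq_neq0; apply/allP => j _ /=; apply/implyP => ij.
  by rewrite !mxE subr_eq0 eqr_nat neq_ltn ij orbT.
exists (fun l j => invmx M (inord l) j) => c l lm.
pose cc : 'cV[C]_m.+1 := \col_i c i.
have Mc : M *m cc = \col_j form_val m c (j : nat)%:R 1.
  apply/colP => j; rewrite !mxE; apply: eq_bigr => i _; rewrite !mxE expr1n mulr1.
  by rewrite mulrC.
have /(congr1 (fun N : 'cV[C]_m.+1 => N (inord l) 0)) : cc = invmx M *m (M *m cc).
  by rewrite mulKmx.
rewrite Mc !mxE inordK ?ltnS// => ->.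
by apply: eq_bigr => j _; rewrite mxE.
Qed.

Definition interp m : nat -> 'I_m.+1 -> C := sval (cid (form_interpolation m)).

Lemma interpE m c l : (l <= m)%N ->
  c l = \sum_j interp l j * form_val m c (j : 'I_m.+1)%:R 1.
Proof. by rewrite /interp; case: cid => V /= VP; exact: VP. Qed.

Lemma form_val_inj m c d : (forall x y, form_val m c x y = form_val m d x y) ->
  forall l, (l <= m)%N -> c l = d l.
Proof. by move=> cd l lm; rewrite (interpE c lm) (interpE d lm); apply: eq_bigr => j _; rewrite cd. Qed.

Definition mono_exp m (l : nat) : mexp m 2 :=
  [ffun j : 'I_2 => if j == 0 then inord l else inord (m - l)].

Lemma symform2E m (a : mexp m 2 -> C) (e : 'I_2 -> C) :
  symform a e = form_val m (fun l => a (mono_exp m l)) (e 0) (e 1).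
Proof.
have sumE (k : mexp m 2) : \sum_j (k j : nat) = (k ord0 + k (lift ord0 ord0))%N.
  by rewrite !big_ord_recl big_ord0 addr0.
rewrite /symform (reindex_onto (fun l : 'I_m.+1 => mono_exp m l) (fun k => k ord0)) /=.
  rewrite /form_val; apply: eq_big => [l|l _].
    have lm : (l <= m)%N by rewrite -ltnS.
    by rewrite sumE !ffunE /= !inordK ?ltnS ?leq_subr// subnKC// !eqxx inord_val eqxx.
  have lm : (l <= m)%N by rewrite -ltnS.
  rewrite !big_ord_recl big_ord0 !ffunE /= !inordK ?ltnS ?leq_subr// mulr1.
  by congr (_ * (_ * e _ ^+ _)); apply/val_inj.
move=> k; rewrite sumE => /eqP km.
have k1 : k (lift ord0 ord0) = (m - k ord0)%N :> nat by apply/eqP; rewrite -(eqn_add2l (k ord0)) subnKC ?km// -ltnS.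
apply/ffunP => j; rewrite ffunE; apply/val_inj.
case: j => [[|[|//]]] lt_j /=; rewrite inordK ?ltnS ?leq_subr//.
- by congr (nat_of_ord (k _)); apply/val_inj.
- by rewrite -ltnS.
- by rewrite -k1; congr (nat_of_ord (k _)); apply/val_inj.
Qed.

Definition is_symdiff_form m (w : 'rV[C]_2 -> C) :=
  is_form m (fun x y => w (row2 x y)).

(* Unlike the definition, the right-hand side is a local condition.            *)
Lemma holo_symdiffP m (A : set 'rV[C]_2) (w : symdiff R 1) : open A ->
  holo_symdiff m A w <-> (forall p, A p -> is_symdiff_form m (w p)) /\
    (forall p xi, A p -> differentiable (w^~ xi) p).
Proof.
move=> oA; split=> [[f fh wf]|[wform wd]].
  split=> [p Ap|p xi Ap].
    by exists (fun l => f (mono_exp m l) p) => x y; rewrite wf// symform2E row20 row21.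
  have : differentiable (fun q => form_val m (fun l => f (mono_exp m l) q) (xi 0 0) (xi 0 1)) p.
    by apply: dfun_sum => l _; apply: dfunM; [exact: fh|exact: dfun_cst].
  apply: near_eq_differentiable; near=> q; rewrite wf ?symform2E//.
  by near: q; exact: open_nbhs_nbhs.
exists (fun (k : mexp m 2) p => \sum_j interp (k ord0) j * w p (row2 (j : 'I_m.+1)%:R 1)).
  move=> k p Ap; apply: dfun_sum => j _; apply: dfunM; [exact: dfun_cst|exact: wd].
move=> p xi Ap; have [c wc] := wform _ Ap.
rewrite symform2E {1}(row2E xi) wc; apply: eq_bigr => l _; congr (_ * _).
have lm : (l <= m)%N by rewrite -ltnS.
rewrite (interpE c lm) ffunE /= inordK//; apply: eq_bigr => j _.
by congr (_ * _); rewrite -wc.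
Unshelve. all: by end_near. Qed.

End BinaryForms.

(** * Toric charts *)

Section MonomialMaps.
Variable R : realType.
Local Notation C := (Cplx R).
Implicit Types (f g : 'rV[C]_2 -> C) (p q xi : 'rV[C]_2) (a b : int).

Definition has_diff f p (L : 'rV[C]_2 -> C) :=
  differentiable f p /\ forall xi, 'd f p xi = L xi.

Lemma has_diff_ext f g p L M : (forall q, f q = g q) -> (forall xi, L xi = M xi) ->
  has_diff f p L -> has_diff g p M.
Proof.
move=> fg LM; have -> : f = g by apply/funext.
by have -> : L = M by apply/funext.
Qed.

Lemma has_diff_coord p j : has_diff (fun q => q 0 j) p (fun xi => xi 0 j).
Proof.
split=> [|xi]; first exact: differentiable_coord.
have := @diff_coord C 2 'rV[C]_2 id p xi j (@ex_diff _ _ _ _ _ _ id (is_diff_id p)).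
by rewrite (@diff_val _ _ _ _ _ _ id (is_diff_id p)) => <-.
Qed.

Lemma has_diff_cst p (c : C) : has_diff (fun=> c) p (fun=> 0).
Proof.
split=> [|xi]; first exact: dfun_cst.
exact: (congr1 (fun h => h xi) (@diff_cst C 'rV[C]_2 C c p)).
Qed.

Lemma has_diffM f g p L M : has_diff f p L -> has_diff g p M ->
  has_diff (fun q => f q * g q) p (fun xi => f p * M xi + g p * L xi).
Proof.
move=> [df fL] [dg gM]; split=> [|xi]; first exact: dfunM.
by rewrite -fL -gM; exact: (congr1 (fun h => h xi) (@diffM _ _ f g p df dg)).
Qed.

Lemma has_diffV f p L : f p != 0 -> has_diff f p L ->
  has_diff (fun q => (f q)^-1) p (fun xi => - (f p) ^- 2 * L xi).
Proof.
move=> fp0 [df fL]; split=> [|xi]; first exact: dfunV.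
by rewrite -fL; exact: (congr1 (fun h => h xi) (@diffV _ _ f p df fp0)).
Qed.

Lemma has_diffX f p L k : has_diff f p L ->
  has_diff (fun q => f q ^+ k) p (fun xi => k%:R * f p ^+ k.-1 * L xi).
Proof.
move=> fL; elim: k => [|k IH].
  apply: has_diff_ext (has_diff_cst p 1) => [q|xi]; first by rewrite expr0.
  by rewrite !mul0r.
apply: has_diff_ext (has_diffM fL IH) => [q|xi]; first by rewrite exprS.
case: k {IH} => [|k] /=; first by rewrite expr0; ring.
by rewrite !exprS [in RHS]mulrS; ring.
Qed.

Lemma has_diffXz f p L a : (f p != 0 \/ 0 <= a) -> has_diff f p L ->
  has_diff (fun q => f q ^ a) p (fun xi => a%:~R * f p ^ (a - 1) * L xi).
Proof.
case: a => k fp0 fL.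
  apply: has_diff_ext (has_diffX k fL) => [//|xi].
  case: k {fp0} => [|k]; first by rewrite !mul0r.
  by rewrite (_ : k.+1%:Z - 1 = k); last by rewrite intS addrAC subrr add0r.
have {}fp0 : f p != 0 by case: fp0.
apply: has_diff_ext (has_diffV (expf_neq0 k.+1 fp0) (has_diffX k.+1 fL)) => [//|xi].
rewrite (_ : Negz k - 1 = Negz k.+1); last by rewrite !NegzE; lia.
rewrite -[(Negz k)%:~R]/(- k.+1%:R) -[f p ^ Negz k.+1]/((f p ^+ k.+2)^-1) /= !exprS.
by field; rewrite ?fp0 ?expf_neq0.
Qed.

Definition monomial a b p : C := p 0 0 ^ a * p 0 1 ^ b.

Definition dmonomial a b p xi : C :=
  a%:~R * (p 0 0 ^ (a - 1) * p 0 1 ^ b) * xi 0 0 +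
  b%:~R * (p 0 0 ^ a * p 0 1 ^ (b - 1)) * xi 0 1.

(** The points at which the Laurent monomial is regular. *)
Definition monomial_dom a b p :=
  (p 0 0 != 0 \/ 0 <= a) /\ (p 0 1 != 0 \/ 0 <= b).

Lemma has_diff_monomial a b p : monomial_dom a b p ->
  has_diff (monomial a b) p (dmonomial a b p).
Proof.
move=> [pa pb].
apply: has_diff_ext (has_diffM (has_diffXz pa (has_diff_coord p 0)) (has_diffXz pb (has_diff_coord p 1))) => [//|xi].
by rewrite /dmonomial; ring.
Qed.

Lemma dmonomial_log a b p (A B : C) : p 0 0 != 0 -> p 0 1 != 0 ->
  dmonomial a b p (row2 (p 0 0 * A) (p 0 1 * B)) =
  monomial a b p * (a%:~R * A + b%:~R * B).
Proof.
move=> p0 p1; rewrite /dmonomial /monomial !row20 row21.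
rewrite !expfzDr// !exprN1.
by field; rewrite p0 p1.
Qed.

Lemma dmonomial_differentiable a b p xi : monomial_dom a b p ->
  differentiable (fun q => dmonomial a b q xi) p.
Proof.
move=> [pa pb].
have aux (j : 'I_2) (c : int) : (p 0 j != 0 \/ 0 <= c) ->
    differentiable (fun q => c%:~R * q 0 j ^ (c - 1)) p /\ differentiable (fun q => q 0 j ^ c) p.
  move=> pc; split; last by have [] := has_diffXz pc (has_diff_coord p j).
  have [->|c0] := eqVneq c 0.
    by rewrite (_ : (fun _ => _) = fun=> 0); [exact: dfun_cst|apply/funext => q; rewrite mul0r].
  apply: dfunM; first exact: dfun_cst.
  have pc1 : p 0 j != 0 \/ 0 <= c - 1 by case: pc => [->|?]; [left|right; lia].
  by have [] := has_diffXz pc1 (has_diff_coord p j).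
have [a1 a2] := aux 0 a pa; have [b1 b2] := aux 1 b pb.
rewrite (_ : (fun _ => _) = fun q => (a%:~R * q 0 0 ^ (a - 1)) * q 0 1 ^ b * xi 0 0 +
  (b%:~R * q 0 1 ^ (b - 1)) * q 0 0 ^ a * xi 0 1); last first.
  by apply/funext => q; rewrite /dmonomial; ring.
by apply: dfunD; apply: dfunM; [exact: dfunM|exact: dfun_cst|exact: dfunM|exact: dfun_cst].
Qed.

Lemma diff_monomial_map d (phi : 'rV[C]_2 -> 'rV[C]_d) (e : 'I_d -> int * int) p :
  (forall q j, phi q 0 j = monomial (e j).1 (e j).2 q) ->
  (forall j, monomial_dom (e j).1 (e j).2 p) ->
  differentiable phi p /\
  forall xi j, ('d phi p xi) 0 j = dmonomial (e j).1 (e j).2 p xi.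
Proof.
move=> phiE ok; have E j : (fun q => phi q 0 j) = monomial (e j).1 (e j).2 by apply/funext => q.
have dphi : differentiable phi p.
  by apply: differentiable_row => j; rewrite E; case: (has_diff_monomial (ok j)).
split=> // xi j; rewrite diff_coord// E.
by case: (has_diff_monomial (ok j)).
Qed.

End MonomialMaps.

Section ChartMaps.
Variables (R : realType) (n : nat).
Local Notation C := (Cplx R).
Implicit Types (p xi : 'rV[C]_2) (i j : 'I_n.+1).

Lemma le_chart i : (i <= n)%N. Proof. by rewrite -ltnS. Qed.

Lemma diff_transition i j p : overlap i j p ->
  differentiable (transition i j) p /\
  forall xi, 'd (transition i j) p xi =
    row2 (dmonomial (i.+1%:Z - j%:Z) (i%:Z - j%:Z) p xi)
         (dmonomial (j%:Z - i%:Z) (j.+1%:Z - i%:Z) p xi).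
Proof.
move=> /overlapP[hu hv].
pose e (k : 'I_2) : int * int := if k == 0 then (i.+1%:Z - j%:Z, i%:Z - j%:Z) else (j%:Z - i%:Z, j.+1%:Z - i%:Z).
have [|k|dt dE] := @diff_monomial_map R 2 (transition i j) e p.
- by move=> q k; rewrite mxE /e; case: k => [[|[|//]]].
- case: k => [[|[|//]]] lt_k; rewrite /e /monomial_dom /=; split;
    [case: hu|case: hv|case: hu|case: hv] => H; by [left|right; lia].
split=> // xi; apply/rowP => k; rewrite dE mxE /e.
by case: k => [[|[|//]]].
Qed.

Lemma diff_sigma i p : differentiable (@sigma R n i) p /\
  forall xi, 'd (@sigma R n i) p xi =
    row3 (dmonomial i.+1 i p xi) (dmonomial 1 1 p xi)
         (dmonomial (n - i)%N (n.+1 - i)%N p xi).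
Proof.
pose e (k : 'I_3) : int * int := if k == 0 then (i.+1%:Z, i%:Z) else
  if k == 1 then (1, 1) else ((n - i)%:Z, (n.+1 - i)%:Z).
have [|k|dt dE] := @diff_monomial_map R 3 (@sigma R n i) e p.
- by move=> q k; rewrite mxE /e; case: k => [[|[|[|//]]]].
- by case: k => [[|[|[|//]]]] lt_k; rewrite /e /monomial_dom /=; split; right.
split=> // xi; apply/rowP => k; rewrite dE mxE /e.
by case: k => [[|[|[|//]]]].
Qed.

Lemma diff_smoothing p : differentiable (@An_smoothing R n) p /\
  forall xi, 'd (@An_smoothing R n) p xi =
    row3 (dmonomial n.+1 0 p xi) (dmonomial 1 1 p xi) (dmonomial 0 n.+1 p xi).
Proof.
pose e (k : 'I_3) : int * int := if k == 0 then (n.+1%:Z, 0) else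
  if k == 1 then (1, 1) else (0, n.+1%:Z).
have [|k|dt dE] := @diff_monomial_map R 3 (@An_smoothing R n) e p.
- move=> q k; rewrite mxE /e /monomial; case: k => [[|[|[|//]]]] lt_k //=.
    by rewrite expr0z mulr1.
  by rewrite expr0z mul1r.
- by case: k => [[|[|[|//]]]] lt_k; rewrite /e /monomial_dom /=; split; right.
split=> // xi; apply/rowP => k; rewrite dE mxE /e.
by case: k => [[|[|[|//]]]].
Qed.

End ChartMaps.

(** * Pullback of symmetric differentials *)

Section Pullbacks.
Variable R : realType.
Local Notation C := (Cplx R).

Lemma is_form_prod (I : Type) (r : seq I) (k : I -> nat) (a b : I -> C) :
  is_form (\sum_(i <- r) k i)%N
    (fun x y => \prod_(i <- r) (a i * x + b i * y) ^+ k i : C).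
Proof.
elim: r => [|i r IH].
  by rewrite big_nil; apply: is_form_ext (@is_form1 R) => x y; rewrite big_nil.
rewrite big_cons; apply: is_form_ext (is_form_linX (k i) (a i) (b i) IH) => x y.
by rewrite big_cons.
Qed.

Lemma pullback_form m d (phi : 'rV[C]_2 -> 'rV[C]_d.+1) (A : set 'rV[C]_d.+1)
    (w : symdiff R d) p :
  holo_symdiff m A w -> A (phi p) -> is_symdiff_form m (pullback phi w p).
Proof.
move=> [f _ wf] Ap; rewrite /is_symdiff_form /pullback.
pose a j := ('d phi p (row2 1 0)) 0 j; pose b j := ('d phi p (row2 0 1)) 0 j.
have dE x y j : ('d phi p (row2 x y)) 0 j = a j * x + b j * y.
  have -> : row2 x y = x *: row2 1 0 + y *: row2 0 1 :> 'rV[C]_2.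
    by rewrite !row2Z row2D !mulr1 !mulr0 addr0 add0r.
  by rewrite linearD !linearZ !mxE mulrC [y * _]mulrC.
apply: (@is_form_ext _ _ (fun x y => symform (f^~ (phi p)) ('d phi p (row2 x y) 0))).
  by move=> x y; rewrite wf.
apply: is_form_sum => k /eqP km; apply: is_formZ.
have := is_form_prod (index_enum 'I_d.+1) (fun j => k j : nat) a b.
rewrite (_ : (\sum_(j <- _) (k j : nat))%N = m); last by rewrite -[RHS]km.
by apply: is_form_ext => x y; apply: eq_bigr => j _; rewrite dE.
Qed.

Lemma pullback_differentiable m d (phi : 'rV[C]_2 -> 'rV[C]_d.+1)
    (A : set 'rV[C]_d.+1) (w : symdiff R d) p xi :
  open A -> holo_symdiff m A w -> A (phi p) -> differentiable phi p ->
  (forall j, differentiable (fun q => ('d phi q xi) 0 j) p) ->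
  differentiable (fun q => pullback phi w q xi) p.
Proof.
move=> oA [f fh wf] Ap dphi ddphi.
have : differentiable (fun q => symform (f^~ (phi q)) ('d phi q xi 0)) p.
  apply: dfun_sum => k _; apply: dfunM.
    by apply: (@differentiable_comp _ _ _ _ phi (f k) _ dphi); exact: fh.
  by apply: dfun_prod => j _; apply: dfunX; exact: ddphi.
apply: near_eq_differentiable.
have H : \forall q \near p, A (phi q).
  exact: differentiable_continuous dphi _ (open_nbhs_nbhs (conj oA Ap)).
near=> q; have Aq : A (phi q) by near: q; exact: H.
exact: (esym (wf _ _ Aq)).
Unshelve. all: by end_near. Qed.

End Pullbacks.

(** * The dense torus of each chart and the lift of the smoothing *)

Section Torus.
Variables (R : realType) (n : nat).
Local Notation C := (Cplx R).
Implicit Types (p z xi : 'rV[C]_2) (i j : 'I_n.+1) (U : set 'rV[C]_3).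

Definition torus : set 'rV[C]_2 := [set p | p 0 0 != 0 /\ p 0 1 != 0].

(* The tangent vector at p on which d log u = A and d log v = B. *)
Definition logvec p (A B : C) : 'rV[C]_2 := row2 (p 0 0 * A) (p 0 1 * B).

Lemma torus_vec p xi : torus p -> xi = logvec p (xi 0 0 / p 0 0) (xi 0 1 / p 0 1).
Proof. by move=> [p0 p1]; rewrite {1}(row2E xi) /logvec !mulrA ![_ * xi 0 _]mulrC !mulfK. Qed.

Lemma torus_overlap i j p : torus p -> overlap i j p.
Proof. by move=> [p0 p1]; split. Qed.

(* The rational lift of the smoothing to the i-th chart, obtained from         *)
(* u = x / y^i and v = y^(i+1) / x for x = z1^(n+1), y = z1 z2.                *)
Definition tau i z : 'rV[C]_2 :=
  row2 (monomial (n.+1%:Z - i%:Z) (- i%:Z) z) (monomial (i%:Z - n%:Z) i.+1 z).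

Lemma monomial_neq0 (a b : int) p : torus p -> monomial a b p != 0.
Proof. by move=> [p0 p1]; rewrite mulf_neq0 ?expfz_neq0. Qed.

Lemma tau_torus i z : torus z -> torus (tau i z).
Proof. by move=> tz; rewrite /torus /= row20 row21; split; exact: monomial_neq0. Qed.

Lemma monomial_row2 (a b c d e f : int) z : torus z ->
  monomial a b (row2 (monomial c d z) (monomial e f z)) =
  monomial (a * c + b * e) (a * d + b * f) z.
Proof.
move=> [z0 z1]; rewrite /monomial row20 row21 !monomialX.
by apply: monomialM; [left|left|lia|lia].
Qed.

Lemma sigmaE i p : sigma i p = row3 (monomial i.+1 i p) (monomial 1 1 p)
  (monomial (n - i)%N (n.+1 - i)%N p) :> 'rV[C]_3.
Proof. by []. Qed.

Lemma smoothingE z : An_smoothing n z =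
  row3 (monomial n.+1 0 z) (monomial 1 1 z) (monomial 0 n.+1 z).
Proof. by rewrite /monomial !expr0z mulr1 mul1r. Qed.

Lemma sigma_tau i z : torus z -> sigma i (tau i z) = An_smoothing n z.
Proof.
move=> tz; have le_i := le_chart i; rewrite sigmaE smoothingE /tau !monomial_row2//.
by congr row3; congr monomial; nia.
Qed.

Lemma transition_tau i j z : torus z -> transition i j (tau i z) = tau j z.
Proof.
move=> tz; rewrite /transition -/(monomial _ _ _) -/(monomial _ _ _) /tau.
by rewrite !monomial_row2//; congr row2; congr monomial; nia.
Qed.

Lemma diff_transition_log i j p A B : torus p ->
  'd (transition i j) p (logvec p A B) = logvec (transition i j p)
    ((i.+1%:Z - j%:Z)%:~R * A + (i%:Z - j%:Z)%:~R * B)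
    ((j%:Z - i%:Z)%:~R * A + (j.+1%:Z - i%:Z)%:~R * B).
Proof.
move=> tp; have [_ ->] := diff_transition (torus_overlap i j tp).
by case: tp => p0 p1; rewrite /logvec !dmonomial_log// !row20 !row21.
Qed.

Lemma diff_sigma_log i p A B : torus p ->
  'd (sigma i) p (logvec p A B) = row3
    (monomial i.+1 i p * (i.+1%:R * A + i%:R * B)) (monomial 1 1 p * (A + B))
    (monomial (n - i)%N (n.+1 - i)%N p * ((n - i)%:R * A + (n.+1 - i)%:R * B)).
Proof.
move=> [p0 p1]; have [_ ->] := @diff_sigma R n i p.
by rewrite /logvec !dmonomial_log// !mul1r.
Qed.

Lemma diff_smoothing_log z a b : torus z ->
  'd (An_smoothing n) z (logvec z a b) = row3
    (monomial n.+1 0 z * (n.+1%:R * a)) (monomial 1 1 z * (a + b))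
    (monomial 0 n.+1 z * (n.+1%:R * b)).
Proof.
move=> [p0 p1]; have [_ ->] := @diff_smoothing R n z.
by rewrite /logvec !dmonomial_log// !mul1r !mul0r addr0 add0r.
Qed.

(** The logarithmic differential of [tau i]: the exponent matrix of the map, taking the values of (d
    log z1, d log z2) to those of (d log u, d log v). *)
Definition tau_log i (a b : C) : C * C :=
  ((n.+1%:R - i%:R) * a - i%:R * b, (i%:R - n%:R) * a + i.+1%:R * b).

Definition tau_vec i z a b : 'rV[C]_2 :=
  logvec (tau i z) (tau_log i a b).1 (tau_log i a b).2.

Lemma diff_sigma_tau i z a b : torus z ->
  'd (sigma i) (tau i z) (tau_vec i z a b) = 'd (An_smoothing n) z (logvec z a b).
Proof.
move=> tz; apply: etrans (diff_sigma_log i _ _ (tau_torus i tz)) _.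
apply: etrans _ (esym (diff_smoothing_log a b tz)).
have le_i := le_chart i.
have := sigma_tau i tz; rewrite sigmaE smoothingE => E.
have := congr1 (fun q : 'rV[C]_3 => q 0 0) E.
have := congr1 (fun q : 'rV[C]_3 => q 0 1) E.
have := congr1 (fun q : 'rV[C]_3 => q 0 2%:R) E.
rewrite !mxE /= => -> -> ->; congr row3; congr (_ * _); rewrite /tau_log /=.
- by rewrite -!natr1; ring.
- by rewrite -!natr1; ring.
- by rewrite !natrB ?leqW// -!natr1; ring.
Qed.

Lemma diff_transition_tau i j z a b : torus z ->
  'd (transition i j) (tau i z) (tau_vec i z a b) = tau_vec j z a b.
Proof.
move=> tz; apply: etrans (diff_transition_log i j _ _ (tau_torus i tz)) _.
rewrite transition_tau//; congr logvec; rewrite /tau_log /= !rmorphB /=;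
by rewrite -!pmulrn -!natr1; ring.
Qed.

(** Any (n+1)-th root of x serves as z1, and then z2 = y / z1. *)
Lemma tau_surj i p : torus p -> exists2 z, torus z & tau i z = p.
Proof.
move=> [p0 p1]; pose x := monomial i.+1 i p.
have x0 : x != 0 by apply: monomial_neq0.
pose z0 : C := n.+1.-root x.
have z0x : z0 ^+ n.+1 = x by rewrite rootCK.
have z0_neq0 : z0 != 0 by apply: contra_neq x0 => z00; rewrite -z0x z00 expr0n.
have y0 : p 0 0 * p 0 1 != 0 by rewrite mulf_neq0.
exists (row2 z0 (p 0 0 * p 0 1 / z0)).
  by split; rewrite ?row20 ?row21 ?mulf_neq0 ?invr_neq0.
have le_i := le_chart i.
have E1 (a b : int) : monomial a b (row2 z0 (p 0 0 * p 0 1 / z0)) =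
    z0 ^ (a - b) * (p 0 0 ^ b * p 0 1 ^ b).
  rewrite /monomial row20 row21 (expfzMl (_ * _)) (expfzMl (p 0 0)) exprz_inv (expfzDr _ _ z0_neq0).
  exact: etrans (mulrA _ _ _) (mulrAC _ _ _).
have z0X (a : int) : z0 ^ (a * n.+1%:Z) = p 0 0 ^ (i.+1%:Z * a) * p 0 1 ^ (i%:Z * a).
  rewrite [a * _]mulrC -(exprz_exp z0) (_ : z0 ^ n.+1%:Z = x); last exact: z0x.
  by rewrite /x /monomial monomialX.
rewrite /tau !E1 [RHS]row2E.
rewrite (_ : n.+1%:Z - i%:Z - - i%:Z = 1 * n.+1%:Z); last by lia.
rewrite (_ : i%:Z - n%:Z - i.+1%:Z = (-1) * n.+1%:Z); last by lia.
rewrite !z0X; congr row2.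
  rewrite -[RHS](_ : p 0 0 ^ 1 * p 0 1 ^ 0 = _); last by rewrite expr0z mulr1.
  by apply: monomialM; [left|left|lia|lia].
rewrite -[RHS](_ : p 0 0 ^ 0 * p 0 1 ^ 1 = _); last by rewrite expr0z mul1r.
by apply: monomialM; [left|left|lia|lia].
Qed.

Lemma near_coord_neq0 (k : 'I_2) z : z 0 k != 0 -> nbhs z (fun q : 'rV[C]_2 => q 0 k != 0).
Proof.
move=> zk; have dk : differentiable (fun q : 'rV[C]_2 => q 0 k : C) z by exact: differentiable_coord.
have /cvgrPdist_lt/(_ `|z 0 k|) := differentiable_continuous dk.
rewrite normr_gt0 => /(_ zk) H.
have {}H : nbhs z (fun q : 'rV[C]_2 => `|z 0 k - q 0 k| < `|z 0 k|) := H.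
by apply: filterS H => q H; apply/eqP => q0; move: H; rewrite q0 subr0 ltxx.
Qed.

Lemma torus_off_exc U i p : (0 < n)%N -> torus p -> U (sigma i p) ->
  resolution_off_exc n U i p.
Proof.
move=> n0 [p0 p1] Up; split=> //; rewrite exc_locusE// => /= s0.
have /eqP := congr1 (fun q : 'rV[C]_3 => q 0 1) s0.
by rewrite !mxE /= mulf_eq0 (negPf p0) (negPf p1).
Qed.

Lemma continuous_sigma i : continuous (@sigma R n i).
Proof. by move=> p; apply: differentiable_continuous; case: (@diff_sigma R n i p). Qed.

Lemma open_resolution_over U i : open U -> open (resolution_over n U i).
Proof. by move=> oU; apply: open_comp => // p _; exact: continuous_sigma. Qed.

Lemma open_resolution_off_exc U i : (0 < n)%N -> open U -> open (resolution_off_exc n U i).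
Proof.
move=> n0 oU; rewrite /resolution_off_exc exc_locusE//.
have -> : resolution_over n U i `\` sigma i @^-1` [set 0] = resolution_over n (U `&` ~` [set 0]) i by [].
apply: open_resolution_over; apply: openI => //; apply: closed_openC.
exact: accessible_closed_set1 (hausdorff_accessible (@norm_hausdorff _ _)) _.
Qed.

End Torus.

(** * Extension across the exceptional locus *)

Section Density.
Variable R : realType.
Local Notation C := (Cplx R).

Lemma exists_near_avoiding (u a b : C) (d : R) : 0 < d ->
  exists v : C, [/\ cabs (v - u) < d, v != a & v != b].
Proof.
move=> d0; pose t (k : nat) : C := u + (d / k.+2%:R)%:C%C.
have tu k : cabs (t k - u) < d.
  rewrite /t addrC addKr cabs_real gtr0_norm ?divr_gt0// ltr_pdivrMr//.
  by rewrite ltr_pMr// ltr1n.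
have tinj k l : k != l -> t k != t l.
  apply: contra_neq => /addrI /complexI /(mulfI (lt0r_neq0 d0)) /invr_inj /eqP.
  by rewrite eqr_nat => /eqP [].
have [t0a|t0a] := eqVneq (t 0%N) a; have [t0b|t0b] := eqVneq (t 0%N) b.
- by exists (t 1%N); split; rewrite // -?t0a -?t0b tinj.
- have [t1b|t1b] := eqVneq (t 1%N) b; last by exists (t 1%N); rewrite -t0a tinj.
  by exists (t 2%N); rewrite -t0a -t1b !tinj.
- have [t1a|t1a] := eqVneq (t 1%N) a; last by exists (t 1%N); rewrite -t0b tinj.
  by exists (t 2%N); rewrite -t0b -t1a !tinj.
- by exists (t 0%N).
Qed.

(** Two excluded values per coordinate make it possible to compare extensions built around two
    different centres, each known only off the coordinate lines through its own centre. *)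
Lemma eq_of_dense (f g : 'rV[C]_2 -> C) (p : 'rV[C]_2) (a b c d : C) :
  {for p, continuous f} -> {for p, continuous g} ->
  nbhs p (fun q : 'rV[C]_2 => q 0 0 != a -> q 0 0 != b -> q 0 1 != c -> q 0 1 != d -> f q = g q) ->
  f p = g p.
Proof.
move=> fc gc fg; apply/eqP; rewrite -subr_eq0 -cabs_eq0 eq_le cabs_ge0 andbT.
apply/ler_addgt0Pl => e e0; rewrite addr0.
have e2 : 0 < (e / 2)%:C%C :> C by rewrite ltcR divr_gt0.
have [r r0 rP] := (nbhs_row2P p _).1
  (filterI (filterI fg ((cvgrPdist_le _ _).1 fc _ e2)) ((cvgrPdist_le _ _).1 gc _ e2)).
have [u [ur ua ub]] := exists_near_avoiding (p 0 0) a b r0.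
have [v [vr vc vd]] := exists_near_avoiding (p 0 1) c d r0.
have [[]] := rP _ _ ur vr; rewrite row20 row21 => /(_ ua ub vc vd) E.
rewrite -!cabs_leE => H1 H2.
have -> : f p - g p = (f p - f (row2 u v)) - (g p - g (row2 u v)) by rewrite E; ring.
by rewrite (le_trans (cabsD _ _))// cabsN; lra.
Qed.

End Density.

(** * Riemann's extension theorem in a logarithmic coframe *)

Section LogExtension.
Variables (R : realType) (n m : nat).
Local Notation C := (Cplx R).
Implicit Types (p q xi : 'rV[C]_2) (i : 'I_n.+1) (U : set 'rV[C]_3).

Lemma exc_locusP i p : exc_locus i p <->
  ((i < n)%N /\ p 0 0 = 0) \/ ((0 < i)%N /\ p 0 1 = 0).
Proof.
split=> [[r _]|[[lt_in p0]|[i0 p1]]].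
- rewrite /exc_curve /= /exc_eq; have lt_rn := ltn_ord r.
  case: eqP => [ir p0|_]; first by left; rewrite ir.
  case: eqP => [ir p1|_ /eqP]; first by right; rewrite ir.
  by rewrite oner_eq0.
- by exists (Ordinal lt_in) => //; rewrite /exc_curve /= /exc_eq eqxx.
- have lt_in : (i.-1 < n)%N by rewrite prednK// -ltnS.
  exists (Ordinal lt_in) => //; rewrite /exc_curve /= /exc_eq /=.
  by rewrite prednK// eqxx; case: eqP => // /eqP; lia.
Qed.

Lemma off_excP U i p : resolution_off_exc n U i p <->
  [/\ U (sigma i p), (i < n)%N -> p 0 0 != 0 & (0 < i)%N -> p 0 1 != 0].
Proof.
split=> [[Up /exc_locusP nE]|[Up p0 p1]].
  split=> // H; apply/eqP => p0; apply: nE; [left|right]; by split.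
split=> // /exc_locusP[[H E]|[H E]]; [move: (p0 H)|move: (p1 H)]; by rewrite E eqxx.
Qed.

Lemma form_val_scale k (c : nat -> C) (a b x y : C) :
  form_val k c (a * x) (b * y) = form_val k (fun l => c l * (a ^+ l * b ^+ (k - l))) x y.
Proof. by apply: eq_bigr => l _; rewrite !exprMn; ring. Qed.

Lemma form_valZ k (c : nat -> C) (a x y : C) :
  a * form_val k c x y = form_val k (fun l => a * c l) x y.
Proof. by rewrite /form_val mulr_sumr; apply: eq_bigr => l _; rewrite mulrA. Qed.

(** Evaluation on [logvec] with constant A, B measures the coefficients of [w] in the coframe du/u,
    dv/v; they are required to be O(|u|^d |v|^d') near [p0]. *)
Definition log_growth i (d d' : nat) (w : symdiff R 1) p0 :=
  exists2 r : R, 0 < r & forall A B : C, exists M, forall u v,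
    cabs (u - p0 0 0) < r -> cabs (v - p0 0 1) < r -> u != 0 -> v != 0 ->
    cabs (w (row2 u v) (logvec (row2 u v) A B)) <= M * (cabs u ^+ d * cabs v ^+ d').

(** Once divided by u^d v^d', the logarithmic coefficients are bounded on the slices that cross E,
    so they extend locally by [removable_cross]; density of the torus glues the local extensions. *)
Lemma log_extension U i (w : symdiff R 1) (d d' : nat) : (0 < n)%N -> open U -> U 0 ->
  (i = n :> nat -> d = 0%N) -> (i = 0%N :> nat -> d' = 0%N) ->
  holo_symdiff m (resolution_off_exc n U i) w ->
  (forall p0, exc_locus i p0 -> log_growth i d d' w p0) ->
  exists2 f : mexp m 2 -> 'rV[C]_2 -> C,
    forall k, holomorphic_on (resolution_over n U i) (f k) &
    forall p xi, resolution_off_exc n U i p ->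
      w p xi = p 0 0 ^+ d * p 0 1 ^+ d' * symform (f^~ p) (log_coframe i p xi).
Proof.
move=> n0 oU U0 d_0 d'_0 [h hh hw] growth.
have offE p := off_excP U i p.
have i_n : ~~ (i < n)%N -> i = n :> nat by rewrite -leqNgt => H; apply/eqP; rewrite eqn_leq le_chart.
have i_0 : ~~ (0 < i)%N -> i = 0%N :> nat by rewrite -leqNgt leqn0 => /eqP.
pose cu (p : 'rV[C]_2) l := if (i < n)%N then p 0 0 ^+ l else 1.
pose cv (p : 'rV[C]_2) l := if (0 < i)%N then p 0 1 ^+ l else 1.
(* The l-th coefficient of [w] in the logarithmic coframe of the chart, divided by u^d v^d'; [cu]
   and [cv] change from du, dv to that coframe. *)
pose F l p := h (mono_exp m l) p * (cu p l * cv p (m - l)%N) * (p 0 0 ^+ d * p 0 1 ^+ d')^-1.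
have div0 p : resolution_off_exc n U i p -> p 0 0 ^+ d * p 0 1 ^+ d' != 0.
  move=> /offE[_ H0 H1]; rewrite mulf_neq0// expf_eq0 negb_and.
    by have [/H0 ->|/i_n/d_0 ->] := boolP (i < n)%N; rewrite ?orbT.
  by have [/H1 ->|/i_0/d'_0 ->] := boolP (0 < i)%N; rewrite ?orbT.
have wF p xi : resolution_off_exc n U i p -> w p xi = p 0 0 ^+ d * p 0 1 ^+ d' *
    form_val m (fun l => F l p) (log_coframe i p xi 0) (log_coframe i p xi 1).
  move=> offp; rewrite hw// symform2E form_valZ; have [_ H0 H1] := (offE p).1 offp.
  have E0 : xi 0 0 = cu p 1%N * log_coframe i p xi 0.
    rewrite /cu /log_coframe /=; case: ifP => lt_in; last by rewrite mul1r.
    by rewrite expr1 mulrC mulfVK// H0.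
  have E1 : xi 0 1 = cv p 1%N * log_coframe i p xi 1.
    rewrite /cv /log_coframe /=; case: ifP => lt_in; last by rewrite mul1r.
    by rewrite expr1 mulrC mulfVK// H1.
  rewrite E0 E1 form_val_scale; apply: eq_bigr => l _; congr (_ * _).
  rewrite /F [RHS]mulrC (divfK (div0 _ offp)); congr (_ * (_ * _)).
    by rewrite /cu; case: ifP => _; rewrite ?expr1n ?expr1.
  by rewrite /cv; case: ifP => _; rewrite ?expr1n ?expr1.
have dcoord j p : differentiable (fun q => q 0 j : C) p by exact: differentiable_coord.
have Fd l p : resolution_off_exc n U i p -> differentiable (F l) p.
  move=> offp; apply: dfunM.
    apply: dfunM; first exact: hh.
    apply: dfunM; [rewrite /cu; case: (i < n)%N => /=|rewrite /cv; case: (0 < i)%N => /=].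
    - exact: dfunX.
    - exact: dfun_cst.
    - exact: dfunX.
    - exact: dfun_cst.
  by apply: dfunV; [exact: div0|apply: dfunM; exact: dfunX].
have toff p : torus p -> U (sigma i p) -> resolution_off_exc n U i p by exact: torus_off_exc.
have overE p0 : exc_locus i p0 -> U (sigma i p0) by rewrite exc_locusE// => /= ->.
(* A neighbourhood of a point of E on which E is contained in the coordinate   *)
(* lines through the point.                                                    *)
have box p0 : exc_locus i p0 -> exists2 r : R, 0 < r &
    [/\ forall u v, cabs (u - p0 0 0) < r -> cabs (v - p0 0 1) < r -> U (sigma i (row2 u v)),
        forall u, cabs (u - p0 0 0) < r -> u != p0 0 0 -> u != 0 &
        forall v, cabs (v - p0 0 1) < r -> v != p0 0 1 -> v != 0].
  move=> Ep0; have := open_nbhs_nbhs (conj (@open_resolution_over R n U i oU) (overE _ Ep0)).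
  move=> /nbhs_row2P[r r0 rP].
  pose g (a : C) : R := if a == 0 then 1 else cabs a.
  have g0 a : 0 < g a by rewrite /g; case: eqVneq => // ?; rewrite cabs_gt0.
  have gP a u : cabs (u - a) < g a -> u != a -> u != 0.
    rewrite /g; case: eqVneq => [-> //|a0 H _]; apply/eqP => u0.
    by move: H; rewrite u0 sub0r cabsN ltxx.
  exists (Num.min r (Num.min (g (p0 0 0)) (g (p0 0 1)))); first by rewrite !lt_min r0 !g0.
  split=> [u v|u|v]; rewrite !lt_min.
  - by move=> /and3P[ur _ _] /and3P[vr _ _]; exact: rP.
  - by move=> /and3P[_ ur _]; exact: gP.
  - by move=> /and3P[_ _ vr]; exact: gP.
have Fslice1 l u v : resolution_off_exc n U i (row2 u v) -> exists2 e : R, 0 < e & exists M,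
    forall u', u' != u -> cabs (u' - u) < e -> cabs (F l (row2 u' v)) <= M.
  move=> /Fd dF; have := continuous_bounded_near (differentiable_continuous (differentiable_slice1 (dF l))).
  by move=> [e e0 [M FM]]; exists e => //; exists M => u' _; exact: FM.
have Fslice2 l u v : resolution_off_exc n U i (row2 u v) -> exists2 e : R, 0 < e & exists M,
    forall v', v' != v -> cabs (v' - v) < e -> cabs (F l (row2 u v')) <= M.
  move=> /Fd dF; have := continuous_bounded_near (differentiable_continuous (differentiable_slice2 (dF l))).
  by move=> [e e0 [M FM]]; exists e => //; exists M => v' _; exact: FM.
(* For a coordinate that is not exceptional the chart's coframe has du in place of du/u, which costs
   a power of that coordinate. This is harmless, since the bound is used only on slices where that
   coordinate is fixed and nonzero. *)
have Fbound l p0 : (l <= m)%N -> exc_locus i p0 -> exists2 r : R, 0 < r & exists2 M, 0 <= M & forall u v,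
    cabs (u - p0 0 0) < r -> cabs (v - p0 0 1) < r -> u != 0 -> v != 0 ->
    resolution_off_exc n U i (row2 u v) ->
    cabs (F l (row2 u v)) <= M * ((if (i < n)%N then 1 else (cabs u ^+ l)^-1) *
                                  (if (0 < i)%N then 1 else (cabs v ^+ (m - l))^-1)).
  move=> lm /growth[r r0 rP]; exists r => //.
  have /choice[M MP] (j : 'I_m.+1) := rP j%:R 1.
  exists (\sum_(j < m.+1) cabs (interp R l j) * `|M j|).
    by apply: sumr_ge0 => j _; rewrite mulr_ge0 ?cabs_ge0.
  move=> u v ur vr u0 v0 offp; set p := row2 u v.
  have E : h (mono_exp m l) p * (u ^+ l * v ^+ (m - l)) = \sum_(j < m.+1) interp R l j * w p (logvec p j%:R 1).
    have := (interpE (fun l => h (mono_exp m l) p * (u ^+ l * v ^+ (m - l))) lm). move=> ->.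
    apply: eq_bigr => j _; rewrite hw// symform2E /logvec !row20 !row21.
    by rewrite form_val_scale.
  have -> : F l p = (h (mono_exp m l) p * (u ^+ l * v ^+ (m - l))) * (u ^+ d * v ^+ d')^-1 *
      ((if (i < n)%N then 1 else (u ^+ l)^-1) * (if (0 < i)%N then 1 else (v ^+ (m - l))^-1)).
    rewrite /F /cu /cv /p row20 row21.
    by case: ifP => _; case: ifP => _; field; rewrite ?expf_neq0.
  rewrite cabsM ler_pM ?cabs_ge0//; last first.
    by rewrite cabsM; case: ifP => _; case: ifP => _; rewrite ?cabsV ?cabsX ?cabs1.
  rewrite E cabsM cabsV cabsM !cabsX ler_pdivrMr; last by rewrite mulr_gt0// exprn_gt0// cabs_gt0.
  apply: le_trans (cabs_sum _ _ _) _; rewrite mulr_suml; apply: ler_sum => j _.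
  rewrite cabsM -mulrA ler_wpM2l ?cabs_ge0//.
  apply: le_trans (MP _ _ _ ur vr u0 v0) _; rewrite ler_wpM2r ?ler_norm//.
  by rewrite mulr_ge0// exprn_ge0// cabs_ge0.
have local l p0 : (l <= m)%N -> exc_locus i p0 -> exists G, exists2 e : R, 0 < e &
    [/\ forall u v, cabs (u - p0 0 0) < e -> cabs (v - p0 0 1) < e -> differentiable G (row2 u v),
        forall u v, cabs (u - p0 0 0) < e -> cabs (v - p0 0 1) < e -> u != p0 0 0 -> v != p0 0 1 ->
          G (row2 u v) = F l (row2 u v) &
        forall u v, cabs (u - p0 0 0) < e -> cabs (v - p0 0 1) < e -> U (sigma i (row2 u v))].
  move=> lm Ep0; have [r r0 [rU ru rv]] := box _ Ep0.
  have [b b0 [M M0 bM]] := Fbound l p0 lm Ep0.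
  pose e := Num.min r b; have e0 : 0 < e by rewrite lt_min r0.
  have er x : x < e -> x < r by rewrite lt_min => /andP[].
  have eb x : x < e -> x < b by rewrite lt_min => /andP[].
  have offtorus u v : cabs (u - p0 0 0) < e -> cabs (v - p0 0 1) < e -> u != 0 -> v != 0 ->
      resolution_off_exc n U i (row2 u v).
    by move=> ue ve u0 v0; apply: toff; [split; rewrite ?row20 ?row21|apply: rU; exact: er].
  have [|v vv0 ve|u uu0 ue|G [g /andP[g0 ge] GP]] := @removable_cross R (F l) (p0 0 0) (p0 0 1) e e0.
  - move=> u v ue ve uu0 vv0; apply: Fd; apply: offtorus => //; [exact: ru (er _ ue) uu0|exact: rv (er _ ve) vv0].
  - have v0 := rv _ (er _ ve) vv0.
    (* Either the line u = u0 lies in E and the growth bound applies, or the slice meets it off E,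
       where [F l] is already differentiable. *)
    have [/andP[/eqP p00 lt_in]|H] := boolP ((p0 0 0 == 0) && (i < n)%N).
      exists e => //; exists (M * (1 * (if (0 < i)%N then 1 else (cabs v ^+ (m - l))^-1))) => u uu0 ue.
      have u0 := ru _ (er _ ue) uu0.
      by have := bM u v (eb _ ue) (eb _ ve) u0 v0 (offtorus _ _ ue ve u0 v0); rewrite lt_in.
    apply: Fslice1; apply/offE; rewrite row20 row21; split=> [|lt_in|//].
      by apply: rU; [rewrite subrr cabs0|exact: er].
    by move: H; rewrite lt_in andbT.
  - have u0 := ru _ (er _ ue) uu0.
    have [/andP[/eqP p00 lt_in]|H] := boolP ((p0 0 1 == 0) && (0 < i)%N).
      exists e => //; exists (M * ((if (i < n)%N then 1 else (cabs u ^+ l)^-1) * 1)) => v vv0 ve.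
      have v0 := rv _ (er _ ve) vv0.
      by have := bM u v (eb _ ue) (eb _ ve) u0 v0 (offtorus _ _ ue ve u0 v0); rewrite lt_in.
    apply: Fslice2; apply/offE; rewrite row20 row21; split=> [|//|lt_in].
      by apply: rU; [exact: er|rewrite subrr cabs0].
    by move: H; rewrite lt_in andbT.
  exists G, g => //; split=> u v ug vg; have [dG GF] := GP _ _ ug vg => //.
  by apply: rU; apply: er; exact: lt_le_trans ge.
have /choice[G GP] (lp : nat * 'rV[C]_2) : exists G, (lp.1 <= m)%N -> exc_locus i lp.2 -> exists2 e : R, 0 < e &
    [/\ forall u v, cabs (u - lp.2 0 0) < e -> cabs (v - lp.2 0 1) < e -> differentiable G (row2 u v),
        forall u v, cabs (u - lp.2 0 0) < e -> cabs (v - lp.2 0 1) < e -> u != lp.2 0 0 -> v != lp.2 0 1 ->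
          G (row2 u v) = F lp.1 (row2 u v) &
        forall u v, cabs (u - lp.2 0 0) < e -> cabs (v - lp.2 0 1) < e -> U (sigma i (row2 u v))].
  have [[lm Ep]|H] := pselect ((lp.1 <= m)%N /\ exc_locus i lp.2).
    by have [G HG] := local _ _ lm Ep; exists G.
  by exists (fun=> 0) => lm Ep; case: H.
(* At a point of E the value comes from the extension chosen at that very point. By density all
   these values agree near p0 with the single extension chosen at p0. *)
pose f (k : mexp m 2) p := if `[< exc_locus i p >] then G (k ord0 : nat, p) p else F (k ord0) p.
exists f; last first.
  move=> p xi offp; rewrite wF// symform2E; congr (_ * _); apply: eq_bigr => l _; congr (_ * _).
  rewrite /f asboolF; last by case: offp.
  by rewrite ffunE /= inordK.
move=> k p0 Up0; have km : (k ord0 <= m)%N by rewrite -ltnS.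
have [Ep0|nEp0] := pselect (exc_locus i p0); last first.
  have off0 : resolution_off_exc n U i p0 by split.
  apply: near_eq_differentiable (Fd (k ord0) p0 off0).
  have := open_nbhs_nbhs (conj (@open_resolution_off_exc R n U i n0 oU) off0).
  by apply: filterS => p [_ nEp]; rewrite /f asboolF.
have [e e0 [dG GF GU]] := GP (k ord0 : nat, p0) km Ep0.
have dGp0 : differentiable (G (k ord0 : nat, p0)) p0.
  by have := dG (p0 0 0) (p0 0 1); rewrite /= -row2E !subrr cabs0; apply.
apply: near_eq_differentiable dGp0.
apply/nbhs_row2P; exists e => // u v ue ve; rewrite /f; set p := row2 u v.
have GFp : nbhs p (fun q : 'rV[C]_2 => q 0 0 != p0 0 0 -> q 0 1 != p0 0 1 -> G (k ord0 : nat, p0) q = F (k ord0) q).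
  have : nbhs p (fun q : 'rV[C]_2 => cabs (q 0 0 - p0 0 0) < e) /\ nbhs p (fun q : 'rV[C]_2 => cabs (q 0 1 - p0 0 1) < e).
    split; apply/nbhs_row2P; [exists (e - cabs (u - p0 0 0))|exists (e - cabs (v - p0 0 1))]; rewrite ?subr_gt0//.
      by move=> u' v'; rewrite /p !row20 => H _; have := cabs_triangle_sub u' u (p0 0 0); lra.
    by move=> u' v'; rewrite /p !row21 => _ H; have := cabs_triangle_sub v' v (p0 0 1); lra.
  move=> [N1 N2]; apply: filterS2 N1 N2 => q q1 q2 qp0 qp1.
  by rewrite (row2E q); exact: GF.
have dGp : differentiable (G (k ord0 : nat, p0)) p by exact: dG.
case: asboolP => [Ep|nEp].
  have [e' e'0 [dG' GF' _]] := GP (k ord0 : nat, p) km Ep.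
  apply: (@eq_of_dense _ _ _ p (p0 0 0) (p 0 0) (p0 0 1) (p 0 1)).
  - exact: differentiable_continuous.
  - apply: differentiable_continuous.
    by have := dG' (p 0 0) (p 0 1); rewrite /= -row2E !subrr cabs0; apply.
  have N' : nbhs p (fun q : 'rV[C]_2 => q 0 0 != p 0 0 -> q 0 1 != p 0 1 -> G (k ord0 : nat, p) q = F (k ord0) q).
    by apply/nbhs_row2P; exists e' => // u' v' H1 H2; rewrite row20 row21; exact: GF'.
  apply: filterS2 GFp N' => q H1 H2 ? ? ? ?; by rewrite H1// H2.
apply: (@eq_of_dense _ _ _ p (p0 0 0) (p0 0 0) (p0 0 1) (p0 0 1)).
- exact: differentiable_continuous.
- by apply: differentiable_continuous; apply: Fd; split=> //; exact: GU.
by apply: filterS GFp => q H ? _ ? _; exact: H.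
Qed.

End LogExtension.

(** * Growth of sections *)

Section MaxDivisor.
Variables (n m : nat).
Local Open Scope nat_scope.

(** The number of terms in the r-th multiplicity: the position of the r-th curve counted from the
    nearer end of the chain, that is min(r + 1, n - r). *)
Definition chain_dist (r : nat) := (minn r (n - r.+1)).+1.

(** Closed form of the multiplicity. With m = t (n + 1) + s and 0 <= s <= n, the j-th ceiling is t +
    1 if 2 j < s and t otherwise, because 2 j < n + 1 for the indices that occur. *)
Definition max_mult (r : nat) :=
  chain_dist r * (m %/ n.+1) + minn (chain_dist r) (uphalf (m %% n.+1)).

Lemma sum_ltn_minn K X : \sum_(0 <= j < K) (j < X : nat) = minn K X.
Proof.
elim: K => [|K IH]; first by rewrite big_geq ?min0n.
by rewrite big_nat_recr//= IH; case: ltnP => H; lia.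
Qed.

Lemma max_divisorE (r : 'I_n) : max_divisor n m r = max_mult r.
Proof.
rewrite /max_divisor.
have ceilE j : (j < chain_dist r) -> Num.ceil ((m%:R - (2 * j)%:R) / n.+1%:R : rat)%R =
    (m %/ n.+1 + (j < uphalf (m %% n.+1)))%N :> int.
  rewrite /chain_dist => hj; apply: ceil_def.
  have mE := divn_eq m n.+1; have := ltn_pmod m (ltn0Sn n).
  have := ltn_ord r.
  set t := m %/ n.+1 in mE *; set s := m %% n.+1 in mE * => rn sn.
  have q0 : (0 < n.+1%:R :> rat)%R by rewrite ltr0n.
  rewrite ltr_pdivlMr// ler_pdivrMr//.
  rewrite -[n.+1%:R%R]/((n.+1 : int)%:~R)%R -[m%:R%R]/((m : int)%:~R)%R.
  rewrite -[(2 * j)%:R%R]/(((2 * j)%N : int)%:~R)%R.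
  rewrite -rmorphB -!rmorphM /= ltr_int ler_int; case: ltnP => hjs; nia.
transitivity (\sum_(0 <= j < chain_dist r) (m %/ n.+1 + (j < uphalf (m %% n.+1)))%N%:Z)%R.
  by apply: eq_big_nat => j /andP[_ hj]; exact: ceilE.
rewrite -(big_morph Posz PoszD (erefl _)) big_split /= sum_ltn_minn.
by rewrite big_const_nat subn0 iter_addn_0 mulnC.
Qed.

(** The right-hand side is n + 1 times the order of z1^A z2^B on the r-th curve. With K =
    [chain_dist r] this order is at least X + T K, where m <= 2 X + (n + 1) T. If T > t, the term T
    K suffices; otherwise each unit missing from T forces X up by (n + 1) / 2 >= K. *)
Lemma max_mult_lower (A B r : nat) : r < n -> m <= A + B -> A = B %[mod n.+1] ->
  n.+1 * max_mult r <= A * r.+1 + B * (n - r).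
Proof.
move=> rn; rewrite /max_mult; have := divn_eq m n.+1; have := ltn_pmod m (ltn0Sn n).
have := divn_eq A n.+1; have := divn_eq B n.+1.
have : chain_dist r = minn r.+1 (n - r) by rewrite /chain_dist; lia.
move: (chain_dist r) => K; move: (m %/ n.+1) (m %% n.+1) => t s.
move: (A %/ n.+1) (A %% n.+1) (B %/ n.+1) (B %% n.+1) => tA sA tB sB.
move=> KE BE AE sn mE AB sAB; move: sAB BE AE => <- {sB} BE AE.
(* X = min(A, B) and T = |A - B| / (n + 1): the right-hand side divided by     *)
(* n + 1 is X + T * r.+1 or X + T * (n - r).                                   *)
have key (X T : nat) : m <= 2 * X + n.+1 * T -> K * t + minn K (uphalf s) <= X + T * K.
  move=> H; have [?|?] := leqP t.+1 T; first by nia.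
  have [d tE] : exists d, t = T + d by exists (t - T); lia.
  have K2 : 2 * K <= n.+1 by lia.
  have : d * (2 * K) <= d * n.+1 by rewrite leq_mul2l K2 orbT.
  have : d * n.+1 + s <= 2 * X by move: H; rewrite mE tE mulnDl; lia.
  rewrite tE mulnDr; have -> : d * (2 * K) = 2 * (K * d) by lia.
  by move: (d * n.+1) (K * d) (mulnC K T) => a b ->; lia.
have [le_BA|lt_AB] := leqP tB tA.
  have HA : A = B + n.+1 * (tA - tB) by nia.
  have := key B (tA - tB); rewrite HA in AB *; move=> /(_ ltac:(lia)) H.
  have -> : (B + n.+1 * (tA - tB)) * r.+1 + B * (n - r) = n.+1 * (B + (tA - tB) * r.+1).
    have : n - r + r.+1 = n.+1 by lia.
    by move: (n - r) (tA - tB) => a b; nia.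
  rewrite leq_pmul2l//; apply: leq_trans H _; rewrite leq_add2l leq_mul2l KE geq_minl.
  exact: orbT.
have HB : B = A + n.+1 * (tB - tA) by nia.
have := key A (tB - tA); rewrite HB in AB *; move=> /(_ ltac:(lia)) H.
have -> : A * r.+1 + (A + n.+1 * (tB - tA)) * (n - r) = n.+1 * (A + (tB - tA) * (n - r)).
  have : n - r + r.+1 = n.+1 by lia.
  by move: (n - r) (tB - tA) => a b; nia.
rewrite leq_pmul2l//; apply: leq_trans H _; rewrite leq_add2l leq_mul2l KE geq_minr.
exact: orbT.
Qed.

(** The extremal pair is X = 0, T = t + 1 or X = ceil(s / 2), T = t, with the larger exponent put on
    the variable of smaller weight. The split k, m - k of the degree makes z1^A z2^B (dz1/z1)^k
    (dz2/z2)^(m-k) holomorphic on C^2. *)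
Lemma max_mult_attained (r : nat) : r < n -> exists A B k,
  [/\ k <= m, k <= A, m - k <= B, A = B %[mod n.+1] &
      A * r.+1 + B * (n - r) = n.+1 * max_mult r].
Proof.
move=> rn; rewrite /max_mult; have := divn_eq m n.+1; have := ltn_pmod m (ltn0Sn n).
have : chain_dist r = minn r.+1 (n - r) by rewrite /chain_dist; lia.
move: (chain_dist r) => K; move: (m %/ n.+1) (m %% n.+1) => t s KE sn mE.
have nr : n - r + r.+1 = n.+1 by lia.
have [X [T [XT E]]] : exists X T, m <= 2 * X + n.+1 * T /\ X + T * K = K * t + minn K (uphalf s).
  have [Ks|sK] := leqP K (uphalf s); [exists 0, t.+1|exists (uphalf s), t]; nia.
have modE Y Z : Y + n.+1 * Z = Y %[mod n.+1] by rewrite addnC mulnC modnMDl.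
have [rK|rK] := leqP r.+1 (n - r).
  have {}KE : K = r.+1 by lia.
  exists (X + n.+1 * T), X, (minn m (X + n.+1 * T)); split; rewrite ?geq_minl ?geq_minr//; first lia.
  by rewrite -E KE; move: (n - r) nr => a <-; nia.
have {}KE : K = n - r by lia.
exists X, (X + n.+1 * T), (minn m X); split; rewrite ?geq_minl ?geq_minr//; first lia.
by rewrite -E KE; move: (n - r) nr => a <-; nia.
Qed.

End MaxDivisor.

Section DivisorEquation.
Variables (R : realType) (n : nat).
Local Notation C := (Cplx R).
Implicit Types (p xi : 'rV[C]_2) (i : 'I_n.+1).

(* 0 if there is no k-th curve *)
Definition div_mult (D : exc_divisor n) (k : nat) : int :=
  oapp D 0 (insub k).

Lemma div_multE D (r : 'I_n) : div_mult D r = D r.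
Proof. by rewrite /div_mult valK. Qed.

Lemma div_mult_out D k : (n <= k)%N -> div_mult D k = 0.
Proof. by move=> nk; rewrite /div_mult insubF// ltnNge nk. Qed.

(** Only the i-th curve, as u = 0, and the preceding one, as v = 0, meet the i-th chart. *)
Lemma divisor_eqE D i p : divisor_eq D i p =
  p 0 0 ^ div_mult D i * p 0 1 ^ (if (i : nat) is k.+1 then div_mult D k else 0) :> C.
Proof.
have prodE (k : nat) (x : C) : \prod_(r < n) (if k == r then x ^ D r else 1) = x ^ div_mult D k.
  rewrite -big_mkcond /=; have [kn|nk] := ltnP k n.
    rewrite (big_pred1 (Ordinal kn)); first by rewrite -[k in RHS]/(val (Ordinal kn)) div_multE.
    by move=> r /=; rewrite eq_sym.
  rewrite div_mult_out// expr0z big1// => r /eqP kr.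
  by move: nk; rewrite kr leqNgt ltn_ord.
have -> : divisor_eq D i p = \prod_(r < n) ((if i == r :> nat then p 0 0 ^ D r else 1) *
    (if i == r.+1 :> nat then p 0 1 ^ D r else 1)).
  apply: eq_bigr => r _; rewrite /exc_eq; case: eqP => [->|_].
    by rewrite (_ : (r == r.+1 :> nat) = false) ?mulr1// -{1}[r : nat]addn0 -addn1 eqn_add2l.
  by rewrite mul1r; case: ifP => _; rewrite ?exp1rz.
apply: etrans (big_split _ _ _ _ _) _; congr (_ * _); first exact: prodE.
case: (i : nat) => [|k]; first by rewrite expr0z big1.
by rewrite -prodE; apply: eq_bigr => r _; rewrite eqSS.
Qed.

End DivisorEquation.

(** * From bounds on C^2 to growth along the curves *)

Section Growth.
Variables (R : realType) (n m : nat).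
Local Notation C := (Cplx R).
Implicit Types (p z xi : 'rV[C]_2) (i : 'I_n.+1).

(** The (n+1)-th power of z1^e.1 z2^e.2 is a monomial in u, v with the two exponents on the right.
    The condition says that z1^e.1 z2^e.2 vanishes to order at least d on u = 0 and d' on v = 0. *)
Definition dominates i (d d' : nat) (e : nat * nat) :=
  (n.+1 * d <= e.1 * i.+1 + e.2 * (n - i) /\
   n.+1 * d' <= e.1 * i + e.2 * (n.+1 - i))%N.

Definition in_box (r : R) z := cabs (z 0 0) < r /\ cabs (z 0 1) < r.

Lemma expr_le_scale (x K : R) a b : 0 <= x -> x <= K -> 1 <= K -> (b <= a)%N ->
  x ^+ a <= K ^+ a * x ^+ b.
Proof.
move=> x0 xK K1 ba; rewrite -{1}(subnK ba) exprD ler_wpM2r ?exprn_ge0//.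
apply: le_trans (_ : K ^+ (a - b) <= _); first by rewrite lerXn2r ?nnegrE// (le_trans x0).
by rewrite ler_weXn2l// leq_subr.
Qed.

Lemma tau_norm i z : torus z ->
  cabs (z 0 0) ^+ n.+1 = cabs (tau i z 0 0) ^+ i.+1 * cabs (tau i z 0 1) ^+ i /\
  cabs (z 0 1) ^+ n.+1 = cabs (tau i z 0 0) ^+ (n - i) * cabs (tau i z 0 1) ^+ (n.+1 - i).
Proof.
move=> tz; move: (tau i z) (sigma_tau i tz) => p E.
have := congr1 (fun q : 'rV[C]_3 => cabs (q 0 0)) E.
have := congr1 (fun q : 'rV[C]_3 => cabs (q 0 2%:R)) E.
by rewrite !mxE /= !cabsM !cabsX => -> ->.
Qed.

(** After raising to the power n + 1 both sides are monomials in |u| and |v|, and surplus exponents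
    are absorbed by powers of K. *)
Lemma dominates_le i d d' (e : nat * nat) (K : R) z : 1 <= K -> torus z ->
  dominates i d d' e -> cabs (tau i z 0 0) <= K -> cabs (tau i z 0 1) <= K ->
  cabs (z 0 0) ^+ e.1 * cabs (z 0 1) ^+ e.2 <=
  K ^+ ((e.1 * i.+1 + e.2 * (n - i)) + (e.1 * i + e.2 * (n.+1 - i))) *
  (cabs (tau i z 0 0) ^+ d * cabs (tau i z 0 1) ^+ d').
Proof.
move=> K1 tz [de de'] uK vK; have [E0 E1] := tau_norm i tz.
set u := cabs (tau i z 0 0) in uK E0 E1 *; set v := cabs (tau i z 0 1) in vK E0 E1 *.
have u0 : 0 <= u := cabs_ge0 _; have v0 : 0 <= v := cabs_ge0 _.
have K0 : 0 <= K by apply: le_trans K1.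
rewrite -(ler_pXn2r (ltn0Sn n)) ?nnegrE; last 2 first.
- by rewrite mulr_ge0// exprn_ge0// cabs_ge0.
- by rewrite !mulr_ge0// exprn_ge0.
set a := (e.1 * i.+1 + e.2 * (n - i))%N in de *.
set b := (e.1 * i + e.2 * (n.+1 - i))%N in de' *.
have -> : (cabs (z 0 0) ^+ e.1 * cabs (z 0 1) ^+ e.2) ^+ n.+1 = u ^+ a * v ^+ b.
  rewrite exprMn -!exprM [(e.1 * _)%N]mulnC [(e.2 * _)%N]mulnC !exprM E0 E1 !exprMn -!exprM.
  by rewrite mulrACA -!exprD ![(_ * e.1)%N]mulnC ![(_ * e.2)%N]mulnC.
rewrite exprMn exprMn -!exprM [(d * _)%N]mulnC [(d' * _)%N]mulnC.
apply: le_trans (ler_pM _ _ (expr_le_scale u0 uK K1 de) (expr_le_scale v0 vK K1 de')) _; rewrite ?exprn_ge0//.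
rewrite mulrACA -exprD ler_wpM2r ?mulr_ge0 ?exprn_ge0//.
by rewrite ler_weXn2l// leq_pmulr.
Qed.

(** The exponent matrix of [tau i] has determinant n + 1. *)
Lemma tau_log_surj i (A B : C) : exists a b, tau_log i a b = (A, B).
Proof.
have q0 : n.+1%:R != 0 :> C by rewrite pnatr_eq0.
exists ((i.+1%:R * A + i%:R * B) / n.+1%:R), (((n%:R - i%:R) * A + (n.+1%:R - i%:R) * B) / n.+1%:R).
rewrite /tau_log; congr pair; rewrite -!natr1; field.
all: by rewrite ?natr1.
Qed.

Lemma cabs_form_val_le (c : nat -> C) (M : R) (a b : C) :
  (forall l, (l <= m)%N -> cabs (c l) <= M) ->
  cabs (form_val m c a b) <= M * \sum_(l < m.+1) cabs a ^+ l * cabs b ^+ (m - l).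
Proof.
move=> cM; apply: le_trans (cabs_sum _ _ _) _; rewrite mulr_sumr.
apply: ler_sum => l _; rewrite cabsM cabsM !cabsX ler_wpM2r ?cM -1?ltnS//.
by rewrite mulr_ge0// exprn_ge0// cabs_ge0.
Qed.

(** Carries a bound on the logarithmic coefficients over C^2 to the chart. A torus point near E
    lifts to a point z close to 0, because z1^(n+1) and z2^(n+1) are coordinates of its image under
    [sigma], which is close to 0; the coframes differ by a constant matrix. *)
Lemma log_growth_of_bound i d d' (w : symdiff R 1) (G : nat -> 'rV[C]_2 -> C)
    (S : nat -> seq (nat * nat)) (M : nat -> R) (r : R) p0 :
  (0 < n)%N -> 0 < r ->
  (forall z a b, torus z -> in_box r z ->
     w (tau i z) (tau_vec i z a b) = form_val m (G^~ z) (z 0 0 * a) (z 0 1 * b)) ->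
  (forall l e, (l <= m)%N -> e \in S l -> dominates i d d' e) ->
  (forall l z, (l <= m)%N -> torus z -> in_box r z ->
     cabs (G l z * (z 0 0 ^+ l * z 0 1 ^+ (m - l))) <=
     M l * \sum_(e <- S l) cabs (z 0 0) ^+ e.1 * cabs (z 0 1) ^+ e.2) ->
  exc_locus i p0 -> log_growth i d d' w p0.
Proof.
move=> n0 r0 wG Sdom GM Ep0.
have s0 : sigma i p0 = 0 by move: Ep0; rewrite exc_locusE.
have rn0 : 0 < r ^+ n.+1 by rewrite exprn_gt0.
have [t t0 tP] : exists2 t : R, 0 < t & forall u v, cabs (u - p0 0 0) < t -> cabs (v - p0 0 1) < t ->
    cabs (sigma i (row2 u v) 0 0) < r ^+ n.+1 /\ cabs (sigma i (row2 u v) 0 2%:R) < r ^+ n.+1.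
  have /cvgrPdist_lt := @continuous_sigma R n i p0.
  move=> /(_ (r ^+ n.+1)%:C%C); rewrite ltcR => /(_ rn0) /nbhs_row2P[t t0 tP]; exists t => // u v ut vt.
  have := tP _ _ ut vt; rewrite s0 sub0r /= => H.
  by rewrite !cabs_ltE; split; apply: le_lt_trans H; rewrite normrN; exact: coord_norm_le.
exists t => // A B.
have [a [b abE]] := tau_log_surj i A B.
pose K : R := cabs (p0 0 0) + cabs (p0 0 1) + t + 1.
have K1 : 1 <= K by rewrite /K; have := cabs_ge0 (p0 0 0); have := cabs_ge0 (p0 0 1); lra.
pose W (e : nat * nat) := K ^+ ((e.1 * i.+1 + e.2 * (n - i)) + (e.1 * i + e.2 * (n.+1 - i))).
have W0 e : 0 <= W e by rewrite exprn_ge0// (le_trans _ K1).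
exists ((\sum_(l < m.+1) `|M l| * \sum_(e <- S l) W e) * \sum_(l < m.+1) cabs a ^+ l * cabs b ^+ (m - l)).
move=> u v ut vt u0 v0; set p := row2 u v.
have tp : torus p by rewrite /torus /= row20 row21.
have [z tz zp] := tau_surj i tp.
have zbox : in_box r z.
  have E := sigma_tau i tz; have [x1 x2] := tP _ _ ut vt.
  have := congr1 (fun q : 'rV[C]_3 => cabs (q 0 0)) E.
  have := congr1 (fun q : 'rV[C]_3 => cabs (q 0 2%:R)) E.
  rewrite zp => E2 E1; rewrite E1 in x1; rewrite E2 in x2.
  split; rewrite -(ltr_pXn2r (ltn0Sn n)) ?nnegrE ?cabs_ge0 ?(ltW r0)// -cabsX.
    by move: x1; rewrite mxE.
  by move: x2; rewrite mxE.
have := wG z a b tz zbox; rewrite /tau_vec abE zp => ->.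
rewrite form_val_scale mulrAC.
have pu : cabs (tau i z 0 0) = cabs u by rewrite zp row20.
have pv : cabs (tau i z 0 1) = cabs v by rewrite zp row21.
have tri (x c : C) : cabs (x - c) < t -> cabs x <= cabs c + t.
  by move=> H; rewrite -[x](subrK c) addrC (le_trans (cabsD _ _))// lerD2l ltW.
have uK : cabs (tau i z 0 0) <= K.
  by rewrite pu /K; have := tri _ _ ut; have := cabs_ge0 (p0 0 1); lra.
have vK : cabs (tau i z 0 1) <= K.
  by rewrite pv /K; have := tri _ _ vt; have := cabs_ge0 (p0 0 0); lra.
apply: cabs_form_val_le => l lm; apply: le_trans (GM _ _ lm tz zbox) _.
rewrite -pu -pv; set T := _ ^+ d * _.
have T0 : 0 <= T by rewrite mulr_ge0// exprn_ge0// cabs_ge0.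
have S0 : 0 <= \sum_(e <- S l) W e by rewrite sumr_ge0.
apply: (@le_trans _ _ (`|M l| * ((\sum_(e <- S l) W e) * T))).
  apply: (@le_trans _ _ (`|M l| * \sum_(e <- S l) cabs (z 0 0) ^+ e.1 * cabs (z 0 1) ^+ e.2)).
    rewrite ler_wpM2r ?ler_norm// sumr_ge0// => e _.
    by rewrite mulr_ge0// exprn_ge0// cabs_ge0.
  rewrite ler_wpM2l// mulr_suml !big_seq; apply: ler_sum => e eS.
  by apply: dominates_le => //; exact: Sdom eS.
rewrite mulrA ler_wpM2r//.
rewrite (bigD1 (Ordinal (lm : (l < m.+1)%N)))//= lerDl sumr_ge0// => k _.
by rewrite mulr_ge0// sumr_ge0.
Qed.

End Growth.

(** * Taylor's formula on C^2 *)

Section Taylor.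
Variable R : realType.
Local Notation C := (Cplx R).
Implicit Types (r : R) (z : 'rV[C]_2) (G H : 'rV[C]_2 -> C).

Definition box_differentiable r G := forall z, in_box r z -> differentiable G z.

Lemma finite_radius N (P : nat -> R -> Prop) (r : R) : 0 < r ->
  (forall a s t, s <= t -> P a t -> P a s) ->
  (forall a, (a < N)%N -> exists2 t : R, 0 < t & P a t) ->
  exists2 t : R, 0 < t <= r & forall a, (a < N)%N -> P a t.
Proof.
move=> r0 Pmono; elim: N => [|N IH] HP; first by exists r; rewrite ?r0 /=.
have [a aN|t /andP[t0 tr] tP] := IH _; first by apply: HP; exact: ltnW.
have [s s0 sP] := HP N (ltnSn N).
exists (Num.min s t) => [|a]; first by rewrite lt_min s0 t0 ge_min tr orbT.
rewrite ltnS leq_eqVlt => /orP[/eqP ->|aN]; first by apply: Pmono sP; rewrite ge_min lexx.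
by apply: Pmono (tP _ aN); rewrite ge_min lexx orbT.
Qed.

Lemma box_differentiable_le r s G : s <= r -> box_differentiable r G -> box_differentiable s G.
Proof. by move=> sr dG z [z0 z1]; apply: dG; split; apply: lt_le_trans sr. Qed.

Lemma differentiable_edge G z : differentiable G (row2 0 (z 0 1)) ->
  differentiable (fun q : 'rV[C]_2 => G (row2 0 (q 0 1))) z.
Proof.
move=> dG; apply: (@differentiable_comp _ _ _ _ (fun q : 'rV[C]_2 => row2 0 (q 0 1)) G _ _ dG).
by apply: differentiable_row2; [exact: dfun_cst|exact: differentiable_coord].
Qed.

(** The quotient (G(z1, z2) - G(0, z2)) / z1 is bounded near z1 = 0 on each slice, by derivability
    of [G], so [removable_cross] extends it. *)
Lemma divide_first r G : 0 < r -> box_differentiable r G ->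
  exists2 s : R, 0 < s <= r & exists2 H, box_differentiable s H &
    forall z, in_box s z -> G z = G (row2 0 (z 0 1)) + z 0 0 * H z.
Proof.
move=> r0 dG; pose F z := (G z - G (row2 0 (z 0 1))) * (z 0 0)^-1.
have edge z : in_box r z -> differentiable (fun q : 'rV[C]_2 => G (row2 0 (q 0 1))) z.
  by move=> [_ z1]; apply: differentiable_edge; apply: dG; rewrite /in_box row20 row21 cabs0.
have dF z : in_box r z -> z 0 0 != 0 -> differentiable F z.
  move=> zr z0; apply: dfunM; first by apply: dfunB; [exact: dG|exact: edge].
  by apply: dfunV => //; exact: differentiable_coord.
have inb u v : cabs u < r -> cabs v < r -> in_box r (row2 u v) by rewrite /in_box row20 row21.
have [||u u0|H [s sr HP]] := @removable_cross R F 0 0 r r0.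
- by move=> u v; rewrite !subr0 => ur vr u0 v0; apply: dF; [exact: inb|rewrite row20].
- move=> v v0; rewrite subr0 => vr.
  have dv : differentiable (fun u : C => G (row2 u v)) 0.
    by apply: differentiable_slice1; apply: dG; apply: inb; rewrite ?cabs0.
  have [c cP] := differentiable_cderivable dv; have [d d0 dP] := cP 1 ltr01.
  exists d => //; exists (cabs c + 1) => u u0 ud; have := dP _ ud; rewrite subr0 => H.
  rewrite /F row20 row21 cabsM cabsV ler_pdivrMr ?cabs_gt0// mulrDl -cabsM.
  rewrite -[X in cabs X](subrK (c * u)) addrC (le_trans (cabsD _ _))// lerD2l.
  by apply: le_trans H _; rewrite lexx.
- rewrite subr0 => ur; have dFu : differentiable (fun v : C => F (row2 u v)) 0.
    by apply: differentiable_slice2; apply: dF; [apply: inb; rewrite ?cabs0|rewrite row20].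
  have [d d0 [M FM]] := continuous_bounded_near (differentiable_continuous dFu).
  by exists d => //; exists M => v _; exact: FM.
have dH z : in_box s z -> differentiable H z.
  move=> [z0 z1]; have := HP (z 0 0) (z 0 1); rewrite !subr0 -row2E => /(_ z0 z1)[d _].
  exact: d.
exists s => //; exists H => // z zs; have /andP[s0 s_r] := sr.
have zr : in_box r z by case: zs => ? ?; split; exact: lt_le_trans s_r.
apply: (@eq_of_dense _ G (fun q : 'rV[C]_2 => G (row2 0 (q 0 1)) + q 0 0 * H q) z 0 0 0 0).
- by apply: differentiable_continuous; exact: dG.
- apply: differentiable_continuous; apply: dfunD; first exact: edge.
  by apply: dfunM; [exact: differentiable_coord|exact: dH].
have zN : nbhs z (in_box s).
  case: zs => z0 z1; apply/nbhs_row2P; exists (Num.min (s - cabs (z 0 0)) (s - cabs (z 0 1))).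
    by rewrite lt_min !subr_gt0 z0.
  move=> u v; rewrite !lt_min => /andP[H1 _] /andP[_ H2]; rewrite /in_box row20 row21.
  have := cabs_triangle_sub u (z 0 0) 0; have := cabs_triangle_sub v (z 0 1) 0.
  by rewrite !subr0; split; lra.
apply: filterS zN => q [q0 q1] u0 _ v0 _.
have := HP (q 0 0) (q 0 1); rewrite !subr0 -row2E => /(_ q0 q1)[_ /(_ u0 v0) ->].
rewrite /F mulrC divfK//.
by rewrite addrC subrK.
Qed.

Lemma taylor_first r G N : 0 < r -> box_differentiable r G ->
  exists2 s : R, 0 < s <= r & exists g : nat -> C -> C, exists2 H, box_differentiable s H &
    (forall a v, (a < N)%N -> cabs v < s -> differentiable (g a) v) /\
    forall z, in_box s z ->
      G z = \sum_(a < N) g a (z 0 1) * z 0 0 ^+ a + z 0 0 ^+ N * H z.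
Proof.
move=> r0 dG; elim: N => [|N [s /andP[s0 sr] [g [H dH [dg GE]]]]].
  exists r; first by rewrite r0 /=.
  exists (fun _ _ => 0), G => //; split=> // z _.
  by rewrite big_ord0 add0r expr0 mul1r.
have [t /andP[t0 ts] [K dK HE]] := divide_first s0 dH.
exists t; first by rewrite t0 (le_trans ts).
exists (fun a => if a == N then (fun v => H (row2 0 v)) else g a), K => //; split=> [a v|z [z0 z1]].
  rewrite ltnS leq_eqVlt => aN vt; have vs := lt_le_trans vt ts.
  have [_|aN'] := eqVneq a N; last by apply: dg => //; move: aN; rewrite (negPf aN').
  by apply: differentiable_slice2; apply: dH; rewrite /in_box row20 row21 cabs0.
have zs : in_box s z by split; exact: lt_le_trans ts.
rewrite GE// {1}HE// big_ord_recr /= eqxx -addrA; congr (_ + _).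
  by apply: eq_bigr => a _; rewrite (ltn_eqF (ltn_ord a)).
by rewrite exprSr; ring.
Qed.

(** The one-variable formula is [taylor_first] for [g] viewed as a function of the first coordinate
    of C^2. *)
Lemma taylor_slice r (g : C -> C) N : 0 < r ->
  (forall v, cabs v < r -> differentiable g v) ->
  exists2 s : R, 0 < s & exists (c : nat -> C) (M : R), forall v, cabs v < s ->
    cabs (g v - \sum_(b < N) c b * v ^+ b) <= M * cabs v ^+ N.
Proof.
move=> r0 dg; pose G z := g (z 0 0 : C).
have dG : box_differentiable r G.
  move=> z [z0 _]; apply: (@differentiable_comp _ _ _ _ (fun q : 'rV[C]_2 => q 0 0 : C) g).
    exact: differentiable_coord.
  exact: dg.
have [s /andP[s0 sr] [k [H dH [_ GE]]]] := taylor_first N r0 dG.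
have [|d d0 [M HM]] := @continuous_bounded_near _ (fun u : C => H (row2 u 0)) 0.
  apply: differentiable_continuous; apply: differentiable_slice1; apply: dH.
  by rewrite /in_box row20 row21 cabs0.
exists (Num.min s d); first by rewrite lt_min s0.
exists (fun b => k b 0), M => v; rewrite lt_min => /andP[vs vd].
have := GE (row2 v 0); rewrite /G /in_box row20 row21 cabs0 => /(_ (conj vs s0)) ->.
rewrite addrC addKr cabsM cabsX mulrC ler_wpM2r ?exprn_ge0 ?cabs_ge0//.
by apply: HM; rewrite subr0.
Qed.

(** Expand in z1 to order N, then expand each of the N coefficient functions in z2. Taking the box
    inside the unit box lets the factors z1^a be dropped from the second remainder. *)
Lemma taylor r G N : 0 < r -> box_differentiable r G ->
  exists2 s : R, 0 < s <= r & exists (c : nat -> nat -> C) (M : R), forall z, in_box s z ->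
    cabs (G z - \sum_(a < N) \sum_(b < N) c a b * (z 0 0 ^+ a * z 0 1 ^+ b)) <=
    M * (cabs (z 0 0) ^+ N + cabs (z 0 1) ^+ N).
Proof.
move=> r0 dG; have [s /andP[s0 sr] [g [H dH [dg GE]]]] := taylor_first N r0 dG.
have H0 : {for row2 0 0, continuous H}.
  by apply: differentiable_continuous; apply: dH; rewrite /in_box row20 row21 cabs0.
have [d d0 dP] : exists2 d : R, 0 < d & forall z, in_box d z -> cabs (H z) <= cabs (H (row2 0 0)) + 1.
  have /cvgrPdist_le/(_ 1 ltr01)/nbhs_row2P[d d0 dP] := H0; exists d => // z [z0 z1].
  have := dP (z 0 0) (z 0 1); rewrite row20 row21 !subr0 -row2E => /(_ z0 z1) /=.
  rewrite -[1]/(1%:C%C : C) -cabs_leE cabsB => K.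
  by rewrite -[H z](subrK (H (row2 0 0))) addrC (le_trans (cabsD _ _))// lerD2l.
pose P a t := exists (c : nat -> C) (M : R), forall v, cabs v < t ->
    cabs (g a v - \sum_(b < N) c b * v ^+ b) <= M * cabs v ^+ N.
have [|||t /andP[t0 ts] tP] := @finite_radius N P (Num.min s (Num.min d 1)).
- by rewrite !lt_min s0 d0 ltr01.
- by move=> a x y xy [c [M cM]]; exists c, M => v vx; apply: cM; exact: lt_le_trans xy.
- move=> a aN; exact: (@taylor_slice s (g a) N s0 (fun v => dg a v aN)).
have /choice[c cP] (a : nat) : exists cM : (nat -> C) * R, (a < N)%N -> forall v, cabs v < t ->
    cabs (g a v - \sum_(b < N) cM.1 b * v ^+ b) <= cM.2 * cabs v ^+ N.
  have [aN|] := boolP (a < N)%N; last by exists (fun=> 0, 0).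
  by have [k [M kM]] := tP a aN; exists (k, M).
exists t; first by rewrite t0 (le_trans ts)// (le_trans _ sr)// ge_min lexx.
exists (fun a => (c a).1), (Num.max (cabs (H (row2 0 0)) + 1) (\sum_(a < N) `|(c a).2|)) => z [z0 z1].
have [ts1 td t1] : [/\ t <= s, t <= d & t <= 1].
  by split; apply: le_trans ts _; rewrite !ge_min lexx ?orbT.
have zs : in_box s z by split; exact: lt_le_trans ts1.
rewrite GE// addrAC -sumrB addrC mulrDr.
apply: le_trans (cabsD _ _) _; apply: lerD.
  rewrite cabsM cabsX mulrC ler_wpM2r ?exprn_ge0 ?cabs_ge0// le_max dP//.
  by split; exact: lt_le_trans td.
apply: le_trans (cabs_sum _ _ _) _.
apply: (@le_trans _ _ ((\sum_(a < N) `|(c a).2|) * cabs (z 0 1) ^+ N)); last first.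
  by rewrite ler_wpM2r ?exprn_ge0 ?cabs_ge0// le_max lexx orbT.
rewrite mulr_suml; apply: ler_sum => a _.
have -> : g a (z 0 1) * z 0 0 ^+ a - \sum_(b < N) (c a).1 b * (z 0 0 ^+ a * z 0 1 ^+ b) =
    (g a (z 0 1) - \sum_(b < N) (c a).1 b * z 0 1 ^+ b) * z 0 0 ^+ a.
  rewrite mulrBl; congr (_ - _); rewrite mulr_suml; apply: eq_bigr => b _; ring.
rewrite cabsM cabsX; apply: (@le_trans _ _ (cabs (g a (z 0 1) - \sum_(b < N) (c a).1 b * z 0 1 ^+ b) * 1)).
  by rewrite ler_wpM2l ?cabs_ge0// exprn_ile1 ?cabs_ge0// (le_trans (ltW z0)).
rewrite mulr1; apply: le_trans (cP _ (ltn_ord a) _ z1) _.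
by rewrite ler_wpM2r ?exprn_ge0 ?cabs_ge0 ?ler_norm.
Qed.

End Taylor.

(** * Averaging over the cyclic group *)

Section Averaging.
Variables (R : realType) (n : nat).
Local Notation C := (Cplx R).
Implicit Types (z : 'rV[C]_2).

Lemma closed_prim_root (K : numClosedFieldType) k : (0 < k)%N -> exists e : K, k.-primitive_root e.
Proof.
move=> k0; have [r Dr] := closed_field_poly_normal ('X^k - 1 : {poly K}).
move: Dr; rewrite (monicP (monicXnsubC _ k0)) scale1r => Dr.
have r_root : all k.-unity_root r by apply/allP => e; rewrite -root_prod_XsubC -Dr.
have r_size : (k < (size r).+1)%N by rewrite -(size_prod_XsubC r id) -Dr size_XnsubC.
have r_uniq : uniq r.
  by rewrite -separable_prod_XsubC -Dr separable_Xn_sub_1// pnatr_eq0 -lt0n.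
by have /hasP[e _ eP] := has_prim_root k0 r_root r_uniq r_size; exists e.
Qed.

(** Orthogonality of characters: a geometric sum with ratio e^(A-B). *)
Lemma prim_root_sum (e : C) A B : n.+1.-primitive_root e ->
  \sum_(j < n.+1) (e ^+ j) ^+ A * (e ^- j) ^+ B =
  if A == B %[mod n.+1] then n.+1%:R else 0.
Proof.
move=> eP; pose x := e ^+ A / e ^+ B.
have e0 : e != 0.
  by apply/eqP => e0; have /eqP := prim_expr_order eP; rewrite e0 expr0n eq_sym oner_eq0.
have xE j : (e ^+ j) ^+ A * (e ^- j) ^+ B = x ^+ j.
  by rewrite /x exprMn -!exprVn -!exprM ![(j * _)%N]mulnC.
under eq_bigr do rewrite xE.
case: ifPn => AB.
  have -> : x = 1 by rewrite /x; move: AB; rewrite -(eq_prim_root_expr eP) => /eqP ->; rewrite mulfV ?expf_neq0.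
  by under eq_bigr do rewrite expr1n; rewrite sumr_const card_ord.
have x1 : x - 1 != 0.
  rewrite subr_eq0; apply: contra AB => /eqP xx; rewrite -(eq_prim_root_expr eP).
  by apply/eqP; rewrite -[LHS](divfK (expf_neq0 B e0)) -/x xx mul1r.
apply: (mulfI x1); rewrite mulr0 -subrX1 /x exprMn exprVn -!exprM ![(_ * n.+1)%N]mulnC !exprM.
by rewrite (prim_expr_order eP) !expr1n divr1 subrr.
Qed.

(* Averaging over the group action keeps only the invariant monomials.         *)
Lemma invariant_bound (G : 'rV[C]_2 -> C) (l k N : nat) (r : R) : 0 < r ->
  box_differentiable r G ->
  (forall e z, e ^+ n.+1 = 1 -> torus z -> in_box r z ->
     G (row2 (e * z 0 0) (e^-1 * z 0 1)) * ((e * z 0 0) ^+ l * (e^-1 * z 0 1) ^+ k) =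
     G z * (z 0 0 ^+ l * z 0 1 ^+ k)) ->
  exists2 s : R, 0 < s <= r & exists M, forall z, torus z -> in_box s z ->
    cabs (G z * (z 0 0 ^+ l * z 0 1 ^+ k)) <=
    M * (\sum_(a < N) \sum_(b < N | a + l == b + k %[mod n.+1])
          cabs (z 0 0) ^+ (a + l) * cabs (z 0 1) ^+ (b + k) +
         (cabs (z 0 0) ^+ (N + l) * cabs (z 0 1) ^+ k +
          cabs (z 0 0) ^+ l * cabs (z 0 1) ^+ (N + k))).
Proof.
move=> r0 dG Ginv; have [s /andP[s0 sr] [c [M cM]]] := taylor N r0 dG.
have [e eP] := @closed_prim_root C n.+1 (ltn0Sn n).
have e1 : cabs e = 1.
  apply/eqP; rewrite -(pexpr_eq1 (ltn0Sn n)) ?cabs_ge0// -cabsX.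
  by rewrite (prim_expr_order eP) cabs1.
exists s; first by rewrite s0.
pose Mc := \sum_(a < N) \sum_(b < N) cabs (c a b).
have Mc0 : 0 <= Mc by apply: sumr_ge0 => a _; apply: sumr_ge0 => b _; exact: cabs_ge0.
have cMc a b : (a < N)%N -> (b < N)%N -> cabs (c a b) <= Mc.
  move=> aN bN; rewrite /Mc (bigD1 (Ordinal aN))//= (bigD1 (Ordinal bN))//= -addrA lerDl.
  by rewrite addr_ge0 ?sumr_ge0// => *; rewrite ?sumr_ge0// => *; exact: cabs_ge0.
exists (Num.max Mc `|M|) => z tz [z0 z1].
have zr : in_box r z by split; exact: lt_le_trans sr.
pose x := z 0 0; pose y := z 0 1.
pose zj (j : nat) : 'rV[C]_2 := row2 (e ^+ j * x) (e ^- j * y).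
have absj j : cabs (e ^+ j) = 1 by rewrite cabsX e1 expr1n.
have absVj j : cabs (e ^- j) = 1 by rewrite cabsV absj invr1.
pose T (q : 'rV[C]_2) := \sum_(a < N) \sum_(b < N) c a b * (q 0 0 ^+ a * q 0 1 ^+ b).
pose E j := (G (zj j) - T (zj j)) * ((e ^+ j * x) ^+ l * (e ^- j * y) ^+ k).
have Ebound j : cabs (E j) <= `|M| * (cabs x ^+ (N + l) * cabs y ^+ k + cabs x ^+ l * cabs y ^+ (N + k)).
  have H : cabs (G (zj j) - T (zj j)) <= M * (cabs x ^+ N + cabs y ^+ N).
    have x1 : cabs (zj j 0 0) = cabs x by rewrite /zj row20 cabsM absj mul1r.
    have y1 : cabs (zj j 0 1) = cabs y by rewrite /zj row21 cabsM absVj mul1r.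
    by have := cM (zj j); rewrite /in_box x1 y1; apply.
  rewrite /E cabsM [cabs (_ ^+ l * _)]cabsM (cabsX _ l) (cabsX _ k).
  rewrite [cabs (e ^+ j * x)]cabsM [cabs (e ^- j * y)]cabsM absj absVj !mul1r.
  apply: (@le_trans _ _ (`|M| * (cabs x ^+ N + cabs y ^+ N) * (cabs x ^+ l * cabs y ^+ k))).
    rewrite ler_wpM2r ?mulr_ge0 ?exprn_ge0 ?cabs_ge0//; apply: le_trans H _.
    by rewrite ler_wpM2r ?ler_norm// addr_ge0 ?exprn_ge0 ?cabs_ge0.
  by rewrite -mulrA ler_wpM2l// !exprD le_eqVlt; apply/orP; left; apply/eqP; ring.
have q0 : n.+1%:R != 0 :> C by rewrite pnatr_eq0.
(* Sum over the orbit of z: the function takes the same value n + 1 times, the noninvariant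
   monomials of the Taylor polynomial cancel, and only the remainders [E j] are left. *)
have key : n.+1%:R * (G z * (x ^+ l * y ^+ k)) =
    n.+1%:R * (\sum_(a < N) \sum_(b < N | a + l == b + k %[mod n.+1]) c a b * (x ^+ (a + l) * y ^+ (b + k)))
    + \sum_(j < n.+1) E j.
  have -> : n.+1%:R * (G z * (x ^+ l * y ^+ k)) =
      \sum_(j < n.+1) (T (zj j) * ((e ^+ j * x) ^+ l * (e ^- j * y) ^+ k) + E j).
    rewrite mulr_natl -[n.+1 in LHS]card_ord -sumr_const; apply: eq_bigr => j _.
    rewrite /E -mulrDl addrC subrK -[RHS](_ : G z * (x ^+ l * y ^+ k) = _)//.
    rewrite -(Ginv (e ^+ j))// -exprM mulnC exprM (prim_expr_order eP) expr1n//.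
  rewrite big_split /=; congr (_ + _).
  rewrite mulr_sumr; under eq_bigr do rewrite /T mulr_suml.
  rewrite exchange_big /=; apply: eq_bigr => a _.
  rewrite mulr_sumr; under eq_bigr do rewrite mulr_suml.
  rewrite exchange_big /= [RHS]big_mkcond /=; apply: eq_bigr => b _.
  transitivity (c a b * (x ^+ (a + l) * y ^+ (b + k)) *
      \sum_(j < n.+1) (e ^+ j) ^+ (a + l) * (e ^- j) ^+ (b + k)).
    rewrite mulr_sumr; apply: eq_bigr => j _; rewrite /zj row20 row21 !exprMn !exprD; ring.
  by rewrite prim_root_sum//; case: ifP => _; rewrite ?mulr0// mulrC.
have -> : G z * (x ^+ l * y ^+ k) =
    (\sum_(a < N) \sum_(b < N | a + l == b + k %[mod n.+1]) c a b * (x ^+ (a + l) * y ^+ (b + k)))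
    + n.+1%:R^-1 * \sum_(j < n.+1) E j.
  by apply: (mulfI q0); rewrite key mulrDr mulrA mulfV// mul1r.
apply: le_trans (cabsD _ _) _; rewrite mulrDr; apply: lerD.
  apply: le_trans (cabs_sum _ _ _) _; rewrite mulr_sumr; apply: ler_sum => a _.
  apply: le_trans (cabs_sum _ _ _) _; rewrite mulr_sumr; apply: ler_sum => b _.
  rewrite cabsM [cabs (_ * y ^+ _)]cabsM !cabsX ler_wpM2r ?mulr_ge0 ?exprn_ge0 ?cabs_ge0//.
  by rewrite le_max cMc.
set B := (_ + _ * _); have B0 : 0 <= B by rewrite addr_ge0 ?mulr_ge0 ?exprn_ge0 ?cabs_ge0.
apply: (@le_trans _ _ (`|M| * B)); last by rewrite ler_wpM2r// le_max lexx orbT.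
rewrite cabsM cabsV cabs_nat mulrC ler_pdivrMr ?ltr0n//.
apply: le_trans (cabs_sum _ _ _) _.
apply: (@le_trans _ _ (\sum_(j < n.+1) `|M| * B)).
  by apply: ler_sum => j _; exact: Ebound.
by rewrite sumr_const card_ord mulr_natr.
Qed.

End Averaging.

(** * Hartogs extension to C^2 and growth of sections *)

Section SectionGrowth.
Variables (R : realType) (n m : nat).
Local Notation C := (Cplx R).
Implicit Types (p z xi : 'rV[C]_2) (i j : 'I_n.+1) (U : set 'rV[C]_3).

(** Where [tau i] is regular. Besides the torus this includes, for the first chart, all points with
    z1 <> 0 and, for the last one, all points with z2 <> 0. *)
Definition tau_dom i z :=
  monomial_dom (n.+1%:Z - i%:Z) (- i%:Z) z /\ monomial_dom (i%:Z - n%:Z) i.+1 z.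

Lemma torus_tau_dom i z : torus z -> tau_dom i z.
Proof. by move=> [z0 z1]; split; split; left. Qed.

Lemma tau_dom_first z : z 0 0 != 0 -> tau_dom ord0 z.
Proof. by move=> z0; split; split; by [left|right]. Qed.

Lemma tau_dom_last z : z 0 1 != 0 -> tau_dom ord_max z.
Proof. by move=> z1; split; split; by [left|right => /=; lia]. Qed.

Lemma diff_tau i z : tau_dom i z -> differentiable (@tau R n i) z /\
  forall xi, 'd (@tau R n i) z xi = row2 (dmonomial (n.+1%:Z - i%:Z) (- i%:Z) z xi)
                                         (dmonomial (i%:Z - n%:Z) i.+1 z xi).
Proof.
move=> [H0 H1]; pose e (k : 'I_2) : int * int :=
  if k == 0 then (n.+1%:Z - i%:Z, - i%:Z) else (i%:Z - n%:Z, i.+1%:Z).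
have [|k|dt dE] := @diff_monomial_map R 2 (@tau R n i) e z.
- by move=> q k; rewrite mxE /e; case: k => [[|[|//]]].
- by case: k => [[|[|//]]].
split=> // xi; apply/rowP => k; rewrite dE mxE /e.
by case: k => [[|[|//]]].
Qed.

Lemma diff_tau_log i z a b : torus z ->
  'd (@tau R n i) z (logvec z a b) = tau_vec i z a b.
Proof.
move=> tz; apply: etrans ((diff_tau (torus_tau_dom i tz)).2 _) _.
case: tz => z0 z1; rewrite /logvec !dmonomial_log// /tau_vec /logvec /tau row20 row21.
by congr row2; congr (_ * _); rewrite /tau_log /= !rmorphB /= ?rmorphN /= -!pmulrn; ring.
Qed.

Lemma monomial_row2_dom (a b c d e f : int) z :
  (z 0 0 != 0 \/ (0 <= c * a /\ 0 <= e * b)) -> (z 0 1 != 0 \/ (0 <= d * a /\ 0 <= f * b)) ->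
  monomial a b (row2 (monomial c d z) (monomial e f z)) =
  monomial (a * c + b * e) (a * d + b * f) z.
Proof.
move=> H0 H1; rewrite /monomial row20 row21 !monomialX.
by apply: monomialM => //; lia.
Qed.

Lemma sigma_tau_dom i z :
  (i = 0%N :> nat /\ z 0 0 != 0) \/ (i = n :> nat /\ z 0 1 != 0) ->
  sigma i (tau i z) = An_smoothing n z.
Proof.
have le_i := le_chart i.
move=> H; rewrite sigmaE smoothingE /tau.
rewrite !monomial_row2_dom; try by case: H => [[i0 z0]|[i_n z1]]; try (by left); right; nia.
by congr row3; congr monomial; case: H => [[i0 _]|[i_n _]]; nia.
Qed.

Lemma sigma_tau_first z : z 0 0 != 0 -> sigma (@ord0 n) (tau (@ord0 n) z) = An_smoothing n z.
Proof. by move=> z0; apply: sigma_tau_dom; left. Qed.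

Lemma sigma_tau_last z : z 0 1 != 0 -> sigma (@ord_max n) (tau (@ord_max n) z) = An_smoothing n z.
Proof. by move=> z1; apply: sigma_tau_dom; right. Qed.

Lemma tau_off_first U z : (0 < n)%N -> z 0 0 != 0 -> U (An_smoothing n z) ->
  resolution_off_exc n U ord0 (tau (@ord0 n) z).
Proof.
move=> n0 z0 Uz; split; first by rewrite /resolution_over /= sigma_tau_first.
move=> /exc_locusP[[_]|[]//]; rewrite row20 => /eqP; apply/negP.
by rewrite /monomial (_ : - (@ord0 n)%:Z = 0)// expr0z mulr1 expfz_neq0.
Qed.

Lemma tau_off_last U z : (0 < n)%N -> z 0 1 != 0 -> U (An_smoothing n z) ->
  resolution_off_exc n U ord_max (tau (@ord_max n) z).
Proof.
move=> n0 z1 Uz; split; first by rewrite /resolution_over /= sigma_tau_last.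
move=> /exc_locusP[[]|[_]]; first by rewrite /= ltnn.
rewrite row21 => /eqP; apply/negP.
by rewrite /monomial (_ : (@ord_max n)%:Z - n%:Z = 0) ?subrr// expr0z mul1r expfz_neq0.
Qed.

Lemma tau_pullback_differentiable U i (w : symdiff R 1) z xi : (0 < n)%N -> open U ->
  holo_symdiff m (resolution_off_exc n U i) w ->
  (\forall q \near z, tau_dom i q) -> resolution_off_exc n U i (tau i z) ->
  differentiable (fun q => pullback (@tau R n i) w q xi) z.
Proof.
move=> n0 oU hw domz offz; have dom_z := nbhs_singleton domz.
apply: (pullback_differentiable (open_resolution_off_exc n0 oU) hw offz (diff_tau dom_z).1) => k.
pose e : int * int := if k == 0 then (n.+1%:Z - i%:Z, - i%:Z) else (i%:Z - n%:Z, i.+1%:Z).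
have de : differentiable (fun q => dmonomial e.1 e.2 q xi) z.
  by apply: dmonomial_differentiable; rewrite /e; case: ifP => _; case: dom_z.
apply: near_eq_differentiable de; apply: filterS domz => q domq.
rewrite (diff_tau domq).2 mxE /e; by case: (k) => [[|[|//]]].
Qed.

Lemma smoothing_box U : open U -> U 0 ->
  exists2 r : R, 0 < r & forall z, in_box r z -> U (An_smoothing n z).
Proof.
move=> oU U0; have pi0 : An_smoothing n (0 : 'rV[C]_2) = 0.
  apply/rowP => k; rewrite !mxE; case: k => [[|[|[|//]]]] lt_k /=;
  by rewrite ?expr0n ?mul0r.
have : U (An_smoothing n (0 : 'rV[C]_2)) by rewrite pi0.
move=> U0'; have : nbhs (0 : 'rV[C]_2) (@An_smoothing R n @^-1` U).
  by apply: (differentiable_continuous (@diff_smoothing R n 0).1); exact: (open_nbhs_nbhs (conj oU U0')).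
move=> /nbhs_row2P[r r0 rP]; exists r => // z [z0 z1].
by have := rP (z 0 0) (z 0 1); rewrite !mxE !subr0 -row2E; apply.
Qed.

(** The pullbacks from the first and the last chart agree on the torus and together cover a
    punctured neighbourhood of 0. [G l] extends the coefficient of dz1^l dz2^(m-l). *)
Lemma hartogs_coefficients U (w : 'I_n.+1 -> symdiff R 1) : (0 < n)%N -> open U -> U 0 ->
  sections m (resolution_off_exc n U) w ->
  exists2 r : R, 0 < r & exists2 G : nat -> 'rV[C]_2 -> C,
    forall l, (l <= m)%N -> box_differentiable r (G l) &
    forall i z a b, torus z -> in_box r z ->
      w i (tau i z) (tau_vec i z a b) = form_val m (G^~ z) (z 0 0 * a) (z 0 1 * b).
Proof.
move=> n0 oU U0 [hw cw].
have [r r0 rU] := smoothing_box oU U0.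
have Ut i z : torus z -> in_box r z -> resolution_off_exc n U i (tau i z).
  by move=> tz zr; apply: torus_off_exc => //; [exact: tau_torus|rewrite sigma_tau//; exact: rU].
(* The coefficient of dz1^l dz2^(m-l) in the pullback from the i-th chart, recovered by
   interpolation. *)
pose f i l z := \sum_j interp R l j * pullback (@tau R n i) (w i) z (row2 (j : 'I_m.+1)%:R 1).
have pullE i z a b : torus z -> pullback (@tau R n i) (w i) z (logvec z a b) = w i (tau i z) (tau_vec i z a b).
  by move=> tz; rewrite /pullback diff_tau_log.
have pull_ij i j z xi : torus z -> in_box r z -> pullback (@tau R n i) (w i) z xi = pullback (@tau R n j) (w j) z xi.
  move=> tz zr; rewrite (torus_vec xi tz) !pullE//.
  have := cw i j (tau i z) (tau_vec i z (xi 0 0 / z 0 0) (xi 0 1 / z 0 1)) (Ut i z tz zr) (torus_overlap _ _ (tau_torus i tz)).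
  by rewrite /pullback transition_tau// diff_transition_tau.
have f_ij i j l z : torus z -> in_box r z -> f i l z = f j l z.
  by move=> tz zr; apply: eq_bigr => k _; rewrite (pull_ij i j).
have fd i l z : (\forall q \near z, tau_dom i q) -> resolution_off_exc n U i (tau i z) -> differentiable (f i l) z.
  move=> domz offz; apply: dfun_sum => k _; apply: dfunM; first exact: dfun_cst.
  exact: (tau_pullback_differentiable _ n0 oU (hw i) domz offz).
have fd0 l z : z 0 0 != 0 -> in_box r z -> differentiable (f ord0 l) z.
  move=> z0 zr; apply: fd; last by apply: tau_off_first => //; exact: rU.
  by apply: filterS (near_coord_neq0 z0) => q; exact: tau_dom_first.
have fdn l z : z 0 1 != 0 -> in_box r z -> differentiable (f ord_max l) z.
  move=> z1 zr; apply: fd; last by apply: tau_off_last => //; exact: rU.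
  by apply: filterS (near_coord_neq0 z1) => q; exact: tau_dom_last.
have inb u v : cabs u < r -> cabs v < r -> in_box r (row2 u v) by rewrite /in_box row20 row21.
have c0r : cabs (0 : C) < r by rewrite cabs0.
pose P l (t : R) := exists2 H, box_differentiable t H &
  forall z, torus z -> in_box t z -> in_box r z -> H z = f ord0 l z.
have [|l _|t /andP[t0 tr] tP] := @finite_radius R m.+1 P r r0.
- by move=> l x y xy [H dH HE]; exists H; [exact: box_differentiable_le xy dH|
    move=> z tz [z0 z1]; apply: HE => //; split; exact: lt_le_trans xy].
- have [||u u0|H [s /andP[s0 _] HP]] := @removable_cross R (f ord0 l) 0 0 r r0.
  + by move=> u v; rewrite !subr0 => ur vr u0 v0; apply: fd0; [rewrite row20|exact: inb].
  + move=> v v0; rewrite subr0 => vr.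
    have dfv : differentiable (fun u : C => f ord_max l (row2 u v)) 0.
      by apply: differentiable_slice1; apply: fdn; [rewrite row21|exact: inb].
    have [d d0 [M FM]] := continuous_bounded_near (differentiable_continuous dfv).
    exists (Num.min d r); first by rewrite lt_min d0.
    exists M => u u0; rewrite subr0 lt_min => /andP[ud ur].
    rewrite (f_ij _ ord_max); [by apply: FM; rewrite subr0|by split; rewrite ?row20 ?row21|exact: inb].
  + rewrite subr0 => ur; have dfu : differentiable (fun v : C => f ord0 l (row2 u v)) 0.
      by apply: differentiable_slice2; apply: fd0; [rewrite row20|exact: inb].
    have [d d0 [M FM]] := continuous_bounded_near (differentiable_continuous dfu).
    by exists d => //; exists M => v _; exact: FM.
  exists s => //; exists H => [z [z0 z1]|z [z0 z1] [zs0 zs1] _].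
    have := HP (z 0 0) (z 0 1); rewrite !subr0 -row2E => /(_ z0 z1)[d _].
    exact: d.
  by have := HP (z 0 0) (z 0 1); rewrite !subr0 -row2E => /(_ zs0 zs1)[_]; apply.
have /choice[G GP] (l : nat) : exists H, (l < m.+1)%N -> box_differentiable t H /\
    forall z, torus z -> in_box t z -> in_box r z -> H z = f ord0 l z.
  have [lm|] := boolP (l < m.+1)%N; last by exists (fun=> 0).
  by have [H dH HE] := tP l lm; exists H.
exists t => //; exists G => [l lm|i z a b tz zt]; first by case: (GP l lm).
have zr : in_box r z by case: zt => ? ?; split; exact: lt_le_trans tr.
rewrite -pullE// (pull_ij i ord0)//.
have [c cE] := pullback_form (hw ord0) (Ut ord0 z tz zr).
rewrite /logvec cE; apply: eq_bigr => l _; congr (_ * _).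
have lm : (l <= m)%N by rewrite -ltnS.
have [_ ->] := GP l (ltn_ord l); rewrite // (interpE c lm) /f.
by apply: eq_bigr => k _; rewrite -cE.
Qed.

Lemma monomial_scale (c d : int) (e : C) z : e != 0 ->
  monomial c d (row2 (e * z 0 0) (e^-1 * z 0 1)) = e ^ (c - d) * monomial c d z.
Proof.
move=> e0; rewrite /monomial row20 row21 (expfzMl e) (expfzMl e^-1) exprz_inv.
by rewrite (expfzDr _ _ e0) mulrACA.
Qed.

(** The exponents in the bound of [invariant_bound] with k = m - l: the invariant monomials, then
    the two remainder terms. *)
Definition growth_exponents l N : seq (nat * nat) :=
  [seq e <- [seq ((a + l)%N, (b + (m - l))%N) | a <- index_iota 0 N, b <- index_iota 0 N] |
     e.1 == e.2 %[mod n.+1]] ++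
  [:: ((N + l)%N, (m - l)%N); (l, (N + (m - l))%N)].

Lemma big_growth_exponents l N (F : nat -> nat -> R) :
  \sum_(e <- growth_exponents l N) F e.1 e.2 =
  \sum_(a < N) \sum_(b < N | a + l == b + (m - l) %[mod n.+1]) F (a + l)%N (b + (m - l))%N +
  (F (N + l)%N (m - l)%N + F l (N + (m - l))%N).
Proof.
rewrite /growth_exponents big_cat big_filter big_mkcond big_allpairs_dep /=.
rewrite !big_cons big_nil addr0; congr (_ + _).
rewrite big_mkord; apply: eq_bigr => a _.
by rewrite big_mkord -big_mkcond.
Qed.

(** An invariant monomial here has total degree at least m, so [max_mult_lower] applies on both
    curves of the chart. For the remainder terms N = (n + 1) (d + d') is large enough by itself. *)
Lemma growth_exponents_dominated i (d d' : nat) l N : (l <= m)%N ->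
  (d = if (i < n)%N then max_mult n m i else 0%N) ->
  (d' = if (0 < i)%N then max_mult n m i.-1 else 0%N) ->
  N = (n.+1 * (d + d'))%N ->
  forall e, e \in growth_exponents l N -> dominates i d d' e.
Proof.
move=> lm dE d'E NE e; have le_i := le_chart i; rewrite mem_cat => /orP[|].
  rewrite mem_filter => /andP[/eqP eqe /allpairsP[[a b] /= [_ _ eE]]].
  have me : (m <= e.1 + e.2)%N by rewrite eE /=; lia.
  split; first by rewrite dE; case: ifP => [lt_in|]; [exact: max_mult_lower|rewrite muln0].
  rewrite d'E; case: ifP => [i0|]; last by rewrite muln0.
  have := @max_mult_lower n m e.1 e.2 i.-1; rewrite prednK//.
  rewrite (_ : (n - i.-1 = n.+1 - i)%N); last by lia.
  by apply=> //; lia.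
have H0 : (n.+1 * d <= N * i.+1)%N by rewrite NE mulnDr; nia.
have H1 : (n.+1 * d' <= N * i)%N.
  have [i0|i0] := posnP i; last by rewrite NE; nia.
  by rewrite (_ : d' = 0%N) ?muln0// d'E i0.
have H2 : (n.+1 * d <= N * (n - i))%N.
  have [lt_in|ge_in] := ltnP i n; first by rewrite NE; have : (0 < n - i)%N by [lia]; nia.
  by rewrite (_ : d = 0%N) ?muln0// dE ltnNge ge_in.
have H3 : (n.+1 * d' <= N * (n.+1 - i))%N.
  by rewrite NE; have : (0 < n.+1 - i)%N by [lia]; nia.
rewrite !inE => /orP[|] /eqP -> /=; rewrite /dominates /= ![((N + _) * _)%N]mulnDl; split.
- by apply: leq_trans H0 _; rewrite -addnA leq_addr.
- by apply: leq_trans H1 _; rewrite -addnA leq_addr.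
- by apply: leq_trans H2 _; rewrite addnCA leq_addr.
- by apply: leq_trans H3 _; rewrite addnCA leq_addr.
Qed.

(** The crucial estimate: the coefficients on C^2 are invariant up to the action on dz1, dz2, so
    only invariant monomials and a high-order remainder contribute, and all of them vanish on the
    curves to the orders wanted. *)
Lemma section_log_growth U (w : 'I_n.+1 -> symdiff R 1) i p0 : (0 < n)%N -> open U -> U 0 ->
  sections m (resolution_off_exc n U) w -> exc_locus i p0 ->
  log_growth i (if (i < n)%N then max_mult n m i else 0%N)
               (if (0 < i)%N then max_mult n m i.-1 else 0%N) (w i) p0.
Proof.
move=> n0 oU U0 sw Ep0; set d := if _ then _ else _; set d' := if (0 < i)%N then _ else _.
have [r r0 [G dG wG]] := hartogs_coefficients n0 oU U0 sw.
pose N := (n.+1 * (d + d'))%N.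
have Ginv l e z : (l <= m)%N -> e ^+ n.+1 = 1 -> torus z -> in_box r z ->
    G l (row2 (e * z 0 0) (e^-1 * z 0 1)) * ((e * z 0 0) ^+ l * (e^-1 * z 0 1) ^+ (m - l)) =
    G l z * (z 0 0 ^+ l * z 0 1 ^+ (m - l)).
  move=> lm en [z0 z1] [zr0 zr1]; set ez := row2 _ _.
  have e0 : e != 0 by apply/eqP => e0; move/eqP: en; rewrite e0 expr0n eq_sym oner_eq0.
  have e1 : cabs e = 1 by apply/eqP; rewrite -(pexpr_eq1 (ltn0Sn n)) ?cabs_ge0// -cabsX en cabs1.
  have tez : torus ez by split; rewrite ?row20 ?row21 mulf_neq0 ?invr_eq0.
  have ezr : in_box r ez by split; rewrite ?row20 ?row21 cabsM ?cabsV e1 ?invr1 mul1r.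
  have enz : e ^ n.+1%:Z = 1 by exact: en.
  (* In both coordinates of [tau j] the difference of the exponents of z1 and z2 is n + 1 up to
     sign, so the group acts trivially. *)
  have tauE j : tau j ez = tau j z.
    have scale (x y : int) : monomial x y ez = e ^ (x - y) * monomial x y z.
      exact: monomial_scale.
    rewrite /tau !scale (_ : _ - - _ = n.+1%:Z); last by lia.
    rewrite (_ : _ - _ - _ = - n.+1%:Z); last by lia.
    by rewrite -exprnN en invr1 enz !mul1r.
  have H x y : form_val m (fun l => G l ez * ((e * z 0 0) ^+ l * (e^-1 * z 0 1) ^+ (m - l))) x y =
               form_val m (fun l => G l z * (z 0 0 ^+ l * z 0 1 ^+ (m - l))) x y.
    rewrite -!form_val_scale -(wG ord0 z x y (conj z0 z1) (conj zr0 zr1)).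
    by have := wG ord0 ez x y tez ezr; rewrite /tau_vec tauE /ez row20 row21 => E; exact: esym E.
  exact: form_val_inj H l lm.
pose P l (t : R) := exists M : R, forall z, torus z -> in_box t z ->
    cabs (G l z * (z 0 0 ^+ l * z 0 1 ^+ (m - l))) <=
    M * \sum_(e <- growth_exponents l N) cabs (z 0 0) ^+ e.1 * cabs (z 0 1) ^+ e.2.
have [||t /andP[t0 tr] tP] := @finite_radius R m.+1 P r r0.
- move=> l x y xy [M HM]; exists M => z tz [z0 z1].
  by apply: HM => //; split; exact: lt_le_trans xy.
- move=> l lm; have [s /andP[s0 _] [M MP]] := invariant_bound N r0 (dG l lm) (fun e z => Ginv l e z lm).
  exists s => //; exists M => z tz zs; apply: le_trans (MP z tz zs) _.
  by rewrite -(big_growth_exponents l N (fun a b => cabs (z 0 0) ^+ a * cabs (z 0 1) ^+ b)).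
have /choice[M MP] (l : nat) : exists M : R, (l <= m)%N -> forall z, torus z -> in_box t z ->
    cabs (G l z * (z 0 0 ^+ l * z 0 1 ^+ (m - l))) <=
    M * \sum_(e <- growth_exponents l N) cabs (z 0 0) ^+ e.1 * cabs (z 0 1) ^+ e.2.
  have [lm|lm] := boolP (l <= m)%N; last by exists 0.
  by have [M HM] := tP l lm; exists M.
apply: (@log_growth_of_bound R n m i d d' (w i) G (growth_exponents^~ N) M t p0 n0 t0) => //.
- move=> z a b tz [z0 z1]; apply: wG => //; split; exact: lt_le_trans tr.
- by move=> l e lm; apply: growth_exponents_dominated.
- by move=> l z lm; exact: MP.
Qed.

End SectionGrowth.

(** * Comparison of holomorphic and logarithmic sections *)

Section LogSections.
Variables (R : realType) (n m : nat).
Local Notation C := (Cplx R).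
Implicit Types (p z xi : 'rV[C]_2) (i j : 'I_n.+1) (U : set 'rV[C]_3) (D : exc_divisor n).

Lemma div_mult_max k : div_mult (max_divisor n m) k =
  (if (k < n)%N then max_mult n m k else 0%N)%:Z.
Proof.
case: ifPn => [kn|]; last by rewrite -leqNgt => /div_mult_out ->.
by rewrite -[k]/(val (Ordinal kn)) div_multE max_divisorE.
Qed.

Lemma sections_log_sections U (w : 'I_n.+1 -> symdiff R 1) : (0 < n)%N -> open U -> U 0 ->
  sections m (resolution_off_exc n U) w -> log_sections m (max_divisor n m) U w.
Proof.
move=> n0 oU U0 sw; split; last by case: sw.
move=> i; have le_i := le_chart i.
pose d := if (i < n)%N then max_mult n m i else 0%N.
pose d' := if (0 < i)%N then max_mult n m i.-1 else 0%N.
have [||||f fh fE] := @log_extension R n m U i (w i) d d' n0 oU U0.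
- by rewrite /d => ->; rewrite ltnn.
- by rewrite /d' => ->.
- by case: sw.
- move=> p0; exact: (section_log_growth n0 oU U0 sw).
exists f => // p xi offp; rewrite fE// divisor_eqE; congr (_ * _); rewrite div_mult_max.
congr (_ * _); rewrite /d'; case: (i : nat) le_i => [|k] le_k; first by rewrite expr0z expr0.
by rewrite div_mult_max le_k.
Qed.

Lemma log_coframe_row2 i p x y : (log_coframe i p (row2 x y) 0 = (if (i < n)%N then (p 0 0)^-1 else 1) * x) *
  (log_coframe i p (row2 x y) 1 = (if (0 < i)%N then (p 0 1)^-1 else 1) * y).
Proof.
rewrite /log_coframe /= row20 row21; split; case: ifP => _; by rewrite ?mul1r// mulrC.
Qed.

(** Off E the local equation of any [D] and the denominators of the coframe are invertible. *)
Lemma log_sections_sections U D (w : 'I_n.+1 -> symdiff R 1) : (0 < n)%N -> open U ->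
  log_sections m D U w -> sections m (resolution_off_exc n U) w.
Proof.
move=> n0 oU [hw cw]; split=> // i; have [f fh fE] := hw i.
apply/(holo_symdiffP _ _ (open_resolution_off_exc n0 oU)).
have wE p x y : resolution_off_exc n U i p -> w i p (row2 x y) =
    form_val m (fun l => divisor_eq D i p * (f (mono_exp m l) p *
      ((if (i < n)%N then (p 0 0)^-1 else 1) ^+ l *
       (if (0 < i)%N then (p 0 1)^-1 else 1) ^+ (m - l)))) x y.
  by move=> offp; rewrite fE// symform2E !log_coframe_row2 form_val_scale form_valZ.
split=> [p offp|p xi offp]; first by eexists => x y; exact: wE.
pose g q := form_val m (fun l => divisor_eq D i q * (f (mono_exp m l) q *
      ((if (i < n)%N then (q 0 0)^-1 else 1) ^+ l *
       (if (0 < i)%N then (q 0 1)^-1 else 1) ^+ (m - l)))) (xi 0 0) (xi 0 1).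
suff dg : differentiable g p.
  apply: near_eq_differentiable dg.
  have := open_nbhs_nbhs (conj (@open_resolution_off_exc R n U i n0 oU) offp).
  by apply: filterS => q offq; rewrite /g -wE// -row2E.
have [Up p0 p1] := (off_excP _ _ _).1 offp.
apply: dfun_sum => l _; apply: dfunM; last exact: dfun_cst.
apply: dfunM.
  pose e : int * int := (div_mult D i, if (i : nat) is k.+1 then div_mult D k else 0).
  have -> : @divisor_eq R n D i = @monomial R e.1 e.2 by apply/funext => q; exact: divisor_eqE.
  apply: (has_diff_monomial _).1; split; rewrite /e /=.
    by have [/p0|/div_mult_out ->] := ltnP i n; [left|right].
  by case: (i : nat) p1 => [|k] p1; [right|left; exact: p1].
apply: dfunM; first by apply: fh; case: offp.
apply: dfunM; apply: dfunX.
  case: (i < n)%N p0 => /= p0; last exact: dfun_cst.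
  by apply: dfunV; [exact: (p0 isT)|exact: differentiable_coord].
case: (0 < i)%N p1 => /= p1; last exact: dfun_cst.
by apply: dfunV; [exact: (p1 isT)|exact: differentiable_coord].
Qed.

End LogSections.

(** * Maximality *)

Section Maximality.
Variables (R : realType) (n m : nat).
Local Notation C := (Cplx R).
Implicit Types (p z xi : 'rV[C]_2) (i j : 'I_n.+1) (U : set 'rV[C]_3) (D : exc_divisor n).

Lemma pullback_transition_id i (w : symdiff R 1) p xi :
  pullback (transition i i) w p xi = w p xi.
Proof.
rewrite /pullback (_ : transition i i = id); last by apply/funext => q; exact: transition_id.
congr w; exact: (congr1 (fun h => h xi) (@diff_val _ _ _ _ _ _ id (is_diff_id p))).
Qed.

(** Being in the overlap of two distinct charts makes one coordinate nonzero; the zero line of the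
    other is exceptional, so being off E excludes it. Compatibility off E therefore need only be
    checked on the torus. *)
Lemma overlap_off_exc i j U p : i != j -> resolution_off_exc n U i p -> overlap i j p -> torus p.
Proof.
move=> ij /off_excP[_ p0 p1] [/= o0 o1].
have := le_chart j; have := le_chart i.
have [lt_ij|lt_ji|/val_inj E] := ltngtP i j => le_i le_j; last by move: ij; rewrite E eqxx.
  by split; [apply: p0; lia|apply: o1; rewrite lt_ij].
by split; [apply: o0; rewrite lt_ji|apply: p1; lia].
Qed.

Lemma compatible_off_exc U (w : 'I_n.+1 -> symdiff R 1) :
  (forall i j p xi, torus p -> U (sigma i p) ->
     w i p xi = pullback (transition i j) (w j) p xi) ->
  compatible (resolution_off_exc n U) w.
Proof.
move=> wt i j p xi offp ov; have [<-|ij] := eqVneq i j.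
  by rewrite pullback_transition_id.
apply: (wt _ _ _ _ (overlap_off_exc ij offp ov)); by case: offp.
Qed.

Variables (T B : int) (k : nat).

Definition toric_fst i p xi : C :=
  i.+1%:R * (if (0 < i)%N then p 0 1 else 1) * xi 0 0 + i%:R * p 0 0 * xi 0 1.

Definition toric_snd i p xi : C :=
  (n - i)%:R * p 0 1 * xi 0 0 + (n.+1 - i)%:R * (if (i < n)%N then p 0 0 else 1) * xi 0 1.

(* The form z1^A z2^B (dz1/z1)^k (dz2/z2)^(m-k), A = B + (n+1) T, up to a      *)
(* constant factor; the linear factors have been cleared of denominators.      *)
Definition toric_section i : symdiff R 1 := fun p xi =>
  monomial (B + i.+1%:Z * T - (k + (i < n) * (m - k))%N%:Z)
           (B + i%:Z * T - ((0 < i) * k + (m - k))%N%:Z) p *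
  (toric_fst i p xi ^+ k * toric_snd i p xi ^+ (m - k)).

Lemma toric_section_log i p a b : torus p ->
  toric_section i p (logvec p a b) = monomial (B + i.+1%:Z * T) (B + i%:Z * T) p *
    ((i.+1%:R * a + i%:R * b) ^+ k * ((n - i)%:R * a + (n.+1 - i)%:R * b) ^+ (m - k)).
Proof.
move=> [p0 p1]; rewrite /toric_section.
have -> : toric_fst i p (logvec p a b) = p 0 0 * p 0 1 ^+ (0 < i)%N * (i.+1%:R * a + i%:R * b).
  rewrite /toric_fst row20 row21; case: (posnP i) => [->|i0] /=; rewrite ?expr0 ?expr1; ring.
have -> : toric_snd i p (logvec p a b) = p 0 0 ^+ (i < n)%N * p 0 1 * ((n - i)%:R * a + (n.+1 - i)%:R * b).
  rewrite /toric_snd row20 row21; case: (ltnP i n) => [lt_in|ge_in] /=; rewrite ?expr0 ?expr1; first by ring.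
  by rewrite (_ : (n - i = 0)%N); [ring|lia].
rewrite !exprMn -!exprM /monomial !expfzDr// -!exprnN !exprD.
move: (p 0 0 ^ B) (p 0 1 ^ B) (p 0 0 ^ (_ * T)) (p 0 1 ^ (_ * T)) => x1 x2 x3 x4.
by field; rewrite !expf_neq0.
Qed.

(** The bounds on the exponents are conditions along the two coordinate lines that are not
    exceptional: u = 0 in the last chart needs k <= A, and v = 0 in the first needs m - k <= B.
    Every other coordinate is invertible off E. Compatibility holds because the form comes from
    C^2. *)
Lemma toric_section_sections U : (0 < n)%N -> open U -> (k <= m)%N ->
  k%:Z <= B + n.+1%:Z * T -> (m - k)%N%:Z <= B ->
  sections m (resolution_off_exc n U) toric_section.
Proof.
move=> n0 oU km kA kB; split; last first.
  apply: compatible_off_exc => i j p xi tp Up.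
  have [a [b ->]] : exists a b, xi = logvec p a b by do 2!eexists; exact: torus_vec.
  rewrite /pullback.
  have H := diff_transition_log i j a b tp.
  have tt : torus (transition i j p).
    by rewrite /torus /= row20 row21; split; exact: monomial_neq0.
  rewrite H.
  apply: etrans (toric_section_log i a b tp) _.
  apply: etrans _ (esym (toric_section_log j _ _ tt)); congr (_ * _).
    rewrite /transition -/(monomial _ _ _) -/(monomial _ _ _) monomial_row2//.
    by congr monomial; ring.
  have := le_chart i; have := le_chart j => le_j le_i.
  rewrite !natrB ?leqW// !rmorphB /= -!pmulrn.
  by congr (_ ^+ _ * _ ^+ _); rewrite -!natr1; ring.
move=> i; have le_i := le_chart i.
apply/(holo_symdiffP _ _ (open_resolution_off_exc n0 oU)); split=> [p offp|p xi offp].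
  apply: is_formZ; rewrite -{1}(subnKC km).
  have := is_form_linX k (i.+1%:R * (if (0 < i)%N then p 0 1 else 1)) (i%:R * p 0 0)
    (is_form_linX (m - k) ((n - i)%:R * p 0 1) ((n.+1 - i)%:R * (if (i < n)%N then p 0 0 else 1)) (@is_form1 R)).
  rewrite addn0; apply: is_form_ext => x y.
  by rewrite mulr1 /toric_fst /toric_snd !row20 !row21.
have [_ p0 p1] := (off_excP _ _ _).1 offp.
have dc (l : 'I_2) : differentiable (fun q : 'rV[C]_2 => q 0 l : C) p by exact: differentiable_coord.
apply: dfunM.
  apply: (has_diff_monomial _).1; split.
    have [/p0|ge_in] := ltnP i n; [by left|right].
    have -> : i = n :> nat by lia.
    by lia.
  have [i0|/p1] := posnP i; [right|by left].
  by rewrite i0; lia.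
apply: dfunM; apply: dfunX; apply: dfunD; apply: dfunM; try exact: dfun_cst.
- apply: dfunM; first exact: dfun_cst.
  by case: (0 < i)%N; [exact: dc|exact: dfun_cst].
- by apply: dfunM; [exact: dfun_cst|exact: dc].
- by apply: dfunM; [exact: dfun_cst|exact: dc].
- apply: dfunM; first exact: dfun_cst.
  by case: (i < n)%N; [exact: dc|exact: dfun_cst].
Qed.

(** On the curve's transversal v = 1 in chart r, the coefficient of (du/u)^m is exactly a nonzero
    constant times u^(B + (r+1) T). A larger multiplicity of [D] would make this constant equal to a
    positive power of u times a bounded function. *)
Lemma toric_section_div_le U D (r : 'I_n) : open U -> U 0 ->
  log_sections m D U toric_section -> D r <= B + r.+1%:Z * T.
Proof.
move=> oU U0 [hs _]; have n0 : (0 < n)%N by apply: leq_ltn_trans (ltn_ord r).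
have rn : (r < n.+1)%N := ltnW (ltn_ord r).
pose i : 'I_n.+1 := Ordinal rn; have lt_in : (i < n)%N := ltn_ord r.
have [f fh fE] := hs i; rewrite leNgt; apply/negP => ltD.
have [N NE] : exists N : nat, D r = B + r.+1%:Z * T + N.+1%:Z.
  by exists (absz (D r - (B + r.+1%:Z * T) - 1)%R); lia.
pose p0 : 'rV[C]_2 := row2 0 1.
have Ep0 : exc_locus i p0 by apply/exc_locusP; left; rewrite row20.
have Up0 : resolution_over n U i p0.
  by rewrite /resolution_over /=; move: Ep0; rewrite exc_locusE// => /= ->.
pose kap : C := i.+1%:R ^+ k * (n - i)%:R ^+ (m - k).
have kap0 : kap != 0.
  by rewrite mulf_neq0// expf_neq0// pnatr_eq0// subn_eq0 -ltnNge.
have [d d0 dP] := (nbhs_row2P _ _).1 (open_nbhs_nbhs (conj (open_resolution_over (i := i) oU) Up0)).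
have [e e0 [M FM]] := continuous_bounded_near (differentiable_continuous
  (differentiable_slice1 (fh (mono_exp m m) _ Up0))).
have key (u : C) : u != 0 -> cabs u < Num.min d (Num.min e 1) -> cabs kap <= cabs u * M.
  move=> u0; rewrite !lt_min => /and3P[ud ue u1].
  pose p : 'rV[C]_2 := row2 u 1.
  have tp : torus p by rewrite /torus /= row20 row21 oner_eq0.
  have offp : resolution_off_exc n U i p.
    apply: (torus_off_exc n0 tp); apply: dP; rewrite /p0 ?row20 ?row21 ?subr0 ?subrr ?cabs0//.
  (* On this vector the coframe takes the values 1 and 0, so only the coefficient of index
     [mono_exp m m] survives. *)
  have := fE p (logvec p 1 0) offp; rewrite toric_section_log// divisor_eqE symform2E.
  have -> : log_coframe i p (logvec p 1 0) 0 = 1.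
    by rewrite /log_coframe /= lt_in !row20 mulr1 divff.
  have -> : log_coframe i p (logvec p 1 0) 1 = 0.
    by rewrite /log_coframe /= row21 mulr0 mul0r; case: ifP.
  rewrite /form_val big_ord_recr /= big1 ?add0r; last first.
    move=> l _; rewrite [X in _ * X](_ : _ = 0) ?mulr0// expr0n subn_eq0.
    by rewrite leqNgt ltn_ord mulr0.
  rewrite subnn !expr1n expr0 !mulr1 !mulr0 !addr0 /monomial /p !row20 !row21 !exp1rz !mulr1.
  rewrite div_multE NE (expfzDr _ N.+1%:Z u0) -[X in _ = X -> _]mulrA => E; have {E} := mulfI (expfz_neq0 _ u0) E.
  rewrite -[_ ^+ k * _]/kap => ->.
  rewrite -exprnP exprS !cabsM -mulrA ler_wpM2l ?cabs_ge0// cabsX.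
  apply: (@le_trans _ _ (1 * cabs (f (mono_exp m m) (row2 u 1)))); first by rewrite ler_wpM2r ?cabs_ge0// exprn_ile1 ?cabs_ge0// ltW.
  by rewrite mul1r; apply: FM; rewrite subr0.
have kap_gt0 : 0 < cabs kap by rewrite cabs_gt0.
pose t : R := Num.min (Num.min d (Num.min e 1)) (cabs kap / (`|M| + 1)) / 2.
have M1 : 0 < `|M| + 1 by rewrite ltr_wpDl.
have t0 : 0 < t by rewrite divr_gt0// !lt_min d0 e0 ltr01 divr_gt0.
have t2 : t < Num.min (Num.min d (Num.min e 1)) (cabs kap / (`|M| + 1)).
  by rewrite /t in t0 *; lra.
have ct : cabs (t%:C%C : C) = t by rewrite cabs_real gtr0_norm.
move: t2; rewrite lt_min => /andP[tmin tk].
have := key (t%:C%C : C); rewrite ct => H.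
have {}H : cabs kap <= t * M by apply: H; [apply/eqP => t00; move: t0; rewrite -ct t00 cabs0 ltxx|exact: tmin].
move: tk; rewrite ltr_pdivlMr// => tk.
have : t * M <= t * `|M| by rewrite ler_wpM2l ?ler_norm// ltW.
by lra.
Qed.

End Maximality.

(** For each curve, test [D] on the toric section whose monomial has the least order on that
    curve. *)
Lemma log_sections_maximal (R : realType) (n m : nat) (U : set 'rV[Cplx R]_3) (D : exc_divisor n) :
  open U -> U 0 ->
  sections m (resolution_off_exc n U) = log_sections m D U ->
  forall r : 'I_n, D r <= max_divisor n m r.
Proof.
move=> oU U0 E r; have n0 : (0 < n)%N by apply: leq_ltn_trans (ltn_ord r).
rewrite max_divisorE; have [A [B [k [km kA kB AB ABE]]]] := max_mult_attained m (ltn_ord r).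
have [T AE] : exists T : int, A%:Z = B%:Z + n.+1%:Z * T.
  exists ((A %/ n.+1)%:Z - (B %/ n.+1)%:Z).
  by have := divn_eq A n.+1; have := divn_eq B n.+1; nia.
have : sections m (resolution_off_exc n U) (@toric_section R n m T B k).
  by apply: toric_section_sections => //; lia.
rewrite E => /(toric_section_div_le r oU U0) /le_trans; apply.
have : n.+1%:Z * (B%:Z + r.+1%:Z * T) = n.+1%:Z * (max_mult n m r)%:Z.
  rewrite -PoszM -ABE PoszD !PoszM AE -subzn ?(ltnW (ltn_ord r))//.
  by ring.
have q0 : n.+1%:Z != 0 by [].
by move/(mulfI q0) => ->.
Qed.

(** * Vanishing order *)

Section VanishingOrder.
Variable R : realType.
Local Notation C := (Cplx R).
Implicit Types (f g : 'rV[C]_2 -> C) (z : 'rV[C]_2).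

(** The estimate f = O(|z|^N), the form in which membership in the N-th power of the maximal ideal
    is used. *)
Definition near_order (N : nat) f := exists M : R,
  nbhs (0 : 'rV[C]_2) (fun z => cabs (f z) <= M * (cabs (z 0 0) + cabs (z 0 1)) ^+ N).

Lemma near_order_ge0 N f : near_order N f -> exists2 M : R, 0 <= M &
  nbhs (0 : 'rV[C]_2) (fun z => cabs (f z) <= M * (cabs (z 0 0) + cabs (z 0 1)) ^+ N).
Proof.
move=> [M MP]; exists `|M| => //; apply: filterS MP => z /le_trans; apply.
by rewrite ler_wpM2r ?ler_norm// exprn_ge0// addr_ge0 ?cabs_ge0.
Qed.

Lemma near_orderM N N' f g : near_order N f -> near_order N' g ->
  near_order (N + N') (fun z => f z * g z).
Proof.
move=> /near_order_ge0[M M0 Mf] /near_order_ge0[M' M'0 Mg]; exists (M * M').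
apply: filterS2 Mf Mg => z Hf Hg; rewrite cabsM exprD mulrACA.
by rewrite ler_pM ?cabs_ge0.
Qed.

Lemma near_orderD N f g : near_order N f -> near_order N g ->
  near_order N (fun z => f z + g z).
Proof.
move=> [M Mf] [M' Mg]; exists (M + M').
by apply: filterS2 Mf Mg => z Hf Hg; rewrite mulrDl (le_trans (cabsD _ _))// lerD.
Qed.

Lemma near_order_sum N (I : Type) (r : seq I) (F : I -> 'rV[C]_2 -> C) :
  (forall i, near_order N (F i)) -> near_order N (fun z => \sum_(i <- r) F i z).
Proof.
move=> FN; elim: r => [|i r IH].
  by exists 0; apply/nbhs_row2P; exists 1 => // u v _ _; rewrite big_nil cabs0 mul0r.
have [M MP] := near_orderD (FN i) IH.
by exists M; apply: filterS MP => z; rewrite big_cons.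
Qed.

Lemma near_order_prod (I : Type) (r : seq I) (F : I -> 'rV[C]_2 -> C) :
  (forall i, near_order 1 (F i)) -> near_order (size r) (fun z => \prod_(i <- r) F i z).
Proof.
move=> FN; elim: r => [|i r IH].
  by exists 1; apply/nbhs_row2P; exists 1 => // u v _ _; rewrite big_nil cabs1 mul1r.
have [M MP] := near_orderM (FN i) IH.
by exists M; apply: filterS MP => z; rewrite big_cons.
Qed.

Lemma near_order_holo f : holo_germ f -> near_order 0 f.
Proof.
move=> /nbhs_singleton/differentiable_continuous/cvgrPdist_le/(_ 1 ltr01) H.
exists (cabs (f 0) + 1); apply: filterS H => z /=.
rewrite -[1]/(1%:C%C : C) -cabs_leE cabsB expr0 mulr1 => H.
by rewrite -[f z](subrK (f 0)) addrC (le_trans (cabsD _ _))// lerD2l.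
Qed.

Lemma near_order_max_ideal f : max_ideal f -> near_order 1 f.
Proof.
move=> [/nbhs_singleton/differentiable_epsP[df [_ dfE]] f0].
exists (1 + cabs (df (row2 1 0)) + cabs (df (row2 0 1))).
have H : nbhs (0 : 'rV[C]_2) (fun z => `|f z - f 0 - df (z - 0)| <= 1 * `|z - 0|) := dfE 1 ltr01.
apply: filterS H => z; rewrite f0 !subr0 mul1r expr1 => H.
have zE : z = z 0 0 *: row2 1 0 + z 0 1 *: row2 0 1.
  by rewrite !row2Z row2D !mulr1 !mulr0 addr0 add0r -row2E.
have dfz : df z = z 0 0 * df (row2 1 0) + z 0 1 * df (row2 0 1).
  by rewrite {1}zE linearD !linearZ.
have {}H : cabs (f z - df z) <= cabs (z 0 0) + cabs (z 0 1).
  rewrite cabs_leE; apply: le_trans H _; rewrite {1}(row2E z).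
  by apply: row2_norm_le; rewrite -cabs_leE ?lerDl ?lerDr cabs_ge0.
rewrite -[f z](subrK (df z)) (le_trans (cabsD _ _))//.
have : cabs (df z) <= cabs (z 0 0) * cabs (df (row2 1 0)) + cabs (z 0 1) * cabs (df (row2 0 1)).
  by rewrite dfz (le_trans (cabsD _ _))// !cabsM.
move: H (cabs_ge0 (z 0 0)) (cabs_ge0 (z 0 1)) (cabs_ge0 (df (row2 1 0))) (cabs_ge0 (df (row2 0 1))).
move: (cabs (f z - df z)) (cabs (df z)) (cabs (z 0 0)) (cabs (z 0 1)) => a b x y.
move: (cabs _) (cabs _) => c d H x0 y0 c0 d0 H'.
have := mulr_ge0 x0 d0; have := mulr_ge0 y0 c0; lra.
Qed.

Lemma near_order_max_ideal_pow N f : max_ideal_pow N f -> near_order N f.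
Proof.
move=> [k [h [g [hh gg fE]]]].
have [M MP] : near_order N (fun z => \sum_a h a z * \prod_b g a b z).
  apply: near_order_sum => a; apply: (@near_orderM 0 N).
    exact: near_order_holo.
  have := near_order_prod (index_enum 'I_N) (fun b => near_order_max_ideal (gg a b)).
  by rewrite -sum1_size sum1_card card_ord.
by exists M; apply: filterS2 fE MP => z ->.
Qed.

Lemma exprD_le_max (x y : R) K : 0 <= x -> 0 <= y ->
  (x + y) ^+ K <= 2 ^+ K * (x ^+ K + y ^+ K).
Proof.
move=> x0 y0; wlog xy : x y x0 y0 / x <= y => [H|].
  by have [/H->//|/ltW yx] := lerP x y; rewrite addrC [X in _ * X]addrC H.
apply: (@le_trans _ _ ((2 * y) ^+ K)); first by rewrite lerXn2r ?nnegrE; lra.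
by rewrite exprMn ler_wpM2l ?exprn_ge0// lerDr exprn_ge0.
Qed.

Lemma near_order_monomials N K f : (K <= N)%N -> near_order N f -> exists M : R,
  nbhs (0 : 'rV[C]_2) (fun z => cabs (f z) <= M * (cabs (z 0 0) ^+ K + cabs (z 0 1) ^+ K)).
Proof.
move=> KN /near_order_ge0[M M0 MP]; exists (M * 2 ^+ K).
have small : nbhs (0 : 'rV[C]_2) (fun z => cabs (z 0 0) + cabs (z 0 1) <= 1).
  apply/nbhs_row2P; exists (2^-1); first by rewrite invr_gt0.
  by move=> u v; rewrite row20 row21 !mxE !subr0; lra.
apply: filterS2 MP small => z H z1; apply: le_trans H _; rewrite -mulrA ler_wpM2l//.
have x0 := cabs_ge0 (z 0 0); have y0 := cabs_ge0 (z 0 1).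
apply: le_trans (exprD_le_max K x0 y0).
by rewrite ler_wiXn2l// addr_ge0.
Qed.

(** If no index K >= N occurred, N - 1 would bound the supremum. Infinite order is covered as
    well. *)
Lemma ord0_symdiff_ge m N (w : symdiff R 1) : (N%:R%:E <= ord0_symdiff m w)%E ->
  exists2 K, (N <= K)%N & in_max_ideal_pow m K w.
Proof.
move=> H; apply: contrapT => nK.
have : (ord0_symdiff m w <= (N%:R - 1)%:E)%E.
  apply: ge_ereal_sup => _ [i wi <-]; rewrite lee_fin lerBrDr natr1 ler_nat ltnNge.
  by apply/negP => Ni; apply: nK; exists i.
by move=> /(le_trans H); rewrite lee_fin lerDl oppr_ge0 lt_geF.
Qed.

Lemma max_ideal_pow_coefficients m K (w : symdiff R 1) : in_max_ideal_pow m K w ->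
  forall N, (N <= K)%N -> exists2 r : R, 0 < r & exists2 G : nat -> 'rV[C]_2 -> C,
    (forall z a b, in_box r z -> w z (row2 a b) = form_val m (G^~ z) a b) &
    exists M : nat -> R, forall l z, (l <= m)%N -> in_box r z ->
      cabs (G l z) <= M l * (cabs (z 0 0) ^+ N + cabs (z 0 1) ^+ N).
Proof.
move=> [f fK wf] N NK; pose G l := f (mono_exp m l).
have /choice[M MP] (l : nat) := near_order_monomials NK (near_order_max_ideal_pow (fK (mono_exp m l))).
have [r r0 rP] := (nbhs_row2P _ _).1 wf.
pose Q l : set 'rV[C]_2 := fun z => cabs (G l z) <= M l * (cabs (z 0 0) ^+ N + cabs (z 0 1) ^+ N).
pose P l (t : R) := forall z, in_box t z -> Q l z.
have inb (t : R) z (A : set 'rV[C]_2) : (forall u v, cabs (u - (0 : 'rV[C]_2) 0 0) < t ->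
    cabs (v - (0 : 'rV[C]_2) 0 1) < t -> A (row2 u v)) -> in_box t z -> A z.
  by move=> H [z0 z1]; rewrite (row2E z); apply: H; rewrite mxE subr0.
have [||t /andP[t0 tr] tP] := @finite_radius R m.+1 P r r0.
- by move=> l x y xy H z [z0 z1]; apply: H; split; exact: lt_le_trans xy.
- move=> l _; have [t t0 tP] := (nbhs_row2P _ _).1 (MP l).
  by exists t => // z; exact: (inb t z (Q l) tP).
exists t => //; exists G => [z a b [z0 z1]|].
  have zr : in_box r z by split; exact: lt_le_trans tr.
  have wz := inb r z (fun z => forall xi, w z xi = symform (f^~ z) (xi 0)) rP zr.
  by rewrite wz symform2E row20 row21.
by exists M => l z lm; exact: tP.
Qed.

End VanishingOrder.

(** * Pullback from the surface to the resolution *)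

Section SurfacePullback.
Variables (R : realType) (n m : nat).
Local Notation C := (Cplx R).
Implicit Types (p q z xi : 'rV[C]_2) (i j : 'I_n.+1) (U : set 'rV[C]_3).

Lemma differentiable_An_eq (x : 'rV[C]_3) : differentiable (@An_eq R n) x.
Proof.
have dc (l : 'I_3) : differentiable (fun y : 'rV[C]_3 => y 0 l : C) x by exact: differentiable_coord.
by apply: dfunB; [apply: dfunM; exact: dc|apply: dfunX; exact: dc].
Qed.

(** Chain rule for [An_eq \o sigma i], which vanishes identically: [sigma] maps tangent vectors to
    vectors tangent to the surface, where the local ambient forms represent [w]. *)
Lemma diff_An_eq_sigma i p xi : 'd (@An_eq R n) (sigma i p) ('d (@sigma R n i) p xi) = 0.
Proof.
have := diff_comp (@diff_sigma R n i p).1 (differentiable_An_eq (sigma i p)).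
have -> : @An_eq R n \o sigma i = cst 0 by apply/funext => q; exact: sigma_An_surface.
move=> /(congr1 (fun h => h xi)) E; apply: etrans (esym E) _.
exact: (congr1 (fun h => h xi) (@diff_cst C 'rV[C]_2 C 0 p)).
Qed.

Lemma diff_sigma_differentiable i p xi (l : 'I_3) :
  differentiable (fun q => ('d (@sigma R n i) q xi) 0 l : C) p.
Proof.
pose e : int * int := if l == 0 then (i.+1%:Z, i%:Z) else
  if l == 1 then (1, 1) else ((n - i)%:Z, (n.+1 - i)%:Z).
have -> : (fun q => ('d (@sigma R n i) q xi) 0 l : C) = (fun q => dmonomial e.1 e.2 q xi).
  apply/funext => q; rewrite (@diff_sigma R n i q).2 mxE /e.
  by case: l {e} => [[|[|[|//]]]].
apply: dmonomial_differentiable; rewrite /e /monomial_dom.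
by case: ifP => _; [|case: ifP => _]; split; right.
Qed.

Lemma surface_pullback U (w : symdiff R 2) i : (0 < n)%N -> open U ->
  holo_symdiff_surface n m ((An_surface n `&` U) `\ 0) w ->
  holo_symdiff m (resolution_off_exc n U i) (pullback (sigma i) w).
Proof.
move=> n0 oU hw.
have offA p : resolution_off_exc n U i p -> ((An_surface n `&` U) `\ 0) (sigma i p).
  move=> [Up nE]; split; first by split; [exact: sigma_An_surface|].
  by move=> s0; apply: nE; rewrite exc_locusE.
have local p : resolution_off_exc n U i p -> exists (B : set 'rV[C]_3) (eta : symdiff R 2),
    [/\ open B, B (sigma i p), holo_symdiff m B eta &
        forall q xi, B (sigma i q) -> resolution_off_exc n U i q ->
          pullback (sigma i) w q xi = pullback (sigma i) eta q xi].
  move=> /offA/hw[B [eta [oB Bp heta wE]]]; exists B, eta; split=> // q xi Bq offq.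
  by apply: wE => //; [exact: offA|exact: diff_An_eq_sigma].
apply/(holo_symdiffP _ _ (open_resolution_off_exc n0 oU)); split=> [p offp|p xi offp].
  have [B [eta [oB Bp heta wE]]] := local p offp.
  have := pullback_form heta Bp; apply: is_form_ext => x y.
  exact: esym (wE _ _ Bp offp).
have [B [eta [oB Bp heta wE]]] := local p offp.
have := pullback_differentiable oB heta Bp (@diff_sigma R n i p).1 (diff_sigma_differentiable i p xi).
apply: near_eq_differentiable.
have N1 := open_nbhs_nbhs (conj (@open_resolution_off_exc R n U i n0 oU) offp).
have N2 : nbhs p (resolution_over n B i).
  exact: (open_nbhs_nbhs (conj (@open_resolution_over R n B i oB) Bp)).
by apply: filterS2 N1 N2 => q offq Bq; exact: esym (wE _ _ Bq offq).
Qed.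

Lemma torus_tau_vec i p xi : torus p -> exists z a b,
  [/\ torus z, p = tau i z & xi = tau_vec i z a b].
Proof.
move=> tp; have [z tz zp] := tau_surj i tp.
have [a [b abE]] := @tau_log_surj R n i (xi 0 0 / p 0 0) (xi 0 1 / p 0 1).
exists z, a, b; split=> //; rewrite /tau_vec abE zp; exact: torus_vec.
Qed.

Lemma pullback_sigma_tau (w : symdiff R 2) i z a b : torus z ->
  pullback (sigma i) w (tau i z) (tau_vec i z a b) = pullback (An_smoothing n) w z (logvec z a b).
Proof.
move=> tz; have H1 := sigma_tau i tz; have H2 := diff_sigma_tau i a b tz.
by rewrite /pullback; congr (w _ _); [exact H1|exact H2].
Qed.

(** On the torus the pullbacks to two charts both agree, through [tau], with the pullback by the
    smoothing. *)
Lemma surface_pullback_compatible U (w : symdiff R 2) :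
  compatible (resolution_off_exc n U) (fun i => pullback (sigma i) w).
Proof.
apply: compatible_off_exc => i j p xi tp _.
have [z [a [b [tz -> ->]]]] := torus_tau_vec i xi tp.
have E := diff_transition_tau i j a b tz.
apply: etrans (pullback_sigma_tau w i a b tz) _.
apply: etrans (esym (pullback_sigma_tau w j a b tz)) _.
apply: esym; exact: (congr2 (pullback (sigma j) w) (transition_tau i j tz) E).
Qed.

End SurfacePullback.

Section ExtensionOverExceptionalLocus.
Variables (R : realType) (n m : nat).
Local Notation C := (Cplx R).
Implicit Types (p q z xi : 'rV[C]_2) (i j : 'I_n.+1) (U : set 'rV[C]_3).

(** Vanishing to order m along E absorbs the logarithmic poles: u^m (du/u)^l = u^(m-l) du^l and v^m
    (dv/v)^(m-l) = v^l dv^(m-l). *)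
Lemma extension_of_log_growth U i (w : symdiff R 1) : (0 < n)%N -> open U -> U 0 ->
  holo_symdiff m (resolution_off_exc n U i) w ->
  (forall p0, exc_locus i p0 ->
     log_growth i (if (i < n)%N then m else 0%N) (if (0 < i)%N then m else 0%N) w p0) ->
  exists2 s, holo_symdiff m (resolution_over n U i) s &
    forall p xi, resolution_off_exc n U i p -> s p xi = w p xi.
Proof.
move=> n0 oU U0 hw growth.
have [||f fh fE] := log_extension n0 oU U0 _ _ hw growth; try by move=> ->; rewrite ltnn.
pose c l p : C := f (mono_exp m l) p * ((if (i < n)%N then p 0 0 ^+ (m - l) else 1) *
                                    (if (0 < i)%N then p 0 1 ^+ l else 1)).
exists (fun p xi => form_val m (c^~ p) (xi 0 0) (xi 0 1)).
  apply/(holo_symdiffP _ _ (open_resolution_over oU)); split=> [p Up|p xi Up].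
    by exists (c^~ p) => x y; rewrite row20 row21.
  have dc (l : 'I_2) : differentiable (fun q : 'rV[C]_2 => q 0 l : C) p by exact: differentiable_coord.
  apply: dfun_sum => l _; apply: dfunM; last exact: dfun_cst.
  apply: dfunM; first exact: fh.
  apply: dfunM.
    by case: (i < n)%N => /=; [apply: dfunX; exact: dc|exact: dfun_cst].
  by case: (0 < i)%N => /=; [apply: dfunX; exact: dc|exact: dfun_cst].
move=> p xi offp; rewrite fE// symform2E.
have := log_coframe_row2 i p (xi 0 0) (xi 0 1); rewrite -row2E => -[-> ->].
rewrite form_val_scale form_valZ; apply: eq_bigr => l _; congr (_ * _); rewrite /c.
have lm : (l <= m)%N by rewrite -ltnS.
have [_ p0 p1] := (off_excP _ _ _).1 offp.
have -> : (if (i < n)%N then p 0 0 ^+ (m - l) else 1) =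
    p 0 0 ^+ (if (i < n)%N then m else 0) * (if (i < n)%N then (p 0 0)^-1 else 1) ^+ l.
  case: (i < n)%N p0 => [/(_ isT) p0|_]; last by rewrite expr0 expr1n mulr1.
  have -> : p 0 0 ^+ m = p 0 0 ^+ (m - l) * p 0 0 ^+ l by rewrite -exprD subnK.
  by rewrite exprVn mulfK// expf_neq0.
have -> : (if (0 < i)%N then p 0 1 ^+ l else 1) =
    p 0 1 ^+ (if (0 < i)%N then m else 0) * (if (0 < i)%N then (p 0 1)^-1 else 1) ^+ (m - l).
  case: (0 < i)%N p1 => [/(_ isT) p1|_]; last by rewrite expr0 expr1n mulr1.
  have -> : p 0 1 ^+ m = p 0 1 ^+ l * p 0 1 ^+ (m - l) by rewrite -exprD subnKC.
  by rewrite exprVn mulfK// expf_neq0.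
by ring.
Qed.

Lemma near_overlap i j p : overlap i j p -> nbhs p (overlap i j : set 'rV[C]_2).
Proof.
move=> [hu hv].
have N0 : nbhs p (fun q : 'rV[C]_2 => (j < i)%N || (i.+1 < j)%N -> q 0 0 != 0).
  case: (_ || _) hu => [/(_ isT)/near_coord_neq0 H|_]; first by apply: filterS H.
  by apply/nbhs_row2P; exists 1.
have N1 : nbhs p (fun q : 'rV[C]_2 => (i < j)%N || (j.+1 < i)%N -> q 0 1 != 0).
  case: (_ || _) hv => [/(_ isT)/near_coord_neq0 H|_]; first by apply: filterS H.
  by apply/nbhs_row2P; exists 1.
by apply: filterS2 N0 N1 => q H0 H1; split.
Qed.

Lemma diff_transition_differentiable i j p xi (l : 'I_2) : overlap i j p ->
  differentiable (fun q => ('d (transition i j) q xi) 0 l : C) p.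
Proof.
move=> ov; pose e : int * int := if l == 0 then (i.+1%:Z - j%:Z, i%:Z - j%:Z) else (j%:Z - i%:Z, j.+1%:Z - i%:Z).
have de : differentiable (fun q => dmonomial e.1 e.2 q xi) p.
  have [hu hv] := overlapP ov.
  by apply: dmonomial_differentiable; rewrite /e; case: ifP => _; split;
    [case: hu|case: hv|case: hu|case: hv] => H; by [left|right => /=; lia].
apply: near_eq_differentiable de; apply: filterS (near_overlap ov) => q ovq.
by rewrite (diff_transition ovq).2 mxE /e; case: l {e} => [[|[|//]]].
Qed.

(** Both sides of the gluing condition are continuous on the overlap and agree on its dense torus,
    where [s] equals [w]. *)
Lemma compatible_by_density U (w s : 'I_n.+1 -> symdiff R 1) : (0 < n)%N -> open U ->
  (forall i, holo_symdiff m (resolution_over n U i) (s i)) ->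
  (forall i p xi, resolution_off_exc n U i p -> s i p xi = w i p xi) ->
  compatible (resolution_off_exc n U) w -> compatible (resolution_over n U) s.
Proof.
move=> n0 oU hs sw cw i j p xi Up ov.
have Uj : resolution_over n U j (transition i j p).
  by rewrite /resolution_over /= sigma_transition.
have ds := ((holo_symdiffP _ _ (open_resolution_over oU)).1 (hs i)).2 p xi Up.
have dt := pullback_differentiable (open_resolution_over oU) (hs j) Uj (diff_transition ov).1
  (fun l => diff_transition_differentiable xi l ov).
apply: (@eq_of_dense _ (fun q => s i q xi) (fun q => pullback (transition i j) (s j) q xi) p 0 0 0 0).
- exact: differentiable_continuous.
- exact: differentiable_continuous.
have NU := open_nbhs_nbhs (conj (@open_resolution_over R n U i oU) Up).
apply: filterS NU => q Uq q0 _ q1 _; have tq : torus q by [].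
have tt : torus (transition i j q).
  by rewrite /torus /= row20 row21; split; exact: monomial_neq0.
rewrite sw; last exact: torus_off_exc.
apply: etrans (cw i j q xi (torus_off_exc n0 tq Uq) (torus_overlap i j tq)) _.
have Utt : U (sigma j (transition i j q)) by rewrite sigma_transition//; exact: torus_overlap.
exact: esym (sw j (transition i j q) ('d (transition i j) q xi) (torus_off_exc n0 tt Utt)).
Qed.

End ExtensionOverExceptionalLocus.

(** The vanishing order bounds the coefficients of [wbar] by |z1|^(n m) + |z2|^(n m); multiplication
    by z1^l z2^(m-l) gives logarithmic coefficients of degree (n + 1) m, as
    [extension_of_log_growth] requires. *)
Lemma extension_of_vanishing_order (R : realType) (n m : nat) (U : set 'rV[Cplx R]_3)
    (w : symdiff R 2) (wbar : symdiff R 1) :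
  (0 < n)%N -> open U -> U 0 ->
  holo_symdiff_surface n m ((An_surface n `&` U) `\ 0) w ->
  (forall z xi, U (An_smoothing n z) -> z != 0 ->
     wbar z xi = pullback (An_smoothing n) w z xi) ->
  (((n * m)%:R)%:E <= ord0_symdiff m wbar)%E ->
  exists2 s : 'I_n.+1 -> symdiff R 1,
    sections m (resolution_over n U) s &
    forall i p xi, resolution_off_exc n U i p -> s i p xi = pullback (sigma i) w p xi.
Proof.
move=> n0 oU U0 hw wE /ord0_symdiff_ge[K KN /max_ideal_pow_coefficients/(_ _ KN)].
move=> [r r0 [G wG [M GM]]].
have [t t0 tU] := @smoothing_box R n U oU U0.
pose e : R := Num.min r t; have e0 : 0 < e by rewrite lt_min r0.
have er z : in_box e z -> in_box r z by rewrite /in_box !lt_min => -[/andP[-> _] /andP[-> _]].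
have et z : in_box e z -> in_box t z by rewrite /in_box !lt_min => -[/andP[_ ->] /andP[_ ->]].
have pE (i : 'I_n.+1) z a b : torus z -> in_box e z -> pullback (sigma i) w (tau i z) (tau_vec i z a b) =
    form_val m (G^~ z) (z 0 0 * a) (z 0 1 * b).
  move=> tz ze; have zU : U (An_smoothing n z) by apply: tU; exact: et.
  have z0 : z != 0 by apply/eqP => z00; case: tz; rewrite z00 mxE eqxx.
  have E0 := pullback_sigma_tau w i a b tz.
  have E1 := wE z (logvec z a b) zU z0.
  have E2 := wG z (z 0 0 * a) (z 0 1 * b) (er z ze).
  exact (etrans E0 (etrans (esym E1) E2)).
pose N := (n * m)%N.
pose S l : seq (nat * nat) := [:: ((N + l)%N, (m - l)%N); (l, (N + (m - l))%N)].
have growth (i : 'I_n.+1) p0 : exc_locus i p0 -> log_growth i (if (i < n)%N then m else 0%N)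
    (if (0 < i)%N then m else 0%N) (pullback (sigma i) w) p0.
  have le_i := le_chart i.
  apply: (@log_growth_of_bound R n m i _ _ _ G S M e p0 n0 e0) => [z a b|l x lm|l z lm tz ze]; first exact: pE.
    (* On an exceptional curve both weights are at least 1, so the weighted degree is at least the
       degree N + m = (n + 1) m. *)
    have key X Y a b : (0 < a)%N -> (0 < b)%N -> (X + Y = N + m -> n.+1 * m <= X * a + Y * b)%N.
      move=> a0 b0 XY; have -> : (n.+1 * m = X + Y)%N by rewrite XY /N mulSn addnC.
      by rewrite leq_add// leq_pmulr.
    have N1 : (N + l + (m - l) = N + m)%N by rewrite -addnA subnKC.
    have N2 : (l + (N + (m - l)) = N + m)%N by rewrite addnCA subnKC.
    rewrite !inE => /orP[|] /eqP -> /=; split=> /=.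
    - by case: ifP => [lt_in|_]; rewrite ?muln0//; apply: key => //; rewrite subn_gt0.
    - by case: ifP => [i0|_]; rewrite ?muln0//; apply: key => //; rewrite subn_gt0.
    - by case: ifP => [lt_in|_]; rewrite ?muln0//; apply: key => //; rewrite subn_gt0.
    - by case: ifP => [i0|_]; rewrite ?muln0//; apply: key => //; rewrite subn_gt0.
  rewrite cabsM (le_trans (ler_wpM2r _ (GM _ _ lm (er _ ze))))// ?cabs_ge0//.
  rewrite !big_cons big_nil addr0 /= -mulrA cabsM !cabsX !exprD.
  by rewrite le_eqVlt; apply/orP; left; apply/eqP; ring.
have /choice[s sP] (i : 'I_n.+1) : exists s, holo_symdiff m (resolution_over n U i) s /\
    forall p xi, resolution_off_exc n U i p -> s p xi = pullback (sigma i) w p xi.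
  have [s hs sE] := extension_of_log_growth n0 oU U0 (surface_pullback i n0 oU hw) (@growth i).
  by exists s.
exists s; last by move=> i; exact: (sP i).2.
split=> [i|]; first exact: (sP i).1.
apply: (compatible_by_density n0 oU (fun i => (sP i).1) (fun i => (sP i).2)).
exact: surface_pullback_compatible.
Qed.

Theorem theorem3 (R : realType) (n m : nat) (U : set 'rV[Cplx R]_3)
    (n_ge1 : (1 <= n)%N) (openU : open U) (U0 : U 0) :
  (sections m (resolution_off_exc n U) = log_sections m (max_divisor n m) U /\
   forall D : exc_divisor n,
     sections m (resolution_off_exc n U) = log_sections m D U ->
     forall r : 'I_n, D r <= max_divisor n m r) /\
  (forall (w : symdiff R 2) (wbar : symdiff R 1),
     holo_symdiff_surface n m ((An_surface n `&` U) `\ 0) w ->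
     holo_symdiff m (An_smoothing n @^-1` U) wbar ->
     (forall z xi, U (An_smoothing n z) -> z != 0 ->
        wbar z xi = pullback (An_smoothing n) w z xi) ->
     (((n * m)%:R)%:E <= ord0_symdiff m wbar)%E ->
     exists2 s : 'I_n.+1 -> symdiff R 1,
       sections m (resolution_over n U) s &
       forall i p xi, resolution_off_exc n U i p ->
         s i p xi = pullback (sigma i) w p xi).
Proof.
split; first split.
- apply/seteqP; split=> w; first exact: sections_log_sections.
  exact: log_sections_sections.
- by move=> D; exact: log_sections_maximal.
move=> w wbar hw _; exact: extension_of_vanishing_order.
Qed.
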